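(* (i) If $1 \le q \le p < 2$, then \[ \mathcal{KS}_q(X) = \overline{\mathcal{KS}_q(X)} = \mathcal K(X) \] for any closed subspace $X \subset \ell^p$. (ii) Suppose that $1 \le p, q < 2$ and $p \neq q$. Then there are closed subspaces $X \subset \ell^p$ and $Y \subset \ell^q$ for which $\mathcal A(X,Y) \subsetneq \mathcal K(X,Y)$. (iii) For $1 \le p < q < 2$ there is a closed subspace $X \subset \ell^p$ such that the quotient algebra \[ \overline{\mathcal{KS}_q(X)}/\mathcal A(X) \] is non-nilpotent and infinite-dimensional.
   Context: Banach spaces are real or complex. $\mathcal K(X,Y)$ denotes the compact operators $X\to Y$, and $\mathcal A(X,Y)$ the operator norm closure of the bounded finite-rank operators $X\to Y$; one writes $\mathcal K(X)=\mathcal K(X,X)$, etc. For $r\in[1,\infty)$, $\mathcal{KS}_r(X,Y)$ is the class of operators that factor compactly through a closed subspace of $\ell^r$: $T\in\mathcal{KS}_r(X,Y)$ if there are a closed subspace $Z\subset\ell^r$ and compact operators $A\in\mathcal K(X,Z)$, $B\in\mathcal K(Z,Y)$ with $T=BA$. One writes $\mathcal{KS}_r(X)=\mathcal{KS}_r(X,X)$, and $\overline{\mathcal{KS}_r(X)}$ is its closure in the operator norm. This closure is a closed two-sided ideal of $\mathcal L(X)$ (the bounded operators on $X$) with $\mathcal A(X)\subset\overline{\mathcal{KS}_r(X)}\subset\mathcal K(X)$. A Banach algebra $A$ is nilpotent if there is $m\in\mathbb N$ such that $x_1\cdots x_m=0$ for all $x_1,\dots,x_m\in A$. *)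

(* Defs.v *)
From HB Require Import structures.
From mathcomp Require Import all_boot all_order all_algebra.
From mathcomp Require Import complex.
From mathcomp Require Import all_classical all_reals all_analysis.

Set Implicit Arguments.
Unset Strict Implicit.
Unset Printing Implicit Defensive.

Import Order.TTheory GRing.Theory Num.Theory.
Import numFieldNormedType.Exports.

Local Open Scope classical_set_scope.
Local Open Scope ring_scope.

Variant scalars := RealScalars | ComplexScalars.

Definition scalar (R : realType) (s : scalars) : numFieldType :=
  match s with RealScalars => R | ComplexScalars => R[i] end.

(* The norm of a [normedModType K] takes its values in [K] itself; [modulus]
   and [of_real] translate between such values and real numbers. *)
Definition modulus (R : realType) (s : scalars) : scalar R s -> R :=
  match s with RealScalars => fun x => `|x| | ComplexScalars => @Normc.normc R end.

Definition of_real (R : realType) (s : scalars) : R -> scalar R s :=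
  match s with RealScalars => id | ComplexScalars => real_complex R end.

Section scalar_theory.
Variables (R : realType) (s : scalars).
Local Notation K := (scalar R s).
Local Notation modulus := (@modulus R s).
Local Notation of_real := (@of_real R s).

Lemma of_real_modulus (x : K) : of_real (modulus x) = `|x|.
Proof. by case: s x. Qed.

Lemma of_realD x y : of_real (x + y) = of_real x + of_real y.
Proof. by case: s => //=; rewrite rmorphD. Qed.

Lemma of_realM x y : of_real (x * y) = of_real x * of_real y.
Proof. by case: s => //=; rewrite rmorphM. Qed.

Lemma of_real0 : of_real 0 = 0.
Proof. by case: s. Qed.

Lemma ler_of_real x y : (of_real x <= of_real y) = (x <= y).
Proof. by case: s => //=; rewrite lecR. Qed.

Lemma of_real_inj : injective of_real.
Proof. by case: s => //= x y []. Qed.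

Lemma modulus_of_real x : 0 <= x -> modulus (of_real x) = x.
Proof.
move=> x0; apply: of_real_inj; rewrite of_real_modulus ger0_norm//.
by rewrite -of_real0 ler_of_real.
Qed.

Lemma modulus_ge0 x : 0 <= modulus x.
Proof. by rewrite -ler_of_real of_real0 of_real_modulus. Qed.

Lemma modulusM x y : modulus (x * y) = modulus x * modulus y.
Proof. by apply: of_real_inj; rewrite of_realM !of_real_modulus normrM. Qed.

Lemma modulus0 : modulus 0 = 0.
Proof. by apply: of_real_inj; rewrite of_real_modulus of_real0 normr0. Qed.

Lemma modulus1 : modulus 1 = 1.
Proof.
by apply: of_real_inj; rewrite of_real_modulus normr1; case: s.
Qed.

Lemma modulus_eq0 x : modulus x = 0 -> x = 0.
Proof.
by move=> x0; apply: normr0_eq0; rewrite -of_real_modulus x0 of_real0.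
Qed.

Lemma ler_modulusD x y : modulus (x + y) <= modulus x + modulus y.
Proof. by rewrite -ler_of_real of_realD !of_real_modulus ler_normD. Qed.

Lemma ge0_of_real (x : K) : 0 <= x -> x = of_real (modulus x).
Proof. by move=> x0; rewrite of_real_modulus ger0_norm. Qed.

End scalar_theory.

Lemma ler_poweRV (R : realType) (r : R) (x y : \bar R) :
  0 < r -> (0 <= x)%E -> (x <= y)%E -> (x `^ r^-1 <= y `^ r^-1)%E.
Proof.
move=> r0 x0 xy; have rV : 0 <= r^-1 by rewrite invr_ge0 ltW.
by apply: (gt0_ler_poweR rV) => //; rewrite in_itv/= leey andbT// (le_trans x0).
Qed.

Section ell_enorm.
Variables (R : realType) (s : scalars) (r : R).
Local Notation K := (scalar R s).
Implicit Types x y : nat -> K^o.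

Definition ell_enorm x : \bar R :=
  ((\sum_(n <oo) (modulus (x n) `^ r)%:E) `^ r^-1)%E.

Definition ell_mem : {pred nat -> K^o} :=
  mem [set x | (ell_enorm x < +oo)%E].

Lemma ell_enorm_ge0 x : (0 <= ell_enorm x)%E.
Proof. exact: poweR_ge0. Qed.

Lemma ell_term_ge0 x n : (0 <= (modulus (x n) `^ r)%:E)%E.
Proof. by rewrite lee_fin powR_ge0. Qed.

Hypothesis r1 : 1 <= r.
Let r_gt0 : 0 < r. Proof. exact: lt_le_trans r1. Qed.

Lemma ell_enormE x :
  ell_enorm x = 'N[counting]_r%:E[EFin \o (fun n => modulus (x n))]%E.
Proof.
rewrite Lnorm_counting//; congr (_ `^ _)%E.
by apply: eq_eseriesr => n _ /=; rewrite ger0_norm// modulus_ge0.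
Qed.

Lemma ell_enorm0 : ell_enorm 0 = 0%E.
Proof.
rewrite /ell_enorm eseries0 ?poweR0r// ?invr_eq0 ?gt_eqF//.
by move=> n _ _ /=; rewrite modulus0 powR0// gt_eqF.
Qed.

Lemma le_ell_enorm x y : (forall n, modulus (x n) <= modulus (y n)) ->
  (ell_enorm x <= ell_enorm y)%E.
Proof.
move=> xy; apply: ler_poweRV => //.
- by apply: nneseries_ge0 => n _ _; exact: ell_term_ge0.
- apply: lee_nneseries => [n _ _|n _]; first exact: ell_term_ge0.
  by rewrite lee_fin ge0_ler_powR ?nnegrE ?modulus_ge0// ltW.
Qed.

Lemma ell_enormD x y : (ell_enorm (x + y)%R <= ell_enorm x + ell_enorm y)%E.
Proof.
have mE (f : nat -> R) : measurable_fun setT f by [].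
rewrite !ell_enormE.
apply: le_trans (minkowski_EFin counting (mE _) (mE _) r1).
rewrite !Lnorm_counting//; apply: ler_poweRV => //.
- by apply: nneseries_ge0 => n _ _; exact: poweR_ge0.
- apply: lee_nneseries => [n _ _|n _]; first exact: poweR_ge0.
  rewrite /= lee_fin ge0_ler_powR ?nnegrE ?normr_ge0 ?(ltW r_gt0)//.
  by rewrite !ger0_norm ?addr_ge0 ?modulus_ge0//; exact: ler_modulusD. 
Qed.

Lemma ell_enormZ a x : ell_enorm (a *: x) = ((modulus a)%:E * ell_enorm x)%E.
Proof.
rewrite /ell_enorm.
have -> : (\sum_(n <oo) (modulus ((a *: x) n) `^ r)%:E =
    (modulus a `^ r)%:E * \sum_(n <oo) (modulus (x n) `^ r)%:E)%E.
  rewrite -nneseriesZl => [|n _]; last exact: ell_term_ge0.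
  by apply: eq_eseriesr => n _; rewrite modulusM powRM ?modulus_ge0// EFinM.
rewrite poweRM ?nneseries_ge0//; first last.
- by move=> n _ _; exact: ell_term_ge0.
- by rewrite lee_fin powR_ge0.
by rewrite poweR_EFin -powRrM mulfV ?gt_eqF// powRr1// modulus_ge0.
Qed.

Lemma ell_enorm_eq0 x : ell_enorm x = 0%E -> x = 0.
Proof.
move=> /poweR_eq0_eq0 x0; apply/funext => n; apply: modulus_eq0.
have : ((modulus (x n) `^ r)%:E <= 0)%E.
  rewrite -x0 ?nneseries_ge0//; last by move=> k _ _; exact: ell_term_ge0.
  rewrite (nneseriesD1 (n := n))//; last by move=> k _; exact: ell_term_ge0.
  by rewrite leeDl// nneseries_ge0// => k _ _; exact: ell_term_ge0.
rewrite lee_fin => xn0.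
have /eqP : modulus (x n) `^ r = 0 by apply/le_anti; rewrite xn0 powR_ge0.
by rewrite powR_eq0 => /andP[/eqP].
Qed.

Lemma ell_memE x : (x \in ell_mem) = (ell_enorm x < +oo)%E.
Proof. by apply/idP/idP; rewrite inE. Qed.

Lemma ell_subsemimod_closed : GRing.subsemimod_closed ell_mem.
Proof.
split; first split; rewrite ?ell_memE ?ell_enorm0//.
- move=> x y; rewrite !ell_memE => x_fin y_fin.
  by rewrite (le_lt_trans (ell_enormD _ _))// lte_add_pinfty.
- move=> a x; rewrite !ell_memE ell_enormZ => x_fin.
  by rewrite lte_mul_pinfty// ?lee_fin ?modulus_ge0.
Qed.

End ell_enorm.

(* [r1] is a parameter of the type because the norm axioms depend on it. *)
Record ell (R : realType) (s : scalars) (r : R) (r1 : 1 <= r) := Ell {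
  ell_val :> nat -> (scalar R s)^o ;
  ell_valP : ell_val \in ell_mem r }.
Arguments ell {R} s {r} r1.

Section ell.
Variables (R : realType) (s : scalars) (r : R) (r1 : 1 <= r).
Local Notation K := (scalar R s).
Local Notation ell := (ell s r1).

HB.instance Definition _ := [isSub for @ell_val R s r r1].
HB.instance Definition _ := [Choice of ell by <:].
HB.instance Definition _ :=
  GRing.SubChoice_isSubLmodule.Build K (nat -> K^o) (@ell_mem R s r) ell
    (ell_subsemimod_closed s r1).

Definition ell_norm (x : ell) : K := of_real s (fine (ell_enorm r x)).

Let ell_fin (x : ell) : ell_enorm r x \is a fin_num.
Proof. by rewrite ge0_fin_numE ?ell_enorm_ge0// -ell_memE ell_valP. Qed.

Lemma ler_ell_normD x y : ell_norm (x + y) <= ell_norm x + ell_norm y.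
Proof.
rewrite -of_realD ler_of_real -fineD ?ell_fin// fine_le ?ell_fin//.
- by rewrite fin_numD !ell_fin.
- exact: ell_enormD.
Qed.

Lemma ell_normZ a x : ell_norm (a *: x) = `|a| * ell_norm x.
Proof.
by rewrite -of_real_modulus -of_realM /ell_norm ell_enormZ// fineM// ell_fin.
Qed.

Lemma ell_norm0_eq0 x : ell_norm x = 0 -> x = 0.
Proof.
move=> x0; suff xE : (x : nat -> K^o) = 0 by apply: val_inj; rewrite [LHS]xE.
apply: (@ell_enorm_eq0 R s r).
rewrite -(fineK (ell_fin x)); congr EFin; apply: (@of_real_inj R s).
by rewrite of_real0.
Qed.

HB.instance Definition _ :=
  Lmodule_isNormed.Build K ell ler_ell_normD ell_normZ ell_norm0_eq0.

End ell.

Record closedSubspace (K : numFieldType) (V : normedModType K) :=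
  ClosedSubspace {
    subspace_pred : {pred V} ;
    subspace_submod : GRing.submod_closed subspace_pred ;
    subspace_closed : closed [set x | x \in subspace_pred] }.

Record subspace_of (K : numFieldType) (V : normedModType K)
    (X : closedSubspace V) := SubspaceOf {
  subspace_val :> V ;
  subspace_valP : subspace_val \in subspace_pred X }.

Section subspace_of.
Variables (K : numFieldType) (V : normedModType K) (X : closedSubspace V).

HB.instance Definition _ := [isSub for @subspace_val K V X].
HB.instance Definition _ := [Choice of subspace_of X by <:].
HB.instance Definition _ :=
  GRing.SubChoice_isSubLmodule.Build K V (subspace_pred X) (subspace_of X)
    (GRing.submod_closed_semi (subspace_submod X)).

Definition subspace_norm (x : subspace_of X) : K := `|subspace_val x|.

Lemma ler_subspace_normD x y :
  subspace_norm (x + y) <= subspace_norm x + subspace_norm y.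
Proof. exact: ler_normD. Qed.

Lemma subspace_normZ a x : subspace_norm (a *: x) = `|a| * subspace_norm x.
Proof. exact: normrZ. Qed.

Lemma subspace_norm0_eq0 x : subspace_norm x = 0 -> x = 0.
Proof. by move=> /normr0_eq0 x0; apply: val_inj; rewrite [LHS]x0. Qed.

HB.instance Definition _ := Lmodule_isNormed.Build K (subspace_of X)
  ler_subspace_normD subspace_normZ subspace_norm0_eq0.

Definition subspace_normedMod : normedModType K := subspace_of X.

End subspace_of.
Coercion subspace_normedMod : closedSubspace >-> NormedModule.type.

Section bounded_linear.
Variables (K : numFieldType) (X Y : normedModType K).

Definition bounded_linear : {pred X -> Y} :=
  mem [set f | linear f /\ exists M, forall x, `|f x| <= M * `|x|].

Lemma bounded_linearP (f : X -> Y) : reflect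
  (linear f /\ exists M, forall x, `|f x| <= M * `|x|) (f \in bounded_linear).
Proof. by apply: (iffP idP); rewrite inE. Qed.

Lemma bounded_linear_subsemimod_closed : GRing.subsemimod_closed bounded_linear.
Proof.
split; first split.
- apply/bounded_linearP; split=> [a x y|].
    by rewrite -[RHS]/(a *: 0 + 0) scaler0 addr0.
  by exists 0 => x; rewrite mul0r normr_le0.
- move=> f g /bounded_linearP[lf [M fM]] /bounded_linearP[lg [N gN]].
  apply/bounded_linearP; split=> [a x y|].
    rewrite -![(f + g) _]/(f _ + g _) lf lg scalerDr.
    by rewrite !addrA; congr (_ + _); rewrite addrAC.
  exists (M + N) => x; rewrite mulrDl.
  by rewrite (le_trans (ler_normD _ _))// lerD.
- move=> a f /bounded_linearP[lf [M fM]].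
  apply/bounded_linearP; split=> [b x y|].
    by rewrite -![(a *: f) _]/(a *: f _) lf scalerDr !scalerA mulrC.
  exists (`|a| * M) => x.
  by rewrite -[(a *: f) x]/(a *: f x) normrZ -mulrA ler_wpM2l.
Qed.

End bounded_linear.
Arguments bounded_linear {K} X Y.

Record bop (K : numFieldType) (X Y : normedModType K) := Bop {
  bop_val :> X -> Y ;
  bop_valP : bop_val \in bounded_linear X Y }.

Section bop_lmod.
Variables (K : numFieldType) (X Y : normedModType K).
Implicit Types S T : bop X Y.

HB.instance Definition _ := [isSub for @bop_val K X Y].
HB.instance Definition _ := [Choice of bop X Y by <:].
HB.instance Definition _ :=
  GRing.SubChoice_isSubLmodule.Build K (X -> Y) (bounded_linear X Y) (bop X Y)
    (@bounded_linear_subsemimod_closed K X Y).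

Lemma bopP S T : (forall x, S x = T x) -> S = T.
Proof. by move=> ST; apply/val_inj/funext. Qed.

Lemma bop_linear T : linear T.
Proof. by case/bounded_linearP: (bop_valP T). Qed.

Lemma bop_bounded T : exists2 M, 0 <= M & forall x, `|T x| <= M * `|x|.
Proof.
have [_ [M TM]] := bounded_linearP _ (bop_valP T).
have [X0|/existsNP[x x0]] := pselect (forall x : X, x = 0).
  by exists 0 => // x; rewrite mul0r -(mulr0 M) -(normr0 X) -(X0 x).
exists M => //; rewrite -(pmulr_lge0 M (x := `|x|)) ?(le_trans _ (TM x))//.
by rewrite normr_gt0; apply/eqP.
Qed.

HB.instance Definition _ T := GRing.isLinear.Build K X Y _ T (bop_linear T).

Lemma bop_continuous T : continuous T.
Proof.
apply: (@bounded_linear_continuous K X Y T); apply/linear_boundedP.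
have [M M0 TM] := bop_bounded T.
near=> r => x; apply: (le_trans (TM x)); rewrite ler_wpM2r//.
by near: r; apply: nbhs_pinfty_ge; rewrite ger0_real.
Unshelve. all: by end_near. Qed.

Lemma bopDE S T x : (S + T) x = S x + T x. Proof. by []. Qed.
Lemma bopZE a T x : (a *: T) x = a *: T x. Proof. by []. Qed.
Lemma bop0E x : (0 : bop X Y) x = 0. Proof. by []. Qed.
Lemma bopBE S T x : (S - T) x = S x - T x. Proof. by []. Qed.

End bop_lmod.

Section bop_comp.
Variables (K : numFieldType) (X Y Z : normedModType K).

Lemma bop_comp_subproof (S : bop Y Z) (T : bop X Y) :
  S \o T \in bounded_linear X Z.
Proof.
apply/bounded_linearP; split=> [a x y|]; first by rewrite /= !linearP.
have [M M0 SM] := bop_bounded S; have [N N0 TN] := bop_bounded T.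
exists (M * N) => x /=.
by rewrite (le_trans (SM _))// -mulrA ler_wpM2l.
Qed.

Definition bop_comp (S : bop Y Z) (T : bop X Y) : bop X Z :=
  Bop (bop_comp_subproof S T).

End bop_comp.

Section bop_norm.
Variables (R : realType) (s : scalars).
Local Notation K := (scalar R s).
Local Notation modulus := (@modulus R s).
Local Notation of_real := (@of_real R s).
Variables (X Y : normedModType K).
Implicit Types S T : bop X Y.

Definition opnorm T : R := sup [set modulus `|T x| | x in [set x | `|x| <= 1]].

Lemma opnorm_ball T x : `|x| <= 1 -> `|T x| <= of_real (opnorm T).
Proof.
move=> x1; rewrite [leLHS]ge0_of_real// ler_of_real.
apply: sup_upper_bound; last by exists x.
split; first by exists (modulus `|T x|), x.
have [M M0 TM] := bop_bounded T; exists (modulus M) => _ [y y1 <-].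
rewrite -(ler_of_real s) -!ge0_of_real// (le_trans (TM y))//.
by rewrite -[leRHS]mulr1 ler_wpM2l.
Qed.

Lemma opnorm_ge0 T : 0 <= opnorm T.
Proof.
rewrite -(ler_of_real s) of_real0 (le_trans _ (opnorm_ball T (x := 0) _))//.
by rewrite normr0.
Qed.

Lemma ler_opnorm T x : `|T x| <= of_real (opnorm T) * `|x|.
Proof.
have [->|x0] := eqVneq x 0; first by rewrite linear0 !normr0 mulr0.
have := @opnorm_ball T (`|x|^-1 *: x); rewrite normfZV// => /(_ (lexx _)).
rewrite linearZ/= normrZ normfV normr_id mulrC ler_pdivrMr//.
by rewrite normr_gt0.
Qed.

Lemma opnorm_le T (M : R) : 0 <= M ->
  (forall x, `|T x| <= of_real M * `|x|) -> opnorm T <= M.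
Proof.
move=> M0 TM; apply: ge_sup; first by exists (modulus `|T 0|), 0 => //=; rewrite normr0.
move=> _ [x x1 <-]; rewrite -(ler_of_real s) -ge0_of_real// (le_trans (TM x))//.
by rewrite -[leRHS]mulr1 ler_wpM2l// -of_real0 ler_of_real.
Qed.

Definition bop_norm T : K := of_real (opnorm T).

Lemma ler_bop_normD S T : bop_norm (S + T) <= bop_norm S + bop_norm T.
Proof.
rewrite -of_realD ler_of_real opnorm_le ?addr_ge0 ?opnorm_ge0// => x.
by rewrite of_realD mulrDl (le_trans (ler_normD _ _))// lerD// ler_opnorm.
Qed.

Lemma bop_normZ a T : bop_norm (a *: T) = `|a| * bop_norm T.
Proof.
have le_opnormZ b S : opnorm (b *: S) <= modulus b * opnorm S.
  apply: opnorm_le => [|x]; first by rewrite mulr_ge0 ?modulus_ge0 ?opnorm_ge0.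
  rewrite bopZE normrZ of_realM of_real_modulus -mulrA.
  by rewrite ler_wpM2l// ler_opnorm.
rewrite -of_real_modulus -of_realM; congr of_real; apply/le_anti.
rewrite le_opnormZ/=; have [->|a0] := eqVneq a 0.
  by rewrite modulus0 mul0r opnorm_ge0.
rewrite -{1}[T](scalerK a0).
apply: (@le_trans _ _ (modulus a * (modulus a^-1 * opnorm (a *: T)))).
  by rewrite ler_wpM2l ?modulus_ge0// le_opnormZ.
by rewrite mulrA -modulusM mulfV// modulus1 mul1r.
Qed.

Lemma bop_norm0_eq0 T : bop_norm T = 0 -> T = 0.
Proof.
move=> T0; apply: bopP => x; apply: normr0_eq0; apply: le_anti.
by rewrite normr_ge0 andbT (le_trans (ler_opnorm T x))// [of_real _]T0 mul0r.
Qed.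

HB.instance Definition _ :=
  Lmodule_isNormed.Build K (bop X Y) ler_bop_normD bop_normZ bop_norm0_eq0.

Lemma bop_normE T : `|T| = of_real (opnorm T). Proof. by []. Qed.

Lemma ler_bop_norm T x : `|T x| <= `|T| * `|x|.
Proof. exact: ler_opnorm. Qed.

Lemma bop_norm_le T (M : K) : 0 <= M ->
  (forall x, `|T x| <= M * `|x|) -> `|T| <= M.
Proof.
move=> M0 TM; rewrite (ge0_of_real M0) bop_normE ler_of_real.
by apply: opnorm_le; rewrite ?modulus_ge0// -ge0_of_real.
Qed.

End bop_norm.

Lemma ler_bop_comp (R : realType) (s : scalars)
    (X Y Z : normedModType (scalar R s)) (S : bop Y Z) (T : bop X Y) :
  `|bop_comp S T| <= `|S| * `|T|.
Proof.
apply: bop_norm_le => [|x]; first exact: mulr_ge0.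
by rewrite (le_trans (ler_bop_norm S _))// -mulrA ler_wpM2l// ler_bop_norm.
Qed.

Section operator_classes.
Variables (R : realType) (s : scalars).
Local Notation K := (scalar R s).
Implicit Types X Y : normedModType K.

Definition compact_op X Y (T : bop X Y) : Prop :=
  precompact (T @` [set x | `|x| <= 1]).

Definition finite_rank X Y (T : bop X Y) : Prop :=
  exists n (y : 'I_n -> Y),
    forall x, exists c : 'I_n -> K, T x = \sum_(i < n) c i *: y i.

Definition compact_ops X Y : set (bop X Y) := [set T | compact_op T].

Definition approximable_ops X Y : set (bop X Y) :=
  closure [set T | finite_rank T].

Definition KS_ops (r : R) (r1 : 1 <= r) X Y : set (bop X Y) :=
  [set T | exists (Z : closedSubspace (ell s r1)) (A : bop X Z) (B : bop Z Y),
    [/\ compact_op A, compact_op B & T = bop_comp B A]].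

End operator_classes.

Arguments compact_ops {R s} X Y.
Arguments approximable_ops {R s} X Y.
Arguments KS_ops {R s r} r1 X Y.

HB.mixin Record Lmodule_isAssocAlgebra (K : pzRingType) A of GRing.Lmodule K A := {
  amul : A -> A -> A ;
  amulA : associative amul ;
  amulDl : left_distributive amul +%R ;
  amulDr : right_distributive amul +%R ;
  amulZl : forall (a : K) x y, amul (a *: x) y = a *: amul x y ;
  amulZr : forall (a : K) x y, amul x (a *: y) = a *: amul x y }.

#[short(type="assocAlgType")]
HB.structure Definition AssocAlgebra (K : pzRingType) :=
  {A of Lmodule_isAssocAlgebra K A & GRing.Lmodule K A}.

Section assoc_algebra.
Variable K : pzRingType.

(* [m] counts the factors following [x], so that no empty product occurs. *)
Definition nilpotent_algebra (A : assocAlgType K) : Prop :=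
  exists m : nat, forall (x : A) (xs : m.-tuple A), foldl amul x xs = 0.

Definition finite_dimensional (V : lmodType K) : Prop :=
  exists n (e : 'I_n -> V),
    forall v, exists c : 'I_n -> K, v = \sum_(i < n) c i *: e i.

Record subalgebra (A : assocAlgType K) := Subalgebra {
  subalgebra_pred : {pred A} ;
  subalgebra_submod : GRing.submod_closed subalgebra_pred ;
  subalgebra_amul : {in subalgebra_pred &, forall x y,
    amul x y \in subalgebra_pred} }.

Record subalgebra_of (A : assocAlgType K) (B : subalgebra A) := SubalgebraOf {
  subalgebra_val :> A ;
  subalgebra_valP : subalgebra_val \in subalgebra_pred B }.

Record algebra_ideal (A : assocAlgType K) := AlgebraIdeal {
  ideal_pred : {pred A} ;
  ideal_submod : GRing.submod_closed ideal_pred ;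
  ideal_amull : forall x, {in ideal_pred, forall y, amul x y \in ideal_pred} ;
  ideal_amulr : forall y, {in ideal_pred, forall x, amul x y \in ideal_pred} }.

End assoc_algebra.

Section subalgebra_of.
Variables (K : pzRingType) (A : assocAlgType K) (B : subalgebra A).

HB.instance Definition _ := [isSub for @subalgebra_val K A B].
HB.instance Definition _ := [Choice of subalgebra_of B by <:].
HB.instance Definition _ :=
  GRing.SubChoice_isSubLmodule.Build K A (subalgebra_pred B) (subalgebra_of B)
    (GRing.submod_closed_semi (subalgebra_submod B)).

Definition subalgebra_mul (x y : subalgebra_of B) : subalgebra_of B :=
  SubalgebraOf (subalgebra_amul (subalgebra_valP x) (subalgebra_valP y)).

Fact subalgebra_mulA : associative subalgebra_mul.
Proof. by move=> x y z; apply/val_inj/amulA. Qed.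
Fact subalgebra_mulDl : left_distributive subalgebra_mul +%R.
Proof. by move=> x y z; apply/val_inj/amulDl. Qed.
Fact subalgebra_mulDr : right_distributive subalgebra_mul +%R.
Proof. by move=> x y z; apply/val_inj/amulDr. Qed.
Fact subalgebra_mulZl a x y :
  subalgebra_mul (a *: x) y = a *: subalgebra_mul x y.
Proof. exact/val_inj/amulZl. Qed.
Fact subalgebra_mulZr a x y :
  subalgebra_mul x (a *: y) = a *: subalgebra_mul x y.
Proof. exact/val_inj/amulZr. Qed.

HB.instance Definition _ := Lmodule_isAssocAlgebra.Build K (subalgebra_of B)
  subalgebra_mulA subalgebra_mulDl subalgebra_mulDr
  subalgebra_mulZl subalgebra_mulZr.

End subalgebra_of.

Section quotient_algebra.
Variables (K : pzRingType) (A : assocAlgType K) (I : algebra_ideal A).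
Local Open Scope quotient_scope.

HB.instance Definition _ := GRing.isZmodClosed.Build A (ideal_pred I)
  (GRing.submod_closedB (ideal_submod I)).

Definition quotient_algebra := {ideal_quot (ideal_pred I)}.
HB.instance Definition _ := GRing.Zmodule.on quotient_algebra.
HB.instance Definition _ := EqQuotient.on quotient_algebra.
Local Notation Q := quotient_algebra.
Local Notation pi := (\pi_Q : A -> Q).

Lemma pi_eqP (x y : A) : reflect (pi x = pi y) (x - y \in ideal_pred I).
Proof. by rewrite Quotient.idealrBE; exact: eqP. Qed.

Lemma pi_add (x y : A) : pi (x + y) = pi x + pi y.
Proof. exact: (raddfD \pi_Q). Qed.

Definition quotient_scale (a : K) (x : Q) : Q := pi (a *: repr x).
Definition quotient_mul (x y : Q) : Q := pi (amul (repr x) (repr y)).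

Lemma repr_piB (x : A) : repr (pi x) - x \in ideal_pred I.
Proof. by apply/pi_eqP; rewrite reprK. Qed.

Lemma pi_scale a x : pi (a *: x) = quotient_scale a (pi x).
Proof.
apply/esym/pi_eqP; rewrite -scalerBr.
have [_ IZ] := GRing.submod_closed_semi (ideal_submod I).
exact/IZ/repr_piB.
Qed.

Lemma pi_mul x y : pi (amul x y) = quotient_mul (pi x) (pi y).
Proof.
apply/esym/pi_eqP.
have -> : amul (repr (pi x)) (repr (pi y)) - amul x y =
    amul (repr (pi x) - x) (repr (pi y)) + amul x (repr (pi y) - y).
  rewrite amulDl amulDr -!scaleN1r amulZl amulZr !scaleN1r.
  by rewrite addrA addrNK.
apply: rpredD; first exact/ideal_amulr/repr_piB.
exact/ideal_amull/repr_piB.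
Qed.

Let piP (x : Q) : exists y, x = pi y.
Proof. by exists (repr x); rewrite reprK. Qed.

Fact quotient_scaleA a b x :
  quotient_scale a (quotient_scale b x) = quotient_scale (a * b) x.
Proof. by have [y ->] := piP x; rewrite -!pi_scale scalerA. Qed.
Fact quotient_scale1 : left_id 1 quotient_scale.
Proof. by move=> x; have [y ->] := piP x; rewrite -pi_scale scale1r. Qed.
Fact quotient_scaleDr : right_distributive quotient_scale +%R.
Proof.
move=> a x y; have [x' ->] := piP x; have [y' ->] := piP y.
by rewrite -pi_add -!pi_scale -pi_add scalerDr.
Qed.
Fact quotient_scaleDl x : {morph quotient_scale^~ x : a b / a + b}.
Proof.
by move=> a b; have [y ->] := piP x; rewrite -!pi_scale -pi_add scalerDl.
Qed.

HB.instance Definition _ := GRing.Zmodule_isLmodule.Build K Q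
  quotient_scaleA quotient_scale1 quotient_scaleDr quotient_scaleDl.

Fact quotient_mulA : associative quotient_mul.
Proof.
move=> x y z.
have [x' ->] := piP x; have [y' ->] := piP y; have [z' ->] := piP z.
by rewrite -!pi_mul amulA.
Qed.
Fact quotient_mulDl : left_distributive quotient_mul +%R.
Proof.
move=> x y z.
have [x' ->] := piP x; have [y' ->] := piP y; have [z' ->] := piP z.
by rewrite -pi_add -!pi_mul -pi_add amulDl.
Qed.
Fact quotient_mulDr : right_distributive quotient_mul +%R.
Proof.
move=> x y z.
have [x' ->] := piP x; have [y' ->] := piP y; have [z' ->] := piP z.
by rewrite -pi_add -!pi_mul -pi_add amulDr.
Qed.
Fact quotient_mulZl (a : K) (x y : Q) :
  quotient_mul (a *: x) y = a *: quotient_mul x y.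
Proof.
have [x' ->] := piP x; have [y' ->] := piP y.
by rewrite -[a *: pi _]pi_scale -!pi_mul -[RHS]pi_scale amulZl.
Qed.
Fact quotient_mulZr (a : K) (x y : Q) :
  quotient_mul x (a *: y) = a *: quotient_mul x y.
Proof.
have [x' ->] := piP x; have [y' ->] := piP y.
by rewrite -[a *: pi _]pi_scale -!pi_mul -[RHS]pi_scale amulZr.
Qed.

HB.instance Definition _ := Lmodule_isAssocAlgebra.Build K Q
  quotient_mulA quotient_mulDl quotient_mulDr quotient_mulZl quotient_mulZr.

End quotient_algebra.

Section closure_normed.
Variables (K : numFieldType).

Lemma closure_normP (V : normedModType K) (A : set V) x : closure A x <->
  forall e : K, 0 < e -> exists2 a, A a & `|x - a| < e.
Proof.
split=> [Ax e e0|Ax U /nbhs_ballP[e /= e0 xU]].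
  have [a [Aa xa]] := Ax _ (nbhsx_ballx x e e0).
  by exists a => //; move: xa; rewrite -ball_normE.
by have [a Aa xa] := Ax e e0; exists a; split=> //; apply: xU; rewrite -ball_normE.
Qed.

Lemma closure_addr (V : normedModType K) (A : set V) :
  (forall x y, A x -> A y -> A (x + y)) ->
  forall x y, closure A x -> closure A y -> closure A (x + y).
Proof.
move=> AD x y /closure_normP Ax /closure_normP Ay; apply/closure_normP => e e0.
have e20 : 0 < e / 2 by rewrite divr_gt0.
have [a Aa xa] := Ax _ e20; have [b Ab yb] := Ay _ e20.
exists (a + b); first exact: AD.
by rewrite opprD addrACA (le_lt_trans (ler_normD _ _))// (splitr e) ltrD.
Qed.

Lemma closure_linear_image (V W : normedModType K) (A : set V) (B : set W)
    (f : V -> W) (M : K) : 0 <= M ->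
  (forall x y, f (x - y) = f x - f y) -> (forall x, `|f x| <= M * `|x|) ->
  (forall x, A x -> B (f x)) -> forall x, closure A x -> closure B (f x).
Proof.
move=> M0 fB fM AB x /closure_normP Ax; apply/closure_normP => e e0.
have M1 : 0 < M + 1 by rewrite ltr_wpDl.
have [a Aa xa] := Ax (e / (M + 1)) (divr_gt0 e0 M1).
exists (f a); first exact: AB.
rewrite -fB (le_lt_trans (fM _))//.
apply: (@le_lt_trans _ _ ((M + 1) * `|x - a|)); first by rewrite ler_wpM2r// lerDl.
by rewrite mulrC -ltr_pdivlMr.
Qed.

Lemma closure_submod (V : normedModType K) (A : set V) :
  A 0 -> (forall x y, A x -> A y -> A (x + y)) ->
  (forall a x, A x -> A (a *: x)) ->
  GRing.submod_closed (mem (closure A)).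
Proof.
move=> A0 AD AZ; split; first by rewrite inE; exact: subset_closure.
move=> a x y; rewrite !inE => Ax Ay; apply: closure_addr => //.
apply: (closure_linear_image (A := A) (f := *:%R a) (M := `|a|)) => //.
- by move=> ? ?; rewrite scalerBr.
- by move=> z; rewrite normrZ.
- by move=> z; exact: AZ.
Qed.

End closure_normed.

Section operator_ideals.
Variables (R : realType) (s : scalars).
Local Notation K := (scalar R s).
Implicit Types X Y Z W : normedModType K.

Lemma finite_rank0 X Y : finite_rank (0 : bop X Y).
Proof. by exists 0%N, (fun=> 0) => x; exists (fun=> 0); rewrite big_ord0. Qed.

Lemma finite_rankD X Y (S T : bop X Y) :
  finite_rank S -> finite_rank T -> finite_rank (S + T).
Proof.
move=> [n [y Sy]] [m [z Tz]].
exists (n + m)%N, (fun i => match fintype.split i with inl j => y j | inr j => z j end).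
move=> x; have [c Sx] := Sy x; have [d Tx] := Tz x.
exists (fun i => match fintype.split i with inl j => c j | inr j => d j end).
rewrite bopDE Sx Tx big_split_ord/=; congr (_ + _).
  by apply: eq_bigr => i _; rewrite (unsplitK (inl i)).
by apply: eq_bigr => i _; rewrite (unsplitK (inr i)).
Qed.

Lemma finite_rankZ X Y a (T : bop X Y) : finite_rank T -> finite_rank (a *: T).
Proof.
move=> [n [y Ty]]; exists n, y => x; have [c Tx] := Ty x.
exists (fun i => a * c i); rewrite bopZE Tx scaler_sumr.
by apply: eq_bigr => i _; rewrite scalerA.
Qed.

Lemma finite_rank_compl X Y Z (S : bop Y Z) (T : bop X Y) :
  finite_rank T -> finite_rank (bop_comp S T).
Proof.
move=> [n [y Ty]]; exists n, (S \o y) => x; have [c Tx] := Ty x.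
exists c; rewrite /= Tx linear_sum.
by apply: eq_bigr => i _; rewrite linearZ.
Qed.

Lemma finite_rank_compr X Y Z (S : bop Y Z) (T : bop X Y) :
  finite_rank S -> finite_rank (bop_comp S T).
Proof. by move=> [n [y Sy]]; exists n, y => x; exact: Sy. Qed.

Lemma compact_precompact_sub Y (A C : set Y) :
  compact C -> A `<=` C -> precompact A.
Proof.
move=> cC sAC; apply: (precompact_subset sAC).
by apply: compact_precompact => //; exact: norm_hausdorff.
Qed.

Lemma compact_op0 X Y : compact_op (0 : bop X Y).
Proof.
have c0 : compact [set (0 : Y)] by exact: compact_set1.
apply: (compact_precompact_sub c0).
by move=> _ [x _ <-].
Qed.

Lemma compact_opD X Y (S T : bop X Y) :
  compact_op S -> compact_op T -> compact_op (S + T).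
Proof.
rewrite /compact_op/= => cS cT; rewrite precompactE in cS; rewrite precompactE in cT.
have addc : continuous (fun p : Y * Y => p.1 + p.2) := @add_continuous Y.
have cI : compact ((fun p : Y * Y => p.1 + p.2) @` (closure (S @` [set x | `|x| <= 1]) `*` closure (T @` [set x | `|x| <= 1]))).
  by apply: continuous_compact; [exact: continuous_subspaceT addc|exact: compact_setX].
apply: (compact_precompact_sub cI).
move=> _ [x x1 <-]; exists (S x, T x) => //=.
by split; apply: subset_closure; exists x.
Qed.

Lemma compact_op_compl X Y Z (S : bop Y Z) (T : bop X Y) :
  compact_op T -> compact_op (bop_comp S T).
Proof.
rewrite /compact_op/= precompactE => cT.
have cI : compact (S @` (closure (T @` [set x | `|x| <= 1]))).
  by apply: continuous_compact; [exact/continuous_subspaceT/bop_continuous|exact: cT].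
apply: (compact_precompact_sub cI).
move=> _ [x x1 <-]; exists (T x) => //=.
by apply: subset_closure; exists x.
Qed.

Lemma compact_opZ X Y a (T : bop X Y) : compact_op T -> compact_op (a *: T).
Proof.
rewrite /compact_op/= precompactE => cT.
have scalec : continuous ( *:%R a : Y -> Y) := @scaler_continuous _ _ _.
have cI : compact (( *:%R a : Y -> Y) @` (closure (T @` [set x | `|x| <= 1]))).
  by apply: continuous_compact; [exact: continuous_subspaceT scalec|exact: cT].
apply: (compact_precompact_sub cI).
move=> _ [x x1 <-]; exists (T x) => //=.
by apply: subset_closure; exists x.
Qed.

Lemma compact_op_compr X Y Z (S : bop Y Z) (T : bop X Y) :
  compact_op S -> compact_op (bop_comp S T).
Proof.
move=> cS; have [M M0 TM] := bop_bounded T.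
have M1 : 0 < M + 1 by rewrite ltr_wpDl.
have := compact_opZ (M + 1) cS; rewrite /compact_op/=.
apply: precompact_subset => _ [x /= x1 <-].
exists ((M + 1)^-1 *: T x); last first.
  by rewrite -[LHS]/((M + 1) *: S _) linearZ scalerA mulfV ?gt_eqF// scale1r.
rewrite /= normrZ gtr0_norm ?invr_gt0// mulrC ler_pdivrMr// mul1r.
rewrite (le_trans (TM x))// -[leRHS]mulr1.
by rewrite ler_pM// lerDl.
Qed.

End operator_ideals.

Section bop_restrict.
Variables (K : numFieldType) (V W : normedModType K) (T : bop V W).
Variables (X : closedSubspace V) (Y : closedSubspace W).
Hypothesis TXY :
  forall x, x \in subspace_pred X -> T x \in subspace_pred Y.

Definition bop_restrict_fun (x : X) : Y :=
  SubspaceOf (TXY (subspace_valP x)).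

Lemma bop_restrict_subproof : bop_restrict_fun \in bounded_linear X Y.
Proof.
apply/bounded_linearP; split=> [a x y|].
  by apply: val_inj; rewrite /= -[RHS]bop_linear.
by have [M M0 TM] := bop_bounded T; exists M => x; exact: TM.
Qed.

Definition bop_restrict : bop X Y := Bop bop_restrict_subproof.

Lemma bop_restrictE x : subspace_val (bop_restrict x) = T (subspace_val x).
Proof. by []. Qed.

End bop_restrict.

Section ell_interleave.
Variables (R : realType) (s : scalars) (r : R) (r1 : 1 <= r).
Local Notation K := (scalar R s).
Local Notation ell := (ell s r1).

Lemma eseries_even_odd (g : nat -> \bar R) : (forall n, 0 <= g n)%E ->
  (\sum_(n <oo) g n = \sum_(n <oo) (g n.*2 + g n.*2.+1))%E.
Proof.
move=> g0; have h0 n : (0 <= g n.*2 + g n.*2.+1)%E by rewrite adde_ge0.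
have gh N : (\sum_(0 <= n < N.*2) g n =
    \sum_(0 <= n < N) (g n.*2 + g n.*2.+1))%E.
  elim: N => [|N IHN]; first by rewrite !big_geq.
  by rewrite doubleS !big_nat_recr//= IHN addeA.
apply/le_anti/andP; split; apply: lime_le.
- by apply: is_cvg_nneseries => n _ _; exact: g0.
- apply: nearW => N; apply: le_trans (nneseries_lim_ge N _) => [|n _ _]; last exact: h0.
  rewrite -gh; apply: lee_sum_nneg_natr => //.
  by rewrite -addnn leq_addr.
- by apply: is_cvg_nneseries => n _ _; exact: h0.
- apply: nearW => N; rewrite -gh; apply: nneseries_lim_ge => n _ _; exact: g0.
Qed.

Section ell_map.
Variable f : (nat -> K^o) -> (nat -> K^o).
Hypothesis lf : linear f.
Hypothesis cf : forall x, (ell_enorm r (f x) <= ell_enorm r x)%E.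

Fact ell_map_subproof (x : ell) : f x \in ell_mem r.
Proof. by rewrite ell_memE (le_lt_trans (cf x))// -ell_memE ell_valP. Qed.

Definition ell_map_fun (x : ell) : ell := Ell r1 (ell_map_subproof x).

Fact ell_map_bounded : ell_map_fun \in bounded_linear ell ell.
Proof.
apply/bounded_linearP; split=> [a x y|]; first by apply: val_inj; exact: lf.
exists 1 => x; rewrite mul1r ler_of_real fine_le ?cf//.
- by rewrite ge0_fin_numE ?ell_enorm_ge0// -ell_memE ell_map_subproof.
- by rewrite ge0_fin_numE ?ell_enorm_ge0// -ell_memE ell_valP.
Qed.

Definition ell_map : bop ell ell := Bop ell_map_bounded.

End ell_map.

Definition even_seq (x : nat -> K^o) : nat -> K^o := fun n => x n.*2.
Definition odd_seq (x : nat -> K^o) : nat -> K^o := fun n => x n.*2.+1.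
Definition to_even (x : nat -> K^o) : nat -> K^o :=
  fun n => if odd n then 0 else x n./2.
Definition to_odd (x : nat -> K^o) : nat -> K^o :=
  fun n => if odd n then x n./2 else 0.

Let r_gt0 : 0 < r. Proof. exact: lt_le_trans r1. Qed.

Let term_ge0 (x : nat -> K^o) n : (0 <= (modulus (x n) `^ r)%:E)%E.
Proof. exact: ell_term_ge0. Qed.

Lemma even_seq_linear : linear even_seq. Proof. by []. Qed.
Lemma odd_seq_linear : linear odd_seq. Proof. by []. Qed.

Lemma to_even_linear : linear to_even.
Proof.
move=> a x y; apply/funext => n.
rewrite -[RHS]/(a *: to_even x n + to_even y n) /to_even.
by case: ifP => // _; rewrite scaler0 addr0.
Qed.

Lemma to_odd_linear : linear to_odd.
Proof.
move=> a x y; apply/funext => n.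
rewrite -[RHS]/(a *: to_odd x n + to_odd y n) /to_odd.
by case: ifP => // _; rewrite scaler0 addr0.
Qed.

Lemma even_seq_enorm x : (ell_enorm r (even_seq x) <= ell_enorm r x)%E.
Proof.
apply: ler_poweRV => //; first by apply: nneseries_ge0 => n _ _; exact: term_ge0.
rewrite [leRHS]eseries_even_odd//.
by apply: lee_nneseries => n *; [exact: term_ge0|rewrite leeDl].
Qed.

Lemma odd_seq_enorm x : (ell_enorm r (odd_seq x) <= ell_enorm r x)%E.
Proof.
apply: ler_poweRV => //; first by apply: nneseries_ge0 => n _ _; exact: term_ge0.
rewrite [leRHS]eseries_even_odd//.
by apply: lee_nneseries => n *; [exact: term_ge0|rewrite leeDr].
Qed.

Lemma to_even_enorm x : (ell_enorm r (to_even x) <= ell_enorm r x)%E.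
Proof.
rewrite /ell_enorm eseries_even_odd//.
rewrite (eq_eseriesr (g := fun n => (modulus (x n) `^ r)%:E))// => n _.
rewrite /to_even oddS odd_double/= doubleK modulus0 powR0 ?adde0//.
by rewrite gt_eqF.
Qed.

Lemma to_odd_enorm x : (ell_enorm r (to_odd x) <= ell_enorm r x)%E.
Proof.
rewrite /ell_enorm eseries_even_odd//.
rewrite (eq_eseriesr (g := fun n => (modulus (x n) `^ r)%:E))// => n _.
rewrite /to_odd oddS odd_double/= uphalf_double modulus0 powR0 ?add0e//.
by rewrite gt_eqF.
Qed.

Definition ell_even := ell_map even_seq_linear even_seq_enorm.
Definition ell_odd := ell_map odd_seq_linear odd_seq_enorm.
Definition ell_to_even := ell_map to_even_linear to_even_enorm.
Definition ell_to_odd := ell_map to_odd_linear to_odd_enorm.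

Lemma ell_to_evenK x : ell_even (ell_to_even x) = x.
Proof.
by apply/val_inj/funext => n; rewrite /= /even_seq /to_even odd_double doubleK.
Qed.

Lemma ell_to_oddK x : ell_odd (ell_to_odd x) = x.
Proof.
apply/val_inj/funext => n.
by rewrite /= /odd_seq /to_odd oddS odd_double/= uphalf_double.
Qed.

Lemma ell_to_even0 x : ell_odd (ell_to_even x) = 0.
Proof.
by apply/val_inj/funext => n; rewrite /= /odd_seq /to_even oddS odd_double.
Qed.

Lemma ell_to_odd0 x : ell_even (ell_to_odd x) = 0.
Proof.
by apply/val_inj/funext => n; rewrite /= /even_seq /to_odd odd_double.
Qed.

Section direct_sum.
Variables Z1 Z2 : closedSubspace ell.

Definition dsum_pred : {pred ell} :=
  [pred z | (ell_even z \in subspace_pred Z1) &&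
            (ell_odd z \in subspace_pred Z2)].

Lemma dsum_submod : GRing.submod_closed dsum_pred.
Proof.
have [Z10 Z1D] := subspace_submod Z1; have [Z20 Z2D] := subspace_submod Z2.
split; first by rewrite inE !linear0 Z10 Z20.
move=> a x y; rewrite !inE => /andP[x1 x2] /andP[y1 y2].
by rewrite !linearP Z1D// Z2D.
Qed.

Lemma dsum_closed : closed [set z | z \in dsum_pred].
Proof.
have -> : [set z | z \in dsum_pred] =
    ell_even @^-1` [set z | z \in subspace_pred Z1] `&`
    ell_odd @^-1` [set z | z \in subspace_pred Z2].
  by apply/seteqP; split=> z /=; rewrite inE => /andP.
apply: closedI; apply: preimage_closed => [z _|].
- exact: bop_continuous.
- exact: subspace_closed.
- exact: bop_continuous.
- exact: subspace_closed.
Qed.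

Definition dsum := ClosedSubspace dsum_submod dsum_closed.

Fact dsum_inl_subproof z :
  z \in subspace_pred Z1 -> ell_to_even z \in subspace_pred dsum.
Proof.
by move=> zZ; rewrite inE ell_to_evenK ell_to_even0 zZ (subspace_submod Z2).1.
Qed.
Fact dsum_inr_subproof z :
  z \in subspace_pred Z2 -> ell_to_odd z \in subspace_pred dsum.
Proof.
by move=> zZ; rewrite inE ell_to_oddK ell_to_odd0 zZ (subspace_submod Z1).1.
Qed.
Fact dsum_fst_subproof z :
  z \in subspace_pred dsum -> ell_even z \in subspace_pred Z1.
Proof. by rewrite inE => /andP[]. Qed.
Fact dsum_snd_subproof z :
  z \in subspace_pred dsum -> ell_odd z \in subspace_pred Z2.
Proof. by rewrite inE => /andP[]. Qed.

Definition dsum_inl : bop Z1 dsum := bop_restrict dsum_inl_subproof.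
Definition dsum_inr : bop Z2 dsum := bop_restrict dsum_inr_subproof.
Definition dsum_fst : bop dsum Z1 := bop_restrict dsum_fst_subproof.
Definition dsum_snd : bop dsum Z2 := bop_restrict dsum_snd_subproof.

Lemma dsum_inlK z : dsum_fst (dsum_inl z) = z.
Proof. by apply: val_inj; exact: ell_to_evenK. Qed.
Lemma dsum_inrK z : dsum_snd (dsum_inr z) = z.
Proof. by apply: val_inj; exact: ell_to_oddK. Qed.
Lemma dsum_inl0 z : dsum_snd (dsum_inl z) = 0.
Proof. by apply: val_inj; exact: ell_to_even0. Qed.
Lemma dsum_inr0 z : dsum_fst (dsum_inr z) = 0.
Proof. by apply: val_inj; exact: ell_to_odd0. Qed.

Lemma dsum_fstE z w : dsum_fst (dsum_inl z + dsum_inr w) = z.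
Proof.
by rewrite linearD [X in X + _]dsum_inlK [X in _ + X]dsum_inr0 addr0.
Qed.
Lemma dsum_sndE z w : dsum_snd (dsum_inl z + dsum_inr w) = w.
Proof.
by rewrite linearD [X in X + _]dsum_inl0 [X in _ + X]dsum_inrK add0r.
Qed.

End direct_sum.

End ell_interleave.

Section KS_ideal.
Variables (R : realType) (s : scalars) (r : R) (r1 : 1 <= r).
Local Notation K := (scalar R s).
Implicit Types X Y : normedModType K.

Lemma KS_compl X Y W (S : bop Y W) (T : bop X Y) :
  KS_ops r1 _ _ T -> KS_ops r1 _ _ (bop_comp S T).
Proof.
move=> [Z [A [B [cA cB ->]]]]; exists Z, A, (bop_comp S B).
by split=> //; [exact: compact_op_compl|exact: bopP].
Qed.

Lemma KS_compr X Y W (S : bop Y W) (T : bop X Y) :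
  KS_ops r1 _ _ S -> KS_ops r1 _ _ (bop_comp S T).
Proof.
move=> [Z [A [B [cA cB ->]]]]; exists Z, (bop_comp A T), B.
by split=> //; [exact: compact_op_compr|exact: bopP].
Qed.

Lemma KSZ X Y a (T : bop X Y) : KS_ops r1 _ _ T -> KS_ops r1 _ _ (a *: T).
Proof.
move=> [Z [A [B [cA cB ->]]]]; exists Z, A, (a *: B).
by split=> //; [exact: compact_opZ|exact: bopP].
Qed.

Lemma KSD X Y (S T : bop X Y) : KS_ops r1 _ _ S -> KS_ops r1 _ _ T -> KS_ops r1 _ _ (S + T).
Proof.
move=> [Z1 [A1 [B1 [cA1 cB1 ->]]]] [Z2 [A2 [B2 [cA2 cB2 ->]]]].
exists (dsum Z1 Z2).
exists (bop_comp (dsum_inl Z1 Z2) A1 + bop_comp (dsum_inr Z1 Z2) A2).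
exists (bop_comp B1 (dsum_fst Z1 Z2) + bop_comp B2 (dsum_snd Z1 Z2)).
split.
- by apply: compact_opD; exact: compact_op_compl.
- by apply: compact_opD; exact: compact_op_compr.
- apply: bopP => x; rewrite !bopDE.
  rewrite -[RHS]/(B1 (dsum_fst Z1 Z2
    (dsum_inl Z1 Z2 (A1 x) + dsum_inr Z1 Z2 (A2 x))) + B2 (dsum_snd Z1 Z2
    (dsum_inl Z1 Z2 (A1 x) + dsum_inr Z1 Z2 (A2 x)))).
  by rewrite dsum_fstE dsum_sndE.
Qed.

Lemma KS0 X Y : KS_ops r1 _ _ (0 : bop X Y).
Proof.
have Z0 : GRing.submod_closed (predT : {pred ell s r1}) by [].
have Zc : closed [set x : ell s r1 | x \in predT].
  by rewrite (_ : mkset _ = setT) ?closedT//; apply/seteqP; split.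
exists (ClosedSubspace Z0 Zc), 0, 0.
by split; [exact: compact_op0|exact: compact_op0|exact: bopP].
Qed.

End KS_ideal.

Section bop_algebra.
Variables (K : numFieldType) (X : normedModType K).
Implicit Types S T U : bop X X.

Fact bop_compA : associative (@bop_comp K X X X).
Proof. by move=> S T U; exact: bopP. Qed.
Fact bop_compDl : left_distributive (@bop_comp K X X X) +%R.
Proof. by move=> S T U; exact: bopP. Qed.
Fact bop_compDr : right_distributive (@bop_comp K X X X) +%R.
Proof. by move=> S T U; apply: bopP => x /=; rewrite linearD. Qed.
Fact bop_compZl (a : K) S T : bop_comp (a *: S) T = a *: bop_comp S T.
Proof. exact: bopP. Qed.
Fact bop_compZr (a : K) S T : bop_comp S (a *: T) = a *: bop_comp S T.
Proof. by apply: bopP => x /=; rewrite linearZ. Qed.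

HB.instance Definition _ := Lmodule_isAssocAlgebra.Build K (bop X X)
  bop_compA bop_compDl bop_compDr bop_compZl bop_compZr.

End bop_algebra.

Section closure_comp.
Variables (R : realType) (s : scalars) (X Y Z : normedModType (scalar R s)).

Lemma closure_compl (A : set (bop X Y)) (B : set (bop X Z)) (S : bop Y Z) T :
  (forall U, A U -> B (bop_comp S U)) -> closure A T ->
  closure B (bop_comp S T).
Proof.
move=> AB; apply: (closure_linear_image (M := `|S|)) => // [U V|U].
  by apply: bopP => x /=; rewrite linearB.
exact: ler_bop_comp.
Qed.

Lemma closure_compr (A : set (bop Y Z)) (B : set (bop X Z)) S (T : bop X Y) :
  (forall U, A U -> B (bop_comp U T)) -> closure A S ->
  closure B (bop_comp S T).
Proof.
move=> AB; apply: (closure_linear_image (f := fun U => bop_comp U T)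
  (M := `|T|)) => // [U V|U]; first exact: bopP.
by rewrite mulrC; exact: ler_bop_comp.
Qed.

End closure_comp.

Section KS_algebra.
Variables (R : realType) (s : scalars) (r : R) (r1 : 1 <= r).
Variable X : normedModType (scalar R s).

Fact KS_closure_submod :
  GRing.submod_closed (mem (closure (KS_ops r1 X X))).
Proof.
apply: closure_submod; first exact: KS0.
- exact: KSD.
- exact: KSZ.
Qed.

Fact KS_closure_comp : {in mem (closure (KS_ops r1 X X)) &,
  forall S T : bop X X, amul S T \in mem (closure (KS_ops r1 X X))}.
Proof.
move=> S T _; rewrite !inE => KT.
by apply: closure_compl KT => U; exact: KS_compl.
Qed.

Definition KS_closure : subalgebra (bop X X) :=
  Subalgebra KS_closure_submod KS_closure_comp.

(* The elements of [approximable_ops X X] in the closure of [KS_ops r1 X X];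
   mathematically this is all of [approximable_ops X X]. *)
Definition approximable_pred : {pred subalgebra_of KS_closure} :=
  [pred T : subalgebra_of KS_closure |
    subalgebra_val T \in approximable_ops X X].

Fact approximable_submod : GRing.submod_closed approximable_pred.
Proof.
have [A0 AD] : GRing.submod_closed (mem (approximable_ops X X)).
  apply: closure_submod; first exact: finite_rank0.
  - exact: finite_rankD.
  - exact: finite_rankZ.
split; first exact: A0.
by move=> a S T; exact: AD.
Qed.

Fact approximable_amull S :
  {in approximable_pred, forall T, amul S T \in approximable_pred}.
Proof.
move=> T; rewrite !inE => AT.
by apply: closure_compl AT => U; exact: finite_rank_compl.
Qed.

Fact approximable_amulr T :
  {in approximable_pred, forall S, amul S T \in approximable_pred}.
Proof.
move=> S; rewrite !inE => AS.
by apply: closure_compr AS => U; exact: finite_rank_compr.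
Qed.

Definition approximable_ideal : algebra_ideal (subalgebra_of KS_closure) :=
  AlgebraIdeal approximable_submod approximable_amull approximable_amulr.

Definition KS_quotient : assocAlgType (scalar R s) :=
  quotient_algebra approximable_ideal.

End KS_algebra.

(* Main.v *)
(* For q <= p < 2, sums of independent symmetric variables with tails v^-p embed
   the finite-dimensional [l^p_d] into [l^q] with constants independent of [d].
   The elements of the image of the unit ball under a compact operator into a
   subspace of [l^p] have uniformly small tails, so coordinates can be cut into
   consecutive blocks on which these tails decay geometrically; embedding every
   block into [l^q] with a rescaling factor codes a subspace of [l^q] through
   which the operator factors compactly. This gives (i).

   For (ii) and (iii), fix t < u < 2 with t the larger exponent. The same
   embeddings realise in [l^p] and in [l^q] the families indexed by binary words
   whose level n carries mu^n times an l^t-sum of l^u-norms over the blocks of a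
   partition; decreasing mu makes the identity between two such spaces compact.
   Inside them, Szankowski's relations cut out subspaces containing vectors
   [z i], and the averages beta_n / 2^(n+1) of the coordinates of [S (z i)] over
   the words [i] of length n form trace functionals. Consecutive averages differ
   by terms [y a b i] whose words can be moved by flipping letters so that the
   coordinate under test runs through distinct blocks while all other letters
   stay in a common block; comparing the l^t-sum of the former with the l^u-norm
   of the latter bounds the differences by a geometric series. Hence the averages
   are bounded uniformly by the norm of S, they tend to 0 when S has finite rank,
   and they equal 1 on the identity, which is therefore not approximable.

   For (iii), alternate such subspaces X_0, Z_0, X_1, Z_1, ... of [l^p] and [l^q]
   with decreasing mu. The identities X_k -> Z_k -> X_(k+1) act as shifts on the
   direct sum of the X_k in [l^p]; their products and nontrivial linear
   combinations compress to multiples of an identity X_j -> X_l. *)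
Require Import Defs.
From HB Require Import structures.
From mathcomp Require Import all_boot all_order all_algebra.
From mathcomp Require Import complex.
From mathcomp Require Import all_classical all_reals all_analysis.
From mathcomp Require Import zify ring lra.
Require Import Defs.

Set Implicit Arguments.
Unset Strict Implicit.
Unset Printing Implicit Defensive.

Import Order.TTheory GRing.Theory Num.Theory.
Import numFieldNormedType.Exports.

Local Open Scope classical_set_scope.
Local Open Scope ring_scope.

(** Closed subspaces of [l^p] may fail the approximation property, and (ii) and (iii) live on such
    subspaces. Hence (i) cannot be reduced to finite rank operators: its factorization carries the
    subspace [Y] along, and the second factor is defined only on codes that decode into [Y]. Random
    variables are replaced by finite weighted lists, so that an [L^q]-norm is literally a finite
    [l^q]-norm. The conditions [q < p < 2] say that the [q]-th moments of tails [v^-p] converge,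
    while truncated second moments are dominated by their last term. In (ii) and (iii) a gain has to
    beat the growing weights [mu^n]. Flipping letters in one position out of eight gives [2^l]
    variants of a word of length [n], with [l] about [n/8]. Signed sums of the corresponding vectors
    cost [2^(l/u)], the coordinates under test are counted in [l^t], and the average gains
    [2^(l/u - l/t)]; this is why [u] exceeds [t] strictly. Eight is four prefixes [[:: a; b]] times
    two parities. The sixteenth root [eta] of the gain per unit of [l] makes [eta^n] available
    twice: once against [mu^n], once for convergence. *)

Section modulus_theory.
Variables (R : realType) (s : scalars).
Local Notation K := (scalar R s).
Local Notation modulus := (@modulus R s).
Local Notation of_real := (@of_real R s).

Lemma modulusN (x : K) : modulus (- x) = modulus x.
Proof. by apply: (@of_real_inj R s); rewrite !of_real_modulus normrN. Qed.

Lemma modulusB_sym (x y : K) : modulus (x - y) = modulus (y - x).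
Proof. by rewrite -modulusN opprB. Qed.

Lemma of_real1 : of_real 1 = 1.
Proof. by case: s. Qed.

Lemma ler_modulus_sum (I : Type) (r : seq I) (P : pred I) (F : I -> K) :
  modulus (\sum_(i <- r | P i) F i) <= \sum_(i <- r | P i) modulus (F i).
Proof.
apply: (big_ind2 (fun x y => modulus x <= y)) => //; first by rewrite modulus0.
by move=> a b c d ab cd; rewrite (le_trans (ler_modulusD _ _))// lerD.
Qed.

Lemma modulus_parallelogram (x y : K) :
  modulus (x + y) ^+ 2 + modulus (x - y) ^+ 2 =
  2 * (modulus x ^+ 2 + modulus y ^+ 2).
Proof.
case: s x y => /= x y.
  by rewrite !real_normK ?num_real//; ring.
case: x y => [a b] [c d]; rewrite /Normc.normc /=.
by rewrite !sqr_sqrtr ?addr_ge0 ?sqr_ge0//; ring.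
Qed.

Lemma of_real2M (y : K) : of_real 2 * y = y + y.
Proof.
by rewrite (_ : 2 = 1 + 1 :> R)// of_realD of_real1 mulrDl !mul1r.
Qed.

Lemma max_modulusD (x y : K) : 1 <= modulus y ->
  (1 <= modulus (x + y)) || (1 <= modulus (x - y)).
Proof.
move=> y1; apply/orP; have : 2 * modulus y <= modulus (x + y) + modulus (x - y).
  have -> : 2 * modulus y = modulus ((x + y) - (x - y)).
    have -> : x + y - (x - y) = y + y by ring.
    rewrite -of_real2M.
    by rewrite modulusM modulus_of_real.
  by rewrite (le_trans (ler_modulusD _ _))// modulusN.
have [|] := leP 1 (modulus (x + y)); first by left.
by have [|] := leP 1 (modulus (x - y)); [right|lra].
Qed.

End modulus_theory.

(** * Truncated stable distributions *)

Section power_lemmas.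
Variable R : realType.
Implicit Types x y u v w p q e : R.

Lemma powR_midpoint e u v : 1 <= e -> 0 <= u -> 0 <= v ->
  ((u + v) / 2) `^ e <= (u `^ e + v `^ e) / 2.
Proof.
move=> e1 u0 v0.
have h0 : (0 : R) <= 2^-1 by rewrite invr_ge0.
have h1 : (2^-1 : R) <= 1 by rewrite invf_le1 ?ler1n.
have uI : u \in (`[0, +oo[%classic : set R) by rewrite inE/= in_itv/= u0.
have vI : v \in (`[0, +oo[%classic : set R) by rewrite inE/= in_itv/= v0.
have : (2^-1 * u + (1 - 2^-1) * v) `^ e <=
    2^-1 * u `^ e + (1 - 2^-1) * v `^ e.
  exact: (@convex_powR R e e1 (Itv01 h0 h1) u v uI vI).
rewrite (_ : 1 - 2^-1 = 2^-1 :> R); last by field.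
by rewrite -!mulrDr ![2^-1 * _]mulrC.
Qed.

(** Concavity of the power [q / 2], applied to the squares of [u] and [v]; the proof reads it off
    the convexity of the inverse power [2 / q]. *)
Lemma powR_two_point q u v w : 0 < q -> q <= 2 ->
  0 <= u -> 0 <= v -> 0 <= w -> u ^+ 2 + v ^+ 2 = 2 * w ^+ 2 ->
  u `^ q + v `^ q <= 2 * w `^ q.
Proof.
move=> q0 q2 u0 v0 w0 uvw.
have e1 : 1 <= 2 / q by rewrite ler_pdivlMr// mul1r.
have qK x : 0 <= x -> (x `^ q) `^ (2 / q) = x ^+ 2.
  by move=> x0; rewrite -powRrM mulrCA mulfV ?gt_eqF// mulr1 powR_mulrn.
have eK x : 0 <= x -> (x `^ (2 / q)) `^ (q / 2) = x.
  move=> x0; rewrite -powRrM mulf_div [q * 2]mulrC mulfV ?powRr1//.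
  by rewrite mulf_neq0// gt_eqF.
have := powR_midpoint e1 (powR_ge0 u q) (powR_ge0 v q).
rewrite !qK// uvw mulrAC mulfV// mul1r => H.
have : ((u `^ q + v `^ q) / 2) <= w `^ q.
  rewrite -(eK ((u `^ q + v `^ q) / 2)) ?divr_ge0 ?addr_ge0 ?powR_ge0//.
  have -> : w `^ q = (w ^+ 2) `^ (q / 2).
    by rewrite -powR_mulrn// -powRrM mulrCA mulfV// mulr1.
  apply: ge0_ler_powR => //; rewrite ?nnegrE ?powR_ge0 ?sqr_ge0//.
  by rewrite divr_ge0// ltW.
by rewrite ler_pdivrMr// mulrC.
Qed.

(** Quadratic near 0, where the cancellation of signs must be felt, and of order [q] at infinity,
    where second moments of the heavy tails are too large. *)
Definition min_power q x : R := Num.min (x ^+ 2) (x `^ q).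

Lemma min_power_ge0 q x : 0 <= min_power q x.
Proof. by rewrite le_min sqr_ge0 powR_ge0. Qed.

Lemma min_power_lt1 q x : 0 <= x -> x <= 1 -> q <= 2 -> min_power q x = x ^+ 2.
Proof.
rewrite le0r => /orP[/eqP->|x0] x1 q2.
  by rewrite /min_power expr0n/= min_l// powR_ge0.
apply: min_l; rewrite -powR_mulrn ?(ltW x0)//.
by apply: ger_powR => //; rewrite x0.
Qed.

Lemma min_power_ge1 q x : 1 <= x -> q <= 2 -> min_power q x = x `^ q.
Proof.
move=> x1 q2; apply: min_r; rewrite -powR_mulrn ?(le_trans _ x1)//.
exact: ler_powR.
Qed.

(** The quotient of [min_power q x] by [x ^+ 2] decreases in [x], so its value at [w] may be used
    for both smaller arguments [u] and [v]. *)
Lemma min_powerD q u v w : 0 < q -> q <= 2 ->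
  0 <= u -> 0 <= v -> 0 <= w -> w ^+ 2 = u ^+ 2 + v ^+ 2 ->
  min_power q w <= min_power q u + min_power q v.
Proof.
move=> q0 q2 u0 v0 w0 uvw.
have uw : u <= w by rewrite -(ler_sqr (_ : _ \in Num.nneg)) ?nnegrE// uvw lerDl sqr_ge0.
have vw : v <= w by rewrite -(ler_sqr (_ : _ \in Num.nneg)) ?nnegrE// uvw lerDr sqr_ge0.
have [w1|w1] := leP w 1.
  rewrite !min_power_lt1 ?uvw//; [exact: le_trans vw w1|exact: le_trans uw w1].
have w'0 : 0 < w by exact: lt_trans w1.
rewrite min_power_ge1// ?(ltW w1)//.
have key x : 0 <= x -> x <= w -> x ^+ 2 * w `^ (q - 2) <= min_power q x.
  move=> x0 xw; rewrite le_min; apply/andP; split.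
    rewrite ler_piMr ?sqr_ge0// -[leRHS](powRr0 w); apply: ler_powR; first exact: ltW.
    by rewrite subr_le0.
  move: x0; rewrite le0r => /orP[/eqP->|x0].
    by rewrite expr0n/= mul0r powR_ge0.
  have -> : x ^+ 2 = x `^ (2 - q) * x `^ q.
    by rewrite -powRD ?(gt_eqF x0) ?implybT// subrK powR_mulrn// ltW.
  rewrite mulrAC ler_piMl ?powR_ge0// -[q - 2]opprB powRN.
  rewrite ler_pdivrMr ?powR_gt0// mul1r.
  by apply: ge0_ler_powR; rewrite ?nnegrE ?subr_ge0// ltW.
have -> : w `^ q = w ^+ 2 * w `^ (q - 2).
  by rewrite -powR_mulrn// -powRD ?(gt_eqF w'0) ?implybT// addrC subrK.
by rewrite uvw mulrDl lerD// key.
Qed.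

(** A type 2 inequality with constant 1: averaging over one sign makes [min_power] subadditive. No
    factor accumulates, so the upper bound for random sums does not depend on the number of
    terms. *)
Lemma min_power_two_point q u v a b : 0 < q -> q <= 2 ->
  0 <= u -> 0 <= v -> 0 <= a -> 0 <= b ->
  u ^+ 2 + v ^+ 2 = 2 * (a ^+ 2 + b ^+ 2) ->
  min_power q u + min_power q v <= 2 * (min_power q a + min_power q b).
Proof.
move=> q0 q2 u0 v0 a0 b0 uvab.
pose w := Num.sqrt (a ^+ 2 + b ^+ 2).
have w2 : w ^+ 2 = a ^+ 2 + b ^+ 2 by rewrite sqr_sqrtr// addr_ge0 ?sqr_ge0.
have w0 : 0 <= w by exact: sqrtr_ge0.
apply: (@le_trans _ _ (2 * min_power q w)); last first.
  by rewrite ler_pM2l// min_powerD.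
rewrite -w2 in uvab; rewrite {3}/min_power.
have [_|_] := leP (w ^+ 2) (w `^ q).
  by rewrite -uvab lerD// ge_min lexx.
apply: le_trans (powR_two_point q0 q2 u0 v0 w0 uvab).
by rewrite lerD// ge_min lexx orbT.
Qed.

Lemma min_power_ub q x : 0 < q -> q <= 2 -> 0 <= x ->
  x `^ q <= 1 + min_power q x.
Proof.
move=> q0 q2 x0; have [x1|x1] := leP x 1.
  apply: (@le_trans _ _ 1); last by rewrite lerDl min_power_ge0.
  have : x `^ q <= 1 `^ q by apply: ge0_ler_powR; rewrite ?nnegrE// ltW.
  by rewrite powR1.
by rewrite min_power_ge1 ?(ltW x1)// lerDr.
Qed.

End power_lemmas.

Section stable_weights.
Variables (R : realType) (p q : R).
Hypotheses (q_ge1 : 1 <= q) (ltqp : q < p) (p_lt2 : p < 2).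
Implicit Types (L : nat) (c : R) (H : R -> R).

Let q_gt0 : 0 < q. Proof. exact: lt_le_trans q_ge1. Qed.
Let p_gt0 : 0 < p. Proof. exact: lt_trans ltqp. Qed.
Let q_le2 : q <= 2. Proof. exact/ltW/(lt_trans ltqp). Qed.

Definition tau : R := 2 `^ p^-1.

Lemma tau_gt0 : 0 < tau. Proof. exact: powR_gt0. Qed.

Lemma tau_powR e : tau `^ e = 2 `^ (e / p).
Proof. by rewrite -powRrM mulrC. Qed.

Lemma tau_powRp : tau `^ p = 2.
Proof. by rewrite tau_powR mulfV ?gt_eqF// powRr1. Qed.

Lemma ltr2_powR e f : e < f -> (2 : R) `^ e < 2 `^ f.
Proof.
move=> ef; rewrite -(subrK e f) addrC powRD ?pnatr_eq0 ?implybT//.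
rewrite ltr_pMr ?powR_gt0//.
have h : 0 < f - e by rewrite subr_gt0.
rewrite lt_neqAle; apply/andP; split; last first.
  by have := @ler_powR R 2 (ler1n _ _) 0 (f - e) (ltW h); rewrite powRr0.
rewrite eq_sym powR_eq1 !negb_or (gt_eqF h) -leNgt ler0n andbT/=.
by rewrite -subr_eq0; apply/eqP; lra.
Qed.

Lemma tau_powRq_lt2 : tau `^ q < 2.
Proof.
rewrite tau_powR -[ltRHS]powRr1//; apply: ltr2_powR.
by rewrite ltr_pdivrMr// mul1r.
Qed.

Lemma tau_sqr_gt2 : 2 < tau ^+ 2.
Proof.
rewrite -powR_mulrn ?(ltW tau_gt0)// tau_powR -[ltLHS]powRr1//.
by apply: ltr2_powR; rewrite ltr_pdivlMr// mul1r.
Qed.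

(* Weights and values of a random variable taking the value [tau ^ k] with
   probability [2^-(k+1)], the tail being cut at [k = L]: its distribution
   function is of order [v^-p]. *)
Fixpoint tail_dist L : seq (R * R) :=
  if L is L'.+1 then
    (2^-1, 1) :: [seq (wv.1 / 2, tau * wv.2) | wv <- tail_dist L']
  else [:: (1, 1)].

Definition tail_mean L H : R := \sum_(wv <- tail_dist L) wv.1 * H wv.2.

Lemma tail_mean0 H : tail_mean 0 H = H 1.
Proof. by rewrite /tail_mean big_seq1 mul1r. Qed.

Lemma tail_meanS L H :
  tail_mean L.+1 H = (H 1 + tail_mean L (fun v => H (tau * v))) / 2.
Proof.
rewrite /tail_mean/= big_cons big_map/= mulrDl mulrC; congr (_ + _).
by rewrite mulr_suml; apply: eq_bigr => wv _ /=; rewrite mulrAC.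
Qed.

Lemma tail_mean_scaleS L c H : tail_mean L.+1 (fun v => H (c * v)) =
  (H c + tail_mean L (fun v => H (c * tau * v))) / 2.
Proof.
rewrite tail_meanS mulr1; congr ((_ + tail_mean _ _) / _).
by apply/funext => v; rewrite mulrA.
Qed.

Lemma tail_mean1 L : tail_mean L (fun=> 1) = 1.
Proof.
by elim: L => [|L IHL]; rewrite ?tail_mean0// tail_meanS IHL mulfV.
Qed.

Lemma tail_dist_ge0 L wv : wv \in tail_dist L -> 0 <= wv.1 /\ 0 <= wv.2.
Proof.
elim: L wv => [|L IHL] wv /=; first by rewrite inE => /eqP->.
rewrite inE => /orP[/eqP->//=|/mapP[u /IHL[u1 u2] ->]] /=.
by rewrite divr_ge0// mulr_ge0// ltW// tau_gt0.
Qed.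

Let B : R := (1 - tau `^ q / 2)^-1.
Let D : R := (tau ^+ 2 / 2 - 1)^-1.
Definition stable_const : R := B + 1 + D.

Let B_gt0 : 0 < B.
Proof. by rewrite invr_gt0 subr_gt0 ltr_pdivrMr// mul1r tau_powRq_lt2. Qed.
Let D_gt0 : 0 < D.
Proof. by rewrite invr_gt0 subr_gt0 ltr_pdivlMr// mul1r tau_sqr_gt2. Qed.
Let BE : 1 + tau `^ q * B / 2 = B.
Proof.
have := B_gt0; rewrite /B invr_gt0 => h.
by field; rewrite gt_eqF//; move: h; lra.
Qed.
Let DE : 1 + D = tau ^+ 2 * D / 2.
Proof.
have := D_gt0; rewrite /D invr_gt0 => h.
by field; rewrite gt_eqF//; move: h; lra.
Qed.

Lemma stable_const_gt0 : 0 < stable_const.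
Proof. by rewrite !addr_gt0. Qed.

(** A supersolution of the recursion [tail_mean_scaleS]. The subtracted multiple of [c ^+ 2] pays
    for the square that each step below the threshold 1 adds. *)
Let bound c := if c < 1 then stable_const * c `^ p - D * c ^+ 2 else B * c `^ q.

Let sqr_le_powR c : 0 <= c -> c <= 1 -> c ^+ 2 <= c `^ p.
Proof.
rewrite le0r => /orP[/eqP->|c0] c1; first by rewrite expr0n/= powR_ge0.
rewrite -powR_mulrn ?(ltW c0)//; apply: ger_powR; [by rewrite c0|exact: ltW].
Qed.

Lemma tail_mean_min_power_bound L c : 0 <= c ->
  tail_mean L (fun v => min_power q (c * v)) <= bound c.
Proof.
elim: L c => [|L IHL] c c0.
  rewrite tail_mean0 mulr1 /bound; case: ltP => c1.
    rewrite min_power_lt1 ?(ltW c1)//.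
    have := sqr_le_powR c0 (ltW c1); have := sqr_ge0 c; have := powR_ge0 c p.
    rewrite /stable_const; move: B_gt0 D_gt0; nra.
  rewrite min_power_ge1// ler_peMl ?powR_ge0// -BE lerDl divr_ge0//.
  by rewrite mulr_ge0 ?powR_ge0// ltW.
have tc0 : 0 <= c * tau by rewrite mulr_ge0// ltW// tau_gt0.
rewrite tail_mean_scaleS ler_pdivrMr//.
apply: (le_trans (lerD (lexx _) (IHL _ tc0))); rewrite /bound.
have tau1 : 1 <= tau.
  by rewrite -(ler_sqr (_ : _ \in Num.nneg)) ?nnegrE ?(ltW tau_gt0)//
    expr1n (le_trans _ (ltW tau_sqr_gt2))// ler1n.
case: (ltP c 1) => c1; last first.
  rewrite ltNge mulr_ege1//= min_power_ge1// powRM// ?(ltW tau_gt0)//.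
  rewrite -[X in _ <= X * _ * 2]BE; have := powR_ge0 c q; lra.
rewrite min_power_lt1 ?(ltW c1)//; case: ltP => ct1.
  rewrite powRM ?(ltW tau_gt0)// tau_powRp exprMn.
  have := sqr_ge0 c; move: DE; nra.
have : (c * tau) `^ q <= (c * tau) `^ p by apply: ler_powR => //; exact: ltW.
rewrite [(c * tau) `^ p]powRM ?(ltW tau_gt0)// tau_powRp.
have := sqr_le_powR c0 (ltW c1); have := sqr_ge0 c; have := powR_ge0 c p.
rewrite /stable_const; move: B_gt0 D_gt0; nra.
Qed.

Lemma tail_mean_min_power L c : 0 <= c -> c <= 1 ->
  tail_mean L (fun v => min_power q (c * v)) <= stable_const * c `^ p.
Proof.
move=> c0 c1; apply: (le_trans (tail_mean_min_power_bound L c0)).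
rewrite /bound; case: ltP => c1'.
  by rewrite gerBl mulr_ge0 ?sqr_ge0// ltW.
have -> : c = 1 by apply/le_anti; rewrite c1 c1'.
by rewrite !powR1 !mulr1 /stable_const -addrA lerDl addr_ge0// ltW.
Qed.

(** At powers of [tau] the tail is exactly of order [p]; rounding [c^-1] up to the next power costs
    the factor 2. The last hypothesis keeps [c^-1] below the largest value [tau ^+ L]. *)
Lemma tail_mean_ge L c : 0 <= c -> c <= 1 -> 1 <= 2 ^+ L * c `^ p ->
  c `^ p / 2 <= tail_mean L (fun v => (1 <= c * v)%R%:R).
Proof.
have tau1 : 1 <= tau.
  by rewrite -(ler_sqr (_ : _ \in Num.nneg)) ?nnegrE ?(ltW tau_gt0)//
    expr1n (le_trans _ (ltW tau_sqr_gt2))// ler1n.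
have large M d : 1 <= d -> tail_mean M (fun v => (1 <= d * v)%R%:R) = 1.
  elim: M d => [|M IHM] d d1; first by rewrite tail_mean0 mulr1 d1.
  rewrite (tail_mean_scaleS M d (fun v => (1 <= v)%R%:R)) d1.
  by rewrite IHM ?mulr_ege1// mulfV.
have le1 d : 0 <= d -> d <= 1 -> d `^ p <= 1.
  move=> d0 d1; have : d `^ p <= 1 `^ p.
    by apply: ge0_ler_powR; rewrite ?nnegrE// ltW.
  by rewrite powR1.
elim: L c => [|L IHL] c c0 c1 cL.
  rewrite tail_mean0 mulr1; rewrite expr0 mul1r in cL.
  have -> : 1 <= c.
    rewrite leNgt; apply/negP => c1'; move: cL; apply/negP; rewrite -ltNge.
    have : c `^ p < 1 `^ p by apply: gt0_ltr_powR; rewrite ?nnegrE.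
    by rewrite powR1.
  by rewrite /=; have := le1 _ c0 c1; lra.
rewrite (tail_mean_scaleS L c (fun v => (1 <= v)%R%:R)).
have tp : (c * tau) `^ p = 2 * c `^ p.
  by rewrite powRM ?(ltW tau_gt0)// tau_powRp mulrC.
have [ct1|ct1] := leP (c * tau) 1; last first.
  rewrite large ?(ltW ct1)//.
  have : (0 : R) <= (1 <= c)%R%:R by []. 
  by rewrite /=; have := le1 _ c0 c1; lra.
have := IHL (c * tau); rewrite tp => /(_ _ ct1 _) H.
have : (0 : R) <= (1 <= c)%R%:R by [].
have : 2 * c `^ p / 2 <= tail_mean L (fun v => (1 <= c * tau * v)%R%:R).
  by apply: H; rewrite ?mulr_ge0 ?(ltW tau_gt0)// mulrA -exprSr.
lra.
Qed.

End stable_weights.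

Section stable_samples.
Variables (R : realType) (s : scalars) (p q : R).
Hypotheses (q_ge1 : 1 <= q) (ltqp : q < p) (p_lt2 : p < 2).
Local Notation K := (scalar R s).
Local Notation tail_dist := (tail_dist p).
Local Notation tail_mean := (tail_mean p).
Implicit Types (L d : nat) (x : nat -> K) (z : K) (F : K -> R).

Let q_gt0 : 0 < q. Proof. exact: lt_le_trans q_ge1. Qed.
Let q_le2 : q <= 2. Proof. exact/ltW/(lt_trans ltqp). Qed.

Definition signed_dist L : seq (R * K) :=
  [seq (wv.1 / 2, of_real s wv.2) | wv <- tail_dist L] ++
  [seq (wv.1 / 2, - of_real s wv.2) | wv <- tail_dist L].

(** The joint law of [d] independent symmetrized variables, listed outcome by outcome; independence
    is the product of the weights. *)
Fixpoint samples L d : seq (R * (nat -> K)) :=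
  if d is d'.+1 then
    [seq (r.1 * u.1, fun i => if i == d' then u.2 else r.2 i)
       | r <- samples L d', u <- signed_dist L]
  else [:: (1, fun=> 0)].

Definition sample_mean L d x F z : R :=
  \sum_(r <- samples L d) r.1 * F (z + \sum_(i < d) r.2 i * x i).

Lemma sample_mean0 L x F z : sample_mean L 0 x F z = F z.
Proof. by rewrite /sample_mean big_seq1 mul1r big_ord0 addr0. Qed.

Lemma sample_meanS L d x F z : sample_mean L d.+1 x F z =
  \sum_(wv <- tail_dist L) wv.1 *
    ((sample_mean L d x F (z + of_real s wv.2 * x d) +
      sample_mean L d x F (z - of_real s wv.2 * x d)) / 2).
Proof.
rewrite /sample_mean/= big_allpairs_dep/= exchange_big/= big_cat !big_map/=.
rewrite -big_split/=; apply: eq_bigr => wv _.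
have step (r : R * (nat -> K)) (u : K) :
    z + \sum_(i < d.+1) (if i == d :> nat then u else r.2 i) * x i =
    z + u * x d + \sum_(i < d) r.2 i * x i.
  rewrite big_ord_recr/= eqxx -!addrA; congr (_ + _); rewrite addrC.
  by congr (_ + _); apply: eq_bigr => i _; rewrite ltn_eqF.
rewrite mulrDl mulrDr !mulr_suml !mulr_sumr.
by congr (_ + _); apply: eq_bigr => r _; rewrite step ?mulNr; field.
Qed.

Lemma samples_ge0 L d r : r \in [seq u.1 | u <- samples L d] -> 0 <= r.
Proof.
elim: d r => [|d IHd] r; first by rewrite inE => /eqP->.
move=> /mapP[u /allpairsP[[v w] /= [v1 w1 ->]] ->] /=.
apply: mulr_ge0; first by apply: IHd; apply: map_f.
by move: w1; rewrite mem_cat => /orP[] /mapP[t /tail_dist_ge0[t0 _] ->];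
  rewrite /= divr_ge0.
Qed.

Lemma ler_sample_mean L d x F G z z' :
  (forall u, F (z + u) <= G (z' + u)) ->
  sample_mean L d x F z <= sample_mean L d x G z'.
Proof.
move=> FG; rewrite /sample_mean !big_seq; apply: ler_sum => r rL.
by rewrite ler_wpM2l//; apply: (@samples_ge0 L d); exact: map_f.
Qed.

Lemma sample_meanD L d x F G z z' :
  sample_mean L d x F z + sample_mean L d x G z' =
  sample_mean L d x (fun u => F (z + u) + G (z' + u)) 0.
Proof.
rewrite /sample_mean -big_split/=; apply: eq_bigr => r _.
by rewrite -mulrDr !add0r.
Qed.

Lemma tail_dist_sum L : \sum_(wv <- tail_dist L) wv.1 = 1.
Proof.
by rewrite -[RHS](tail_mean1 p L); apply: eq_bigr => wv _; rewrite mulr1.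
Qed.

Lemma sample_mean_cst L d x (c : R) z : sample_mean L d x (fun=> c) z = c.
Proof.
elim: d z => [|d IHd] z; first by rewrite sample_mean0.
rewrite sample_meanS -[RHS]mul1r -[X in _ = X * _](tail_dist_sum L) mulr_suml.
by apply: eq_bigr => wv _; rewrite !IHd; field.
Qed.

Lemma tail_dist_sumr_ge L (f g : R * R -> R) :
  (forall wv, 0 <= wv.2 -> f wv <= g wv) ->
  \sum_(wv <- tail_dist L) wv.1 * f wv <= \sum_(wv <- tail_dist L) wv.1 * g wv.
Proof.
move=> fg; rewrite !big_seq; apply: ler_sum => wv /tail_dist_ge0[w1 w2].
by rewrite ler_wpM2l// fg.
Qed.

(** The last variable is split off and its sign averaged by [min_power_two_point]. The starting
    point [z] is arbitrary so that the induction hypothesis applies after the shift by that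
    variable. *)
Lemma sample_mean_min_power L d x z :
  sample_mean L d x (fun u => min_power q (modulus u)) z <=
  min_power q (modulus z) +
  \sum_(i < d) tail_mean L (fun v => min_power q (modulus (x i) * v)).
Proof.
elim: d z => [|d IHd] z; first by rewrite sample_mean0 big_ord0 addr0.
set S := \sum_(i < d) _ in IHd.
rewrite sample_meanS big_ord_recr/= -/S.
set a := min_power q (modulus z).
have -> : a + (S + tail_mean L (fun v => min_power q (modulus (x d) * v))) =
    \sum_(wv <- tail_dist L) wv.1 *
      (min_power q (modulus (x d) * wv.2) + (a + S)).
  under [RHS]eq_bigr do rewrite mulrDr.
  rewrite big_split/= -mulr_suml tail_dist_sum mul1r /tail_mean.
  by rewrite addrA addrC.
apply: tail_dist_sumr_ge => wv v0; rewrite ler_pdivrMr//.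
apply: (le_trans (lerD (IHd _) (IHd _))).
set y := of_real s wv.2 * x d.
have -> : modulus (x d) * wv.2 = modulus y.
  by rewrite /y modulusM modulus_of_real// mulrC.
have := @min_power_two_point R q _ _ (modulus z) (modulus y) q_gt0 q_le2
  (modulus_ge0 (z + y)) (modulus_ge0 (z - y)) (modulus_ge0 _) (modulus_ge0 _)
  (modulus_parallelogram z y).
rewrite -/a; lra.
Qed.

(** Some summand has modulus at least 1 with probability at least [sig / (1 + sig)]. Once this
    happens, one of the two signs of that summand leaves a total of modulus at least 1, which
    accounts for the final factor 1/2. *)
Lemma sample_mean_powR_ge L d x z :
  let sig := \sum_(i < d) tail_mean L (fun v => (1 <= modulus (x i) * v)%R%:R) in
  sig / (1 + sig) / 2 <=
  sample_mean L d x (fun u => modulus u `^ q) z.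
Proof.
have indic_ge0 (b : bool) : 0 <= b%:R :> R by [].
have P_ge0 i : 0 <= tail_mean L (fun v => (1 <= modulus (x i) * v)%R%:R).
  rewrite /tail_mean big_seq; apply: sumr_ge0 => wv /tail_dist_ge0[w0 _].
  by rewrite mulr_ge0.
elim: d z => [|d IHd] z.
  by rewrite /= big_ord0 mul0r mul0r sample_mean0 powR_ge0.
move: IHd; rewrite /= big_ord_recr/=.
set sig := \sum_(i < d) _; set P := tail_mean _ _ => IHd.
have sig0 : 0 <= sig by apply: sumr_ge0 => i _.
have P0 : 0 <= P by exact: P_ge0.
set rho := sig / (1 + sig) in IHd.
have rho_ge0 : 0 <= rho by rewrite divr_ge0// addr_ge0.
apply: (@le_trans _ _ ((P + (1 - P) * rho) / 2)).
  rewrite ler_pM2r ?invr_gt0// ler_pdivrMr ?ltr_pwDl ?addr_ge0//.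
  have -> : (P + (1 - P) * rho) * (1 + (sig + P)) =
      sig + P + (P * rho + P ^+ 2 * (1 - rho)).
    by rewrite /rho; field; rewrite gt_eqF// ltr_pwDl.
  rewrite lerDl; apply: addr_ge0; first exact: mulr_ge0.
  apply: mulr_ge0; first exact: sqr_ge0.
  rewrite subr_ge0 ler_pdivrMr ?ltr_pwDl// mul1r.
  by rewrite lerDr.
rewrite sample_meanS.
have -> : (P + (1 - P) * rho) / 2 = \sum_(wv <- tail_dist L) wv.1 *
    (((1 <= modulus (x d) * wv.2)%R%:R * (1 - rho) + rho) / 2).
  under [RHS]eq_bigr do rewrite mulrA mulrDr mulrA.
  by rewrite -mulr_suml big_split/= -!mulr_suml tail_dist_sum mul1r /P /tail_mean; field.
apply: tail_dist_sumr_ge => wv v0; rewrite ler_pM2r ?invr_gt0//.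
set y := of_real s wv.2 * x d.
have -> : modulus (x d) * wv.2 = modulus y.
  by rewrite /y modulusM modulus_of_real// mulrC.
have [y1|y1] := leP 1 (modulus y); rewrite /= ?mul1r ?mul0r ?add0r; last first.
  have := IHd (z + y); have := IHd (z - y); lra.
rewrite subrK sample_meanD -[leLHS](sample_mean_cst L d x 1 0).
apply: ler_sample_mean => u; rewrite add0r.
rewrite -![z + _ + u]addrAC; have one v : 1 <= modulus v -> 1 <= modulus v `^ q.
  by move=> v1; have := ler_powR v1 (ltW q_gt0); rewrite powRr0.
case/orP: (max_modulusD (z + u) y1) => /one H.
  by rewrite (le_trans H)// lerDl powR_ge0.
by rewrite (le_trans H)// lerDr powR_ge0.
Qed.

End stable_samples.

(* For independent symmetric variables with tails [v^-p] the combination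
   [\sum_i x_i xi_i] has [L^q]-norm comparable with the [l^p]-norm of [x]. *)
Lemma stable_embedding_unit (R : realType) (s : scalars) (p q : R) (d : nat) :
  1 <= q -> q < p -> p < 2 ->
  exists (M : nat) (a : nat -> nat -> scalar R s), forall x : nat -> scalar R s,
    \sum_(i < d) modulus (x i) `^ p = 1 ->
    1 <= \sum_(k < M) modulus (\sum_(i < d) a k i * x i) `^ q <=
      10 * (1 + stable_const p q).
Proof.
move=> q1 qp p2; have q0 : 0 < q by exact: lt_le_trans q1.
have p0 : 0 < p by exact: lt_trans qp.
have q2 : q <= 2 by exact/ltW/(lt_trans qp).
(* With [L = 2 d] the coordinates too small for [tail_mean_ge] contribute at most
   [d * 2 ^- L <= 1 / 2]. Hence [sig >= 1 / 4], the sample mean is at least [1 / 10], and the factor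
   10 in the coefficients normalizes the lower bound to 1. *)
pose L := d.*2; pose rs := samples s p L d; pose r0 : R * (nat -> scalar R s) := (0, fun=> 0).
exists (size rs), (fun k i => of_real s ((10 * (nth r0 rs k).1) `^ q^-1) *
  (nth r0 rs k).2 i) => x x1.
have -> : \sum_(k < size rs) modulus (\sum_(i < d)
      of_real s ((10 * (nth r0 rs k).1) `^ q^-1) * (nth r0 rs k).2 i * x i) `^ q =
    10 * sample_mean p L d x (fun u => modulus u `^ q) 0.
  rewrite /sample_mean mulr_sumr (big_nth r0) big_mkord.
  apply: eq_bigr => k _; under eq_bigr do rewrite -mulrA.
  rewrite -mulr_sumr modulusM modulus_of_real ?powR_ge0//.
  have rk0 : 0 <= (nth r0 rs k).1.
    by apply: (@samples_ge0 R s p L d); apply/map_f/mem_nth.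
  rewrite powRM ?powR_ge0 ?modulus_ge0// -powRrM mulVf ?gt_eqF// powRr1.
    by rewrite add0r mulrA.
  by rewrite mulr_ge0.
have xi1 i : (i < d)%N -> modulus (x i) `^ p <= 1.
  move=> id; rewrite -x1 (bigD1 (Ordinal id))//= lerDl.
  by apply: sumr_ge0 => j _; exact: powR_ge0.
have le1 i : (i < d)%N -> modulus (x i) <= 1.
  move=> /xi1 H; rewrite leNgt; apply/negP => xi.
  have : 1 `^ p < modulus (x i) `^ p.
    by apply: gt0_ltr_powR; rewrite ?nnegrE ?modulus_ge0.
  by rewrite powR1 ltNge H.
apply/andP; split; last first.
  rewrite ler_pM2l//.
  apply: (@le_trans _ _ (sample_mean p L d x
      (fun u => 1 + min_power q (modulus u)) 0)).
    by apply: ler_sample_mean => u; rewrite min_power_ub ?modulus_ge0.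
  have -> : sample_mean p L d x (fun u => 1 + min_power q (modulus u)) 0 =
      1 + sample_mean p L d x (fun u => min_power q (modulus u)) 0.
    rewrite -[in RHS](sample_mean_cst p L d x 1 0) sample_meanD; congr sample_mean.
    by apply/funext => u; rewrite add0r.
  rewrite lerD2l (le_trans (sample_mean_min_power q1 qp p2 _ _ _ _))//.
  rewrite modulus0 min_power_lt1// expr0n/= add0r -[leRHS]mulr1 -x1 mulr_sumr.
  apply: ler_sum => i _.
  exact: tail_mean_min_power (modulus_ge0 _) (le1 _ (ltn_ord i)).
have := sample_mean_powR_ge p q1 L d x 0.
set sig := \sum_(i < d) _ => /= H.
have sig4 : 4^-1 <= sig.
  have {1}-> : 4^-1 = (1 - 2^-1) / 2 :> R by field.
  rewrite ler_pdivrMr// lerBlDr -[leLHS]x1.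
  have h i : (i < d)%N -> modulus (x i) `^ p <=
      tail_mean p L (fun v => (1 <= modulus (x i) * v)%R%:R) * 2 + 2 ^- L.
    move=> id; have [xL|xL] := leP 1 (2 ^+ L * modulus (x i) `^ p).
      have := tail_mean_ge q1 qp p2 (modulus_ge0 _) (le1 _ id) xL.
      have : (0 : R) < 2 ^- L by rewrite invr_gt0 exprn_gt0.
      lra.
    apply: (@le_trans _ _ (2 ^- L)); last first.
      rewrite lerDr mulr_ge0// /tail_mean big_seq.
      by apply: sumr_ge0 => wv /tail_dist_ge0[w0 _]; rewrite mulr_ge0.
    by rewrite -[leRHS]mul1r ler_pdivlMr ?exprn_gt0// mulrC ltW.
  apply: (@le_trans _ _ (\sum_(i < d)
      (tail_mean p L (fun v => (1 <= modulus (x i) * v)%R%:R) * 2 + 2 ^- L))).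
    by apply: ler_sum => i _; exact: h.
  rewrite big_split/= -mulr_suml lerD2l sumr_const card_ord -[leLHS]mulr_natr.
  rewrite mulrC ler_pdivrMr ?exprn_gt0// /L.
  have dL : (2 * d <= 2 ^ d.*2)%N by rewrite mul2n ltnW// ltn_expl.
  by rewrite -natrX mulrC ler_pdivlMr// -natrM ler_nat mulnC.
have sig0 : 0 < 1 + sig by lra.
have : 5^-1 <= sig / (1 + sig) by rewrite ler_pdivlMr//; lra.
move: H; lra.
Qed.

Lemma stable_embedding (R : realType) (s : scalars) (p q : R) :
  1 <= q -> q <= p -> p < 2 -> exists2 C : R, 1 <= C &
  forall d, exists (M : nat) (a : nat -> nat -> scalar R s),
  forall x : nat -> scalar R s,
    (\sum_(i < d) modulus (x i) `^ p) `^ (q / p) <=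
      \sum_(k < M) modulus (\sum_(i < d) a k i * x i) `^ q <=
      C * (\sum_(i < d) modulus (x i) `^ p) `^ (q / p).
Proof.
move=> q1 qp p2; have q0 : 0 < q by exact: lt_le_trans q1.
have p0 : 0 < p by exact: lt_le_trans qp.
have sum_ge0 d (x : nat -> scalar R s) : 0 <= \sum_(i < d) modulus (x i) `^ p.
  by apply: sumr_ge0 => i _; exact: powR_ge0.
have [{}qp|qp'] := ltP q p; last first.
  have pq : p = q by apply/le_anti; rewrite qp' qp.
  exists 1 => // d; exists d, (fun k i => (k == i)%:R) => x.
  rewrite pq mulfV ?gt_eqF// powRr1 -?pq//.
  rewrite mul1r; set S := (X in _ <= X <= _).
  suff -> : S = \sum_(i < d) modulus (x i) `^ p by rewrite !lexx.
  apply: eq_bigr => k _; rewrite (bigD1 k)//= eqxx mul1r big1 ?addr0// => i ik.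
  by rewrite (_ : (k == i :> nat) = false) ?mul0r// eq_sym; apply/negbTE.
exists (10 * (1 + stable_const p q)).
  have := stable_const_gt0 q1 qp p2; lra.
move=> d; have [M [a aP]] := stable_embedding_unit s d q1 qp p2.
exists M, a => x; pose N := (\sum_(i < d) modulus (x i) `^ p) `^ p^-1.
have -> : (\sum_(i < d) modulus (x i) `^ p) `^ (q / p) = N `^ q.
  by rewrite mulrC powRrM.
have [N0|N0] := eqVneq N 0.
  have x0 i : (i < d)%N -> x i = 0.
    move=> id; apply: modulus_eq0.
    move/eqP: N0; rewrite powR_eq0 => /andP[/eqP S0 _].
    have /eqP := S0; rewrite psumr_eq0 => [/allP/(_ (Ordinal id))|j _]; last first.
      exact: powR_ge0.
    by rewrite mem_index_enum powR_eq0 => /(_ isT)/andP[/eqP].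
  rewrite N0 powR0 ?gt_eqF// mulr0 big1 ?lexx// => k _.
  rewrite big1 ?modulus0 ?powR0 ?gt_eqF// => i _.
  by rewrite x0 ?mulr0.
have {}N0 : 0 < N by rewrite lt0r N0 powR_ge0.
pose y i := of_real s N^-1 * x i.
have yE i : modulus (y i) = N^-1 * modulus (x i).
  by rewrite modulusM modulus_of_real// invr_ge0 ltW.
have y1 : \sum_(i < d) modulus (y i) `^ p = 1.
  under eq_bigr do rewrite yE powRM ?invr_ge0 ?(ltW N0) ?modulus_ge0//.
  rewrite -mulr_sumr.
  have -> : \sum_(i < d) modulus (x i) `^ p = N `^ p.
    by rewrite /N -powRrM mulVf ?gt_eqF// powRr1.
  by rewrite -powRM ?invr_ge0 ?(ltW N0)// mulVf ?gt_eqF// powR1.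
have := aP y y1.
have -> : \sum_(k < M) modulus (\sum_(i < d) a k i * y i) `^ q =
    (N `^ q)^-1 * \sum_(k < M) modulus (\sum_(i < d) a k i * x i) `^ q.
  rewrite mulr_sumr; apply: eq_bigr => k _.
  have -> : \sum_(i < d) a k i * y i =
      of_real s N^-1 * \sum_(i < d) a k i * x i.
    by rewrite mulr_sumr; apply: eq_bigr => i _; rewrite mulrCA.
  rewrite modulusM modulus_of_real ?invr_ge0 ?(ltW N0)//.
  rewrite powRM ?invr_ge0 ?(ltW N0) ?modulus_ge0//; congr (_ * _).
  by rewrite -powR_inv1 ?(ltW N0)// -powRN powRAC powR_inv1 ?powR_ge0// powRN.
have Nq : 0 < N `^ q by rewrite powR_gt0.
by rewrite mulrC ler_pdivlMr// mul1r ler_pdivrMr.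
Qed.

(** * Embeddings of mixed sums *)

Section seq_embedding.
Variables (R : realType) (s : scalars).
Local Notation K := (scalar R s).

Definition powsum (p : R) (T : Type) (L : seq T) (x : T -> K) : R :=
  \sum_(j <- L) modulus (x j) `^ p.

Lemma powsum_ge0 p (T : Type) (L : seq T) x : 0 <= powsum p L x.
Proof. by apply: sumr_ge0 => j _; exact: powR_ge0. Qed.

Lemma eq_powsum p (T : eqType) (L : seq T) x y :
  {in L, x =1 y} -> powsum p L x = powsum p L y.
Proof. by move=> xy; apply: eq_big_seq => j jL; rewrite xy. Qed.

Lemma powsum_eq0 p (T : eqType) (L : seq T) x j : p != 0 ->
  powsum p L x = 0 -> j \in L -> x j = 0.
Proof.
move=> p0 /eqP; rewrite psumr_eq0 => [/allP xL jL|i _]; last exact: powR_ge0.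
have := xL _ jL; rewrite /= powR_eq0 p0 andbT => /eqP.
exact: modulus_eq0.
Qed.

Lemma stable_embedding_seq (p q : R) :
  1 <= q -> q <= p -> p < 2 -> exists2 C : R, 1 <= C &
  forall (T : eqType) (L : seq T), uniq L ->
  exists (M : nat) (a : nat -> T -> K), forall x : T -> K,
    powsum p L x `^ (q / p) <=
      \sum_(k < M) modulus (\sum_(j <- L) a k j * x j) `^ q <=
      C * powsum p L x `^ (q / p).
Proof.
move=> q1 qp p2; have [C C1 emb] := stable_embedding s q1 qp p2.
exists C => // T [|j0 L'] uL.
  exists 0, (fun _ _ => 0) => x.
  rewrite /powsum big_ord0 big_nil powR0 ?mulr0 ?lexx//.
  by rewrite mulf_neq0 ?invr_eq0 ?gt_eqF// ?(lt_le_trans _ qp)//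
    (lt_le_trans _ q1).
set L := j0 :: L' in uL *; have [M [a aP]] := emb (size L).
exists M, (fun k j => a k (index j L)) => x.
have := aP (fun i => x (nth j0 L i)).
have -> : \sum_(i < size L) modulus (x (nth j0 L i)) `^ p = powsum p L x.
  by rewrite /powsum (big_nth j0) big_mkord.
suff -> : \sum_(k < M) modulus (\sum_(i < size L) a k i * x (nth j0 L i)) `^ q =
  \sum_(k < M) modulus (\sum_(j <- L) a k (index j L) * x j) `^ q by [].
apply: eq_bigr => k _; rewrite (big_nth j0) big_mkord.
by congr (modulus _ `^ _); apply: eq_bigr => i _; rewrite index_uniq.
Qed.

Section mixed.
Variables (t u : R) (T T' : eqType) (blk : T -> T').
Implicit Types (L : seq T) (x : T -> K).

(** The [t]-th power of the [l^t]-sum over the blocks of the [l^u]-norms; being a power rather than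
    a norm, it appears below with exponents such as [q / t]. *)
Definition mixed_sum L x : R :=
  \sum_(l <- undup (map blk L)) powsum u [seq j <- L | blk j == l] x `^ (t / u).

Lemma mixed_sum_ge0 L x : 0 <= mixed_sum L x.
Proof. by apply: sumr_ge0 => l _; exact: powR_ge0. Qed.

Lemma eq_mixed_sum L x y : {in L, x =1 y} -> mixed_sum L x = mixed_sum L y.
Proof.
move=> xy; apply: eq_bigr => l _; congr (_ `^ _); apply: eq_powsum => j.
by rewrite mem_filter => /andP[_ /xy].
Qed.

Hypotheses (t_gt0 : 0 < t) (u_gt0 : 0 < u).

Let tu0 : t / u != 0.
Proof. by rewrite mulf_neq0 ?invr_eq0 ?gt_eqF. Qed.

Lemma mixed_sum_eq0 L x j : mixed_sum L x = 0 -> j \in L -> x j = 0.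
Proof.
move=> /eqP; rewrite psumr_eq0 => [/allP xL jL|i _]; last exact: powR_ge0.
have := xL (blk j); rewrite mem_undup map_f// => /(_ isT) /=.
rewrite powR_eq0 tu0 andbT => /eqP/powsum_eq0; apply; first exact: lt0r_neq0.
by rewrite mem_filter eqxx.
Qed.

Lemma mixed_sum_block L x l : (forall j, j \in L -> blk j != l -> x j = 0) ->
  mixed_sum L x <= powsum u L x `^ (t / u).
Proof.
move=> xl.
have term l' : l' != l -> powsum u [seq j <- L | blk j == l'] x `^ (t / u) = 0.
  move=> l'l; rewrite /powsum big_seq big1 ?powR0// => j.
  rewrite mem_filter => /andP[/eqP jl' jL].
  by rewrite xl ?jl'// modulus0 powR0// gt_eqF.
have filterL : powsum u [seq j <- L | blk j == l] x <= powsum u L x.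
  rewrite /powsum big_filter [leRHS](bigID (fun j => blk j == l))/= lerDl.
  by apply: sumr_ge0 => j _; exact: powR_ge0.
have [lL|lL] := boolP (l \in undup (map blk L)); last first.
  rewrite /mixed_sum big_seq big1 ?powR_ge0// => l' l'L.
  by rewrite term//; apply: contraNneq lL => <-.
rewrite /mixed_sum (bigD1_seq l) ?undup_uniq//= big1 ?addr0.
  apply: ge0_ler_powR; rewrite ?nnegrE ?powsum_ge0//.
  by rewrite divr_ge0// ltW.
by move=> l' l'l; exact: term.
Qed.

End mixed.

(** Two embeddings are composed: [l^u] into [l^t] inside every block, then the [l^t]-sum of the
    results into [l^q]. A single inner embedding of the whole list serves all blocks, applied to the
    restrictions [xl l]. *)
Lemma mixed_embedding (q t u : R) :
  1 <= q -> q <= t -> t <= u -> u < 2 -> exists2 C : R, 1 <= C &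
  forall (T T' : eqType) (blk : T -> T') (L : seq T), uniq L ->
  exists (M : nat) (a : nat -> T -> K), forall x : T -> K,
    mixed_sum t u blk L x `^ (q / t) <=
      \sum_(k < M) modulus (\sum_(j <- L) a k j * x j) `^ q <=
      C * mixed_sum t u blk L x `^ (q / t).
Proof.
move=> q1 qt tu u2.
have t1 : 1 <= t by exact: le_trans q1 qt.
have t2 : t < 2 by exact: le_lt_trans u2.
have u0 : 0 < u by rewrite (lt_le_trans _ tu)// (lt_le_trans _ t1).
have [C1 C11 emb1] := stable_embedding_seq t1 tu u2.
have [C2 C21 emb2] := stable_embedding_seq q1 qt t2.
have qt0 : 0 <= q / t.
  by apply: divr_ge0; [exact: le_trans q1|exact: le_trans t1].
have one : 1 <= C1 `^ (q / t).
  by have := ler_powR C11 qt0; rewrite powRr0.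
exists (C2 * C1 `^ (q / t)); first by rewrite mulr_ege1.
move=> T T' blk L uL; have [M1 [a1 a1P]] := emb1 T L uL.
pose P := [seq (l, k) | l <- undup (map blk L), k <- iota 0 M1].
have uP : uniq P.
  apply: allpairs_uniq; rewrite ?undup_uniq ?iota_uniq//.
  by move=> [? ?] [? ?] _ _ [-> ->].
have [M2 [a2 a2P]] := emb2 _ P uP.
exists M2, (fun m j => \sum_(w <- P) a2 m w * (a1 w.2 j * (blk j == w.1)%:R)) => x.
pose xl l j := (blk j == l)%:R * x j.
pose y (w : T' * nat) := \sum_(j <- L) a1 w.2 j * xl w.1 j.
have -> : \sum_(k < M2) modulus (\sum_(j <- L)
      (\sum_(w <- P) a2 k w * (a1 w.2 j * (blk j == w.1)%:R)) * x j) `^ q =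
    \sum_(k < M2) modulus (\sum_(w <- P) a2 k w * y w) `^ q.
  apply: eq_bigr => k _; congr (modulus _ `^ _).
  under eq_bigr do rewrite mulr_suml; rewrite exchange_big/=.
  apply: eq_bigr => w _; rewrite /y mulr_sumr; apply: eq_bigr => j _.
  by rewrite /xl !mulrA.
have yP : mixed_sum t u blk L x <= powsum t P y <= C1 * mixed_sum t u blk L x.
  have pl l : powsum u [seq j <- L | blk j == l] x = powsum u L (xl l).
    rewrite /powsum big_filter big_mkcond; apply: eq_bigr => j _.
    by rewrite /xl; case: eqP => _; rewrite ?mul1r// mul0r modulus0 powR0 ?gt_eqF.
  have -> : powsum t P y = \sum_(l <- undup (map blk L))
      \sum_(k < M1) modulus (\sum_(j <- L) a1 k j * xl l j) `^ t.
    rewrite /powsum /P big_allpairs_dep/=; apply: eq_bigr => l _.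
    by rewrite -(subn0 M1) -/(index_iota 0 M1) big_mkord subn0.
  rewrite /mixed_sum mulr_sumr; apply/andP; split; apply: ler_sum => l _.
    by rewrite pl; have /andP[] := a1P (xl l).
  by rewrite pl; have /andP[] := a1P (xl l).
have /andP[lo hi] := a2P y; have /andP[ylo yhi] := yP.
apply/andP; split.
  apply: le_trans lo; apply: ge0_ler_powR; rewrite ?nnegrE ?powsum_ge0//.
  exact: mixed_sum_ge0.
apply: (le_trans hi); rewrite -mulrA ler_wpM2l ?(le_trans _ C21)//.
rewrite -powRM ?mixed_sum_ge0 ?(le_trans _ C11)//.
apply: ge0_ler_powR; rewrite ?nnegrE ?powsum_ge0//.
by rewrite mulr_ge0 ?mixed_sum_ge0// (le_trans _ C11).
Qed.

(** No bound on the inverse is recorded: decoding is only ever used coordinate by coordinate, and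
    norms are read off the lower estimate of the embedding. *)
Lemma injective_left_inverse (T : eqType) (L : seq T) (M : nat)
    (a : nat -> T -> K) : uniq L ->
  (forall x : T -> K,
     (forall k, (k < M)%N -> \sum_(j <- L) a k j * x j = 0) ->
     forall j, j \in L -> x j = 0) ->
  exists b : T -> nat -> K, forall (x : T -> K) j, j \in L ->
    \sum_(k < M) b j k * (\sum_(j' <- L) a k j' * x j') = x j.
Proof.
case: L => [|j0 L'] uL inj; first by exists (fun _ _ => 0).
set L := j0 :: L' in uL inj *.
have sumL (F : T -> K) : \sum_(j <- L) F j = \sum_(i < size L) F (nth j0 L i).
  by rewrite (big_nth j0) big_mkord.
pose A := \matrix_(i < size L, k < M) a k (nth j0 L i).
have /row_freeP[B AB] : row_free A.
  apply: inj_row_free => v vA; apply/rowP => i; rewrite mxE.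
  have := inj (fun j => v 0 (insubd i (index j L))) _ (nth j0 L i).
  rewrite mem_nth// index_uniq// valKd; apply => //.
  move=> k kM; move/rowP/(_ (Ordinal kM)): vA; rewrite !mxE => vA.
  rewrite -[RHS]vA sumL; apply: eq_bigr => i' _; rewrite mxE index_uniq// valKd.
  by rewrite mulrC.
pose b (j : T) (k : nat) : K :=
  if (insub k : option 'I_M, insub (index j L) : option 'I_(size L))
  is (Some k', Some i) then B k' i else 0.
exists b => x j jL; have jL' : (index j L < size L)%N by rewrite index_mem.
pose i := Ordinal jL'.
have -> : x j = \sum_(i' < size L) (A *m B) i' i * x (nth j0 L i').
  rewrite AB (bigD1 i)//= mxE eqxx mul1r big1 ?addr0 ?nth_index// => i' i'i.
  by rewrite mxE (negbTE i'i) mul0r.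
under eq_bigr do rewrite sumL mulr_sumr.
rewrite exchange_big/=; apply: eq_bigr => i' _; rewrite mxE mulr_suml.
apply: eq_bigr => k _; rewrite mxE /b valK insubT/= mulrCA mulrA.
by congr (_ * _ * _); congr (B _ _); apply: val_inj.
Qed.

End seq_embedding.

(** * Sequences coded level by level *)

Lemma ler_sum_uniq (R : numDomainType) (T : eqType) (l1 l2 : seq T) (F : T -> R) :
  uniq l1 -> {subset l1 <= l2} -> (forall i, 0 <= F i) ->
  \sum_(i <- l1) F i <= \sum_(i <- l2) F i.
Proof.
move=> + + F0; elim: l1 l2 => [|x l1 IHl1] l2.
  by move=> _ _; rewrite big_nil sumr_ge0.
move=> /= /andP[xl1 ul1] sub; rewrite big_cons.
have xl2 : x \in l2 by apply: sub; exact: mem_head.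
rewrite (perm_big _ (perm_to_rem xl2))/= big_cons lerD2l IHl1// => y yl1.
have : y \in l2 by apply: sub; rewrite inE yl1 orbT.
rewrite (perm_mem (perm_to_rem xl2)) inE => /orP[/eqP yx|//].
by rewrite -yx yl1 in xl1.
Qed.

Section ell_enorm_theory.
Variables (R : realType) (s : scalars) (r : R).
Hypothesis r1 : 1 <= r.
Local Notation K := (scalar R s).
Implicit Types x y : nat -> K.

Let r_gt0 : 0 < r. Proof. exact: lt_le_trans r1. Qed.

Lemma ell_enorm_le x (D : R) : 0 <= D ->
  (forall n, \sum_(i < n) modulus (x i) `^ r <= D `^ r) ->
  (ell_enorm r x <= D%:E)%E.
Proof.
move=> D0 xD; rewrite -[X in (_ <= X%:E)%E](powRr1 D0).
rewrite -(mulfV (lt0r_neq0 r_gt0)) powRrM -poweR_EFin.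
apply: ler_poweRV => //.
  by apply: nneseries_ge0 => n _ _; exact: ell_term_ge0.
apply: lime_le; first by apply: is_cvg_nneseries => n _ _; exact: ell_term_ge0.
by apply: nearW => n; rewrite sumEFin lee_fin big_mkord.
Qed.

Lemma ell_enorm_ge (l : seq nat) x : uniq l ->
  ((powsum r l x `^ r^-1)%:E <= ell_enorm r x)%E.
Proof.
move=> ul; rewrite -poweR_EFin; apply: ler_poweRV => //.
  by rewrite lee_fin powsum_ge0.
pose N := (\max_(i <- l) i).+1.
have lN : {subset l <= index_iota 0 N}.
  by move=> i il; rewrite mem_index_iota/= ltnS leq_bigmax_seq.
apply: (@le_trans _ _ (\sum_(0 <= i < N) (modulus (x i) `^ r)%:E)%E).
  rewrite sumEFin lee_fin; apply: ler_sum_uniq => // i; exact: powR_ge0.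
by apply: nneseries_lim_ge => n _ _; exact: ell_term_ge0.
Qed.

Lemma powsum_le_ell_enorm (l : seq nat) x (D : R) : 0 <= D -> uniq l ->
  (ell_enorm r x <= D%:E)%E -> powsum r l x <= D `^ r.
Proof.
move=> D0 ul xD; have := le_trans (ell_enorm_ge x ul) xD; rewrite lee_fin => H.
have -> : powsum r l x = (powsum r l x `^ r^-1) `^ r.
  by rewrite -powRrM mulVf ?gt_eqF// powRr1// powsum_ge0.
by apply: ge0_ler_powR; rewrite ?nnegrE ?powR_ge0// ltW.
Qed.

Lemma modulus_le_ell_enorm x i : ((modulus (x i))%:E <= ell_enorm r x)%E.
Proof.
have := @ell_enorm_ge [:: i] x isT; rewrite /powsum big_seq1 -powRrM.
by rewrite mulfV ?gt_eqF// powRr1// modulus_ge0.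
Qed.

(** Every [c n] is at most [D], so [c n ^ r <= c n * D ^ (r - 1)] and the [l^1]-sum of the block
    norms dominates the [l^r]-norm. The blocks may overlap. *)
Lemma ell_enorm_blocks_le (Q : nat -> seq nat) (c : nat -> R) (D : R) x :
  (forall i, x i != 0 -> exists n, i \in Q n) ->
  (forall n, powsum r (Q n) x `^ r^-1 <= c n) ->
  (forall N, \sum_(n < N) c n <= D) -> (ell_enorm r x <= D%:E)%E.
Proof.
move=> xQ Qc cD.
have D0 : 0 <= D by rewrite (le_trans _ (cD 0))// big_ord0.
have c0 n : 0 <= c n by rewrite (le_trans _ (Qc n))// powR_ge0.
have c_le n : c n <= D.
  by rewrite (le_trans _ (cD n.+1))// big_ord_recr/= lerDr sumr_ge0.
apply: ell_enorm_le => // n.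
have [N NP] : exists N, forall i, (i < n)%N -> x i != 0 ->
    exists2 k, (k < N)%N & i \in Q k.
  elim: n => [|n [N NP]]; first by exists 0.
  have [xn|xn] := eqVneq (x n) 0.
    exists N => i; rewrite ltnS leq_eqVlt => /orP[/eqP->|]; last exact: NP.
    by rewrite xn eqxx.
  have [k nk] := xQ _ xn; exists (maxn N k.+1) => i.
  rewrite ltnS leq_eqVlt => /orP[/eqP-> _|lin xi].
    by exists k => //; rewrite leq_max ltnSn orbT.
  by have [m mN im] := NP _ lin xi; exists m => //; rewrite leq_max mN.
pose l1 := [seq i <- iota 0 n | x i != 0].
pose l2 := flatten [seq Q k | k <- iota 0 N].
apply: (@le_trans _ _ (\sum_(i <- l1) modulus (x i) `^ r)).
  rewrite /l1 big_filter -(big_mkord predT (fun i => modulus (x i) `^ r)).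
  rewrite /index_iota subn0 [leLHS](bigID (fun i => x i != 0))/= gerDl.
  apply: sumr_le0 => i; rewrite negbK => /eqP->.
  by rewrite modulus0 powR0// gt_eqF.
apply: (@le_trans _ _ (\sum_(i <- l2) modulus (x i) `^ r)).
  apply: ler_sum_uniq => [|i|i]; first by rewrite filter_uniq// iota_uniq.
    rewrite mem_filter mem_iota/= => /andP[xi lin].
    have [k kN iQ] := NP _ lin xi; apply/flattenP; exists (Q k) => //.
    by apply: map_f; rewrite mem_iota.
  exact: powR_ge0.
rewrite /l2 big_flatten big_map/=.
apply: (@le_trans _ _ (\sum_(k <- iota 0 N) c k * D `^ (r - 1))).
  apply: ler_sum => k _.
  have -> : \sum_(i <- Q k) modulus (x i) `^ r = (powsum r (Q k) x `^ r^-1) `^ r.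
    by rewrite -powRrM mulVf ?gt_eqF// powRr1// powsum_ge0.
  apply: (@le_trans _ _ (c k `^ r)).
    by apply: ge0_ler_powR; rewrite ?nnegrE ?powR_ge0// ltW.
  rewrite -mulr_powRB1// ler_wpM2l//.
  by apply: ge0_ler_powR; rewrite ?nnegrE ?subr_ge0.
rewrite -mulr_suml -[leRHS]mulr_powRB1// ler_wpM2r ?powR_ge0//.
by rewrite -(subn0 N) -/(index_iota 0 N) big_mkord.
Qed.

End ell_enorm_theory.

(* [enc] identifies the families [x : T -> K], split into the finite levels
   [L n] normed by [nrm n], with block sequences in [l^r]; [dec] is a left
   inverse of it. *)
Record coding (R : realType) (s : scalars) (r : R) (T : eqType)
    (lev : T -> nat) (L : nat -> seq T) (nrm : nat -> (T -> scalar R s) -> R)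
    (C : R) := Coding {
  enc : (T -> scalar R s) -> nat -> scalar R s ;
  dec : (nat -> scalar R s) -> T -> scalar R s ;
  enc_finite : forall i, exists (l : seq T) (c : T -> scalar R s),
    forall x, enc x i = \sum_(j <- l) c j * x j ;
  dec_finite : forall j, exists (l : seq nat) (c : nat -> scalar R s),
    forall y, dec y j = \sum_(i <- l) c i * y i ;
  encK : forall x j, dec (enc x) j = x j ;
  enc_lower : forall n x, ((nrm n x)%:E <= ell_enorm r (enc x))%E ;
  enc_upper : forall x c D, (forall n, nrm n x <= c n) ->
    (forall N, \sum_(n < N) c n <= D) -> (ell_enorm r (enc x) <= (C * D)%:E)%E ;
  enc_tail : forall m, exists n0, forall x,
    (forall j, (m <= lev j)%N -> x j = 0) -> forall i, (n0 <= i)%N -> enc x i = 0 }.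

Section coding_existence.
Variables (R : realType) (s : scalars) (r : R).
Hypothesis r1 : 1 <= r.
Local Notation K := (scalar R s).
Variables (T : eqType) (lev : T -> nat) (L : nat -> seq T).
Hypothesis uniqL : forall n, uniq (L n).
Hypothesis memL : forall n j, (j \in L n) = (lev j == n).
Variables (nrm : nat -> (T -> K) -> R) (C : R).
Hypothesis nrm_ge0 : forall n x, 0 <= nrm n x.
Hypothesis nrm_eq0 : forall n x j, nrm n x = 0 -> j \in L n -> x j = 0.
Hypothesis C_ge0 : 0 <= C.
Hypothesis embL : forall n, exists (M : nat) (a : nat -> T -> K), forall x,
  nrm n x `^ r <= \sum_(k < M) modulus (\sum_(j <- L n) a k j * x j) `^ r <=
  (C * nrm n x) `^ r.

Let r_gt0 : 0 < r. Proof. exact: lt_le_trans r1. Qed.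

(** Level [n] is embedded on the positions [pickle (n, k)]. Only a supremum over levels below and a
    sum over levels above are retained; this loss is harmless since the levels will decay
    geometrically. *)
Lemma coding_exists : inhabited (coding r lev L nrm C).
Proof.
have [M /choice[a aP]] := choice embL.
have invL n : exists b : T -> nat -> K, forall (x : T -> K) j, j \in L n ->
    \sum_(k < M n) b j k * (\sum_(j' <- L n) a n k j' * x j') = x j.
  apply: injective_left_inverse => // x x0 j; apply: nrm_eq0.
  have /andP[+ _] := aP n x; rewrite big1 => [|k _]; last first.
    by rewrite x0// modulus0 powR0// gt_eqF.
  rewrite le_eqVlt ltNge powR_ge0 orbF powR_eq0 => /andP[/eqP->//].
have [b bP] := choice invL.
pose e x i : K := if (pickle_inv i : option (nat * nat)) is Some nk
  then if (nk.2 < M nk.1)%N then \sum_(j <- L nk.1) a nk.1 nk.2 j * x j else 0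
  else 0.
pose d (y : nat -> K) j :=
  \sum_(k < M (lev j)) b (lev j) j k * y (pickle (lev j, nat_of_ord k)).
pose Q n := [seq pickle (n, k) | k <- iota 0 (M n)].
have uQ n : uniq (Q n).
  rewrite map_inj_in_uniq ?iota_uniq// => k k' _ _.
  by move=> /(congr1 (@pickle_inv (nat * nat)%type)); rewrite !pickleK_inv => -[].
have eQ n x : powsum r (Q n) (e x) =
    \sum_(k < M n) modulus (\sum_(j <- L n) a n k j * x j) `^ r.
  rewrite /powsum big_map -(subn0 (M n)) -/(index_iota 0 (M n)) big_mkord.
  rewrite subn0; apply: eq_bigr => k _.
  by rewrite /e pickleK_inv/= ltn_ord.
have xQ x i : e x i != 0 -> exists n, i \in Q n.
  rewrite /e; have := @pickle_invK (nat * nat)%type i.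
  case: pickle_inv => [[n k]|_]; last by rewrite eqxx.
  move=> /= <-; case: ifP => [kM _|]; last by rewrite eqxx.
  by exists n; apply: map_f; rewrite mem_iota.
have nrmV n x c : 0 <= c -> powsum r (Q n) (e x) <= c `^ r ->
    powsum r (Q n) (e x) `^ r^-1 <= c.
  move=> c0 H; rewrite -[leRHS](powRr1 c0) -(mulfV (lt0r_neq0 r_gt0)) powRrM.
  by apply: ge0_ler_powR; rewrite ?nnegrE ?powR_ge0 ?powsum_ge0// invr_ge0 ltW.
exists; apply: (@Coding R s r T lev L nrm C e d).
- move=> i; rewrite /e; case: pickle_inv => [[n k]|]; last first.
    by exists [::], (fun=> 0) => x; rewrite big_nil.
  case: (ltnP k (M n)) => /= kM; last by exists [::], (fun=> 0) => x; rewrite big_nil.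
  by exists (L n), (a n k).
- move=> j; exists [seq pickle (lev j, k) | k <- iota 0 (M (lev j))].
  exists (fun i => if (pickle_inv i : option (nat * nat)) is Some nk
    then b (lev j) j nk.2 else 0) => y.
  rewrite big_map -(subn0 (M (lev j))) -/(index_iota 0 (M (lev j))) big_mkord.
  by rewrite /d; apply: eq_bigr => k _; rewrite pickleK_inv.
- move=> x j; rewrite /d.
  under eq_bigr => k _ do rewrite /e pickleK_inv/= ltn_ord.
  by rewrite bP// memL.
- move=> n x; apply: le_trans (ell_enorm_ge r1 (e x) (uQ n)).
  rewrite lee_fin eQ -[leLHS](powRr1 (nrm_ge0 _ _)) -(mulfV (lt0r_neq0 r_gt0)).
  rewrite powRrM; have /andP[H _] := aP n x.
  apply: ge0_ler_powR; rewrite ?nnegrE ?powR_ge0 ?sumr_ge0// ?invr_ge0 ?ltW//.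
  by move=> k _; exact: powR_ge0.
- move=> x c D xc cD.
  apply: (@ell_enorm_blocks_le R s r r1 Q (fun n => C * c n)) => //.
  + exact: xQ.
  + move=> n; have c0 : 0 <= c n by rewrite (le_trans _ (xc n)).
    apply: nrmV; first by rewrite mulr_ge0.
    have /andP[_ H] := aP n x; rewrite eQ (le_trans H)//.
    apply: ge0_ler_powR; rewrite ?nnegrE ?mulr_ge0//; first exact: ltW.
    by rewrite ler_wpM2l.
  + by move=> N; rewrite -mulr_sumr ler_wpM2l.
- move=> m; pose n0 := \max_(n < m) (\max_(i <- Q n) i).+1.
  exists n0 => x xm i n0i; rewrite /e.
  have := @pickle_invK (nat * nat)%type i; case: pickle_inv => [[n k]|//] /= nk.
  case: ifP => // kM; rewrite big_seq big1// => j; rewrite memL => /eqP jn.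
  rewrite xm ?mulr0// jn leqNgt; apply/negP => nm.
  move: n0i; apply/negP; rewrite -ltnNge /n0.
  apply: (@leq_trans (\max_(i <- Q n) i).+1).
    rewrite ltnS; apply: leq_bigmax_seq => //.
    by rewrite -nk; apply: map_f; rewrite mem_iota.
  exact: (leq_bigmax (Ordinal nm)).
Qed.

End coding_existence.

(** * Real-valued norms and closed subspaces of [l^r] given by functionals *)

Section real_norm.
Variables (R : realType) (s : scalars).
Local Notation K := (scalar R s).
Local Notation of_real := (@of_real R s).

Lemma ltr_of_real (x y : R) : (of_real x < of_real y) = (x < y).
Proof.
by rewrite !lt_neqAle ler_of_real (inj_eq (@of_real_inj R s)).
Qed.

(** Norms are themselves scalars, possibly complex; this real copy allows suprema and real
    arithmetic over both fields at once. *)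
Definition rnorm (V : normedModType K) (x : V) : R := modulus `|x|.

Section rnorm_theory.
Variable V : normedModType K.
Implicit Types x y : V.

Lemma normr_rnorm x : `|x| = of_real (rnorm x).
Proof. exact: ge0_of_real. Qed.

Lemma rnorm_ge0 x : 0 <= rnorm x. Proof. exact: modulus_ge0. Qed.

Lemma rnorm_le x (M : R) : (rnorm x <= M) = (`|x| <= of_real M).
Proof. by rewrite normr_rnorm ler_of_real. Qed.

Lemma rnorm_lt x (M : R) : (rnorm x < M) = (`|x| < of_real M).
Proof. by rewrite normr_rnorm ltr_of_real. Qed.

Lemma rnorm0 : rnorm (0 : V) = 0.
Proof. by rewrite /rnorm normr0 modulus0. Qed.

Lemma rnormZ (a : K) x : rnorm (a *: x) = modulus a * rnorm x.
Proof. by rewrite /rnorm normrZ modulusM; congr (_ * _); rewrite -of_real_modulus modulus_of_real// modulus_ge0. Qed.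

Lemma rnormN x : rnorm (- x) = rnorm x.
Proof. by rewrite /rnorm normrN. Qed.

Lemma rnormB_sym x y : rnorm (x - y) = rnorm (y - x).
Proof. by rewrite -rnormN opprB. Qed.

Lemma closure_rnormP (A : set V) x : closure A x <->
  forall e : R, 0 < e -> exists2 a, A a & rnorm (x - a) < e.
Proof.
rewrite closure_normP; split=> Ax e e0.
  have [|a Aa xa] := Ax (of_real e); first by rewrite -(of_real0 R s) ltr_of_real.
  by exists a => //; rewrite rnorm_lt.
have [|a Aa xa] := Ax (modulus e).
  by rewrite -ltr_of_real of_real0 -ge0_of_real// ltW.
by exists a => //; move: xa; rewrite rnorm_lt -ge0_of_real// ltW.
Qed.

End rnorm_theory.

Section rnorm_bop.
Variables X Y : normedModType K.
Implicit Types T : bop X Y.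

Lemma ler_rnorm_bop T x : rnorm (T x) <= rnorm T * rnorm x.
Proof. by rewrite rnorm_le of_realM -!normr_rnorm ler_bop_norm. Qed.

End rnorm_bop.

Lemma subspace_rnorm (V : normedModType K) (X : closedSubspace V) (x : X) :
  rnorm x = rnorm (subspace_val x).
Proof. by []. Qed.

Section ell.
Variables (r : R) (r1 : 1 <= r).
Local Notation ell := (ell s r1).

Lemma ell_rnorm (x : ell) : (rnorm x)%:E = ell_enorm r x.
Proof.
have -> : rnorm x = fine (ell_enorm r x).
  by rewrite /rnorm modulus_of_real// fine_ge0// ell_enorm_ge0.
by rewrite fineK// ge0_fin_numE ?ell_enorm_ge0// -ell_memE ell_valP.
Qed.

Lemma ell_enorm_mem (x : nat -> K) (M : R) :
  (ell_enorm r x <= M%:E)%E -> (x : nat -> K^o) \in ell_mem r.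
Proof. by move=> xM; rewrite ell_memE (le_lt_trans xM)// ltry. Qed.

Lemma modulus_le_rnorm (x : ell) i : modulus (x i) <= rnorm x.
Proof. by rewrite -lee_fin ell_rnorm modulus_le_ell_enorm. Qed.

Lemma ell_coord_lin (a : K) (x y : ell) i : (a *: x + y) i = a * x i + y i.
Proof. by []. Qed.

Lemma ell_coordB (x y : ell) i : (x - y) i = x i - y i.
Proof. by []. Qed.

Lemma ell_eqP (x y : ell) : (forall i, x i = y i) -> x = y.
Proof. by move=> xy; apply/val_inj/funext. Qed.

(** Operators are given by coordinate formulas. Membership in [Y] is asked of every [e] with the
    right coordinates because [f x] is a bare sequence until the norm bound places it in [l^r]. *)
Lemma bop_into_subspace (X : normedModType K) (Y : closedSubspace ell)
    (f : X -> nat -> K) (M : R) :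
  (forall a x y i, f (a *: x + y) i = a * f x i + f y i) ->
  (forall x, (ell_enorm r (f x) <= (M * rnorm x)%:E)%E) ->
  (forall x (e : ell), (forall i, e i = f x i) -> e \in subspace_pred Y) ->
  exists T : bop X Y, forall x i, subspace_val (T x) i = f x i.
Proof.
move=> flin fM fY.
pose g x : ell := Ell r1 (ell_enorm_mem (fM x)).
have gY x : g x \in subspace_pred Y by exact: (fY x).
pose h x : Y := SubspaceOf (gY x).
have hb : h \in bounded_linear X Y.
  apply/bounded_linearP; split=> [a x y|].
    by apply: val_inj; apply: ell_eqP => i; exact: flin.
  exists (of_real M) => x; rewrite [`|x|]normr_rnorm -of_realM -rnorm_le.
  by rewrite subspace_rnorm -lee_fin ell_rnorm; exact: fM.
by exists (Bop hb).
Qed.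

Section subspace_coord.
Variables (X : normedModType K) (Y : closedSubspace ell) (T : bop X Y).
Implicit Types y : Y.

Lemma subspace_valZ y a : subspace_val (a *: y) = a *: subspace_val y.
Proof. by []. Qed.

Lemma subspace_valD y y' : subspace_val (y + y') = subspace_val y + subspace_val y'.
Proof. by []. Qed.

Lemma subspace_valN y : subspace_val (- y) = - subspace_val y.
Proof. by []. Qed.

Lemma subspace_coordZ y a i : subspace_val (a *: y) i = a * subspace_val y i.
Proof. by rewrite subspace_valZ. Qed.

Lemma subspace_coordD y y' i :
  subspace_val (y + y') i = subspace_val y i + subspace_val y' i.
Proof. by rewrite subspace_valD. Qed.

Lemma subspace_coordB y y' i :
  subspace_val (y - y') i = subspace_val y i - subspace_val y' i.
Proof. by rewrite subspace_coordD subspace_valN. Qed.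

Lemma bop_coordZ a x i : subspace_val (T (a *: x)) i = a * subspace_val (T x) i.
Proof. by rewrite linearZ subspace_coordZ. Qed.

Lemma bop_coordP a x x' i : subspace_val (T (a *: x + x')) i =
  a * subspace_val (T x) i + subspace_val (T x') i.
Proof. by rewrite linearP subspace_coordD subspace_coordZ. Qed.

End subspace_coord.

Section common_kernel.
Variables (I : Type) (phi : I -> ell -> K).
Hypothesis phi_lin : forall i a x y, phi i (a *: x + y) = a * phi i x + phi i y.
Hypothesis phi_bounded :
  forall i, exists A, forall x, modulus (phi i x) <= A * rnorm x.

Definition kernel_pred : {pred ell} := mem [set y : ell | forall i, phi i y = 0].

Lemma kernel_submod : GRing.submod_closed kernel_pred.
Proof.
split.
  rewrite inE => i; have := phi_lin i (-1) 0 0.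
  by rewrite scaler0 addr0 mulN1r addNr.
by move=> a x y; rewrite !inE => xS yS i; rewrite phi_lin xS yS mulr0 addr0.
Qed.

Lemma kernel_closed : closed [set y | y \in kernel_pred].
Proof.
move=> x /closure_rnormP xS; rewrite /= inE => i; apply: modulus_eq0.
have [A phiA] := phi_bounded i; pose B := `|A| + 1.
have B0 : 0 < B by rewrite ltr_wpDl.
apply/le_anti; rewrite modulus_ge0 andbT; apply/ler_addgt0Pr => e e0.
have [|a] := xS (e / B); first by rewrite divr_gt0.
rewrite /= inE => aS xa; rewrite add0r.
have -> : phi i x = phi i (x - a).
  by rewrite addrC -scaleN1r phi_lin aS mulr0 add0r.
apply: (le_trans (phiA _)); apply: (@le_trans _ _ (B * (e / B))).
  apply: (@le_trans _ _ (B * rnorm (x - a))).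
    by rewrite ler_wpM2r ?rnorm_ge0// (le_trans (ler_norm A))// lerDl.
  by rewrite ler_wpM2l// ltW.
by rewrite mulrCA mulfV ?mulr1// gt_eqF.
Qed.

Definition common_kernel := ClosedSubspace kernel_submod kernel_closed.

Lemma common_kernelP (y : ell) :
  reflect (forall i, phi i y = 0) (y \in subspace_pred common_kernel).
Proof. by apply: (iffP idP); rewrite inE. Qed.

End common_kernel.

End ell.
End real_norm.

(** The limit is the supremum of the [a] with [a <= f y] for [G]-most [y]; beyond it the ultrafilter
    must choose the complement. *)
Lemma ultra_limit_real (R : realType) (Y : Type) (G : set_system Y) (f : Y -> R)
    (M : R) : UltraFilter G -> G [set y | `|f y| <= M] ->
  exists l, forall e, 0 < e -> G [set y | `|f y - l| < e].
Proof.
move=> UG GM; pose S := [set a | G [set y | a <= f y]].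
have SM : S (- M) by apply: filterS GM => y /=; rewrite ler_norml => /andP[].
have ubM : ubound S M.
  move=> a Sa; have [y [/= ay]] := filter_ex (filterI Sa GM).
  by rewrite ler_norml => /andP[_]; exact: le_trans.
have supS : has_sup S by split; [exists (- M)|exists M].
exists (sup S) => e e0.
have [a Sa ae] := sup_adherent e0 supS.
have : ~ S (sup S + e).
  move=> /(sup_upper_bound supS); apply/negP.
  by rewrite -ltNge ltrDl.
have [//|Ge _] := in_ultra_setVsetC [set y | sup S + e <= f y] UG.
apply: filterS (filterI Sa Ge) => y /= [ay] /negP; rewrite -ltNge => yl.
by rewrite ltr_distl yl (lt_le_trans ae).
Qed.

Lemma ultra_limit (R : realType) (s : scalars) (Y : Type) (G : set_system Y)
    (f : Y -> scalar R s) (M : R) :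
  UltraFilter G -> G [set y | modulus (f y) <= M] ->
  exists l, forall e, 0 < e -> G [set y | modulus (f y - l) < e].
Proof.
case: s f => /= f UG GM; first exact: ultra_limit_real GM.
have re_le (z : R[i]) : `|complex.Re z| <= Normc.normc z.
  by case: z => a b /=; rewrite -sqrtr_sqr ler_wsqrtr// lerDl sqr_ge0.
have im_le (z : R[i]) : `|complex.Im z| <= Normc.normc z.
  by case: z => a b /=; rewrite -sqrtr_sqr ler_wsqrtr// lerDr sqr_ge0.
have [a aP] : exists a, forall e, 0 < e ->
    G [set y | `|complex.Re (f y) - a| < e].
  by apply: (ultra_limit_real (M := M)); apply: filterS GM => y; exact: le_trans.
have [b bP] : exists a, forall e, 0 < e ->
    G [set y | `|complex.Im (f y) - a| < e].
  by apply: (ultra_limit_real (M := M)); apply: filterS GM => y; exact: le_trans.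
exists (Complex a b) => e e0; have e20 : 0 < e / 2 by rewrite divr_gt0.
apply: filterS (filterI (aP _ e20) (bP _ e20)) => y /=; case: (f y) => c d /= [ca db].
rewrite -(ltr_sqr (_ : _ \in Num.nneg)) ?nnegrE ?sqrtr_ge0 ?(ltW e0)//.
rewrite sqr_sqrtr ?addr_ge0 ?sqr_ge0//.
have sq (t : R) : `|t| < e / 2 -> t ^+ 2 < (e / 2) ^+ 2.
  move=> te; rewrite -[t ^+ 2]real_normK ?num_real//.
  by rewrite ltr_sqr ?nnegrE// ltW.
have := sq _ ca; have := sq _ db; nra.
Qed.

(** * Compactness and uniform tails *)

Section compactness.
Variables (R : realType) (s : scalars) (r : R) (r1 : 1 <= r).
Local Notation K := (scalar R s).
Local Notation ell := (ell s r1).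
Implicit Types x y z : nat -> K.

Definition restrict_seq (P : pred nat) x : nat -> K :=
  fun i => if P i then x i else 0.

Lemma ell_enorm_restrict P x : (ell_enorm r (restrict_seq P x) <= ell_enorm r x)%E.
Proof.
apply: le_ell_enorm => // i; rewrite /restrict_seq; case: ifP => // _.
by rewrite modulus0 modulus_ge0.
Qed.

Lemma ell_enorm_addle x y z (a b : R) : (forall i, z i = x i + y i) ->
  (ell_enorm r x <= a%:E)%E -> (ell_enorm r y <= b%:E)%E ->
  (ell_enorm r z <= (a + b)%:E)%E.
Proof.
move=> zE xa yb; have -> : z = (x : nat -> K^o) + (y : nat -> K^o) by apply/funext.
by rewrite (le_trans (ell_enormD r1 _ _))// EFinD leeD.
Qed.

Lemma ell_enorm_scale (a : K) x :
  ell_enorm r (fun i => a * x i) = ((modulus a)%:E * ell_enorm r x)%E.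
Proof. exact: (@ell_enormZ R s r r1 a x). Qed.

Lemma restrict_seqZ P (a : K) x :
  restrict_seq P (fun i => a * x i) = (fun i => a * restrict_seq P x i).
Proof.
by apply/funext => i; rewrite /restrict_seq; case: (P i); rewrite ?mulr0.
Qed.

Lemma ell_enorm_finite_le x n (e : R) : 0 <= e ->
  (forall i, (i < n)%N -> modulus (x i) <= e) ->
  (ell_enorm r (restrict_seq (fun i => (i < n)%N) x) <= (n%:R * e)%:E)%E.
Proof.
move=> e0 xe; apply: (@ell_enorm_blocks_le R s r r1 (fun i => [:: i])
  (fun i => if (i < n)%N then e else 0)).
- by move=> i _; exists i; rewrite inE.
- move=> i; rewrite /powsum big_seq1 -powRrM mulfV ?gt_eqF ?(lt_le_trans _ r1)//.
  rewrite powRr1 ?modulus_ge0// /restrict_seq; case: ltnP => // ni.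
    exact: xe.
  by rewrite modulus0.
- move=> N; have -> : \sum_(i < N) (if (i < n)%N then e else 0) = (minn N n)%:R * e.
    elim: N => [|N IHN]; first by rewrite big_ord0 min0n mul0r.
    rewrite big_ord_recr/= IHN; case: (ltnP N n) => Nn.
      by rewrite !(minn_idPl _) ?(ltnW Nn)// -[X in _ + X]mul1r -mulrDl natr1.
    by rewrite !(minn_idPr _) ?addr0// ltnW.
  by rewrite ler_wpM2r// ler_nat geq_minr.
Qed.

Lemma ell_tail_cvg0 (x : ell) (e : R) : 0 < e ->
  exists n, (ell_enorm r (restrict_seq (leq n) x) <= e%:E)%E.
Proof.
move=> e0; have r0 : 0 < r by exact: lt_le_trans r1.
pose S n := \sum_(i < n) modulus (x i) `^ r.
have S_le n : S n <= rnorm x `^ r.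
  have := @powsum_le_ell_enorm R s r r1 (iota 0 n) x (rnorm x).
  rewrite /powsum -{2}(subn0 n) -/(index_iota 0 n) big_mkord; apply.
  - exact: rnorm_ge0.
  - exact: iota_uniq.
  - by rewrite -ell_rnorm.
have supS : has_sup (range S).
  by split; [exists (S 0), 0|exists (rnorm x `^ r) => _ [n _ <-]].
have er : 0 < e `^ r by exact: powR_gt0.
have [_ [n _ <-] Sn] := sup_adherent er supS.
exists n; apply: ell_enorm_le => //; first exact: ltW.
move=> m; rewrite -(big_mkord predT (fun i => modulus (restrict_seq (leq n) x i) `^ r)).
have [mn|nm] := leqP m n.
  rewrite big_nat big1 ?powR_ge0// => i /andP[_ im].
  by rewrite /restrict_seq leqNgt (leq_trans im mn)/= modulus0 powR0// gt_eqF.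
rewrite (big_cat_nat (n := n)) ?(ltnW nm)//= big_nat big1 ?add0r; last first.
  move=> i /andP[_ im].
  by rewrite /restrict_seq leqNgt im/= modulus0 powR0// gt_eqF.
have : S m <= sup (range S) by apply: sup_upper_bound => //; exists m.
have -> : S m = S n + \sum_(n <= i < m) modulus (restrict_seq (leq n) x i) `^ r.
  rewrite /S -(big_mkord predT (fun i => modulus (x i) `^ r)).
  rewrite (big_cat_nat (n := n)) ?(ltnW nm)//= big_mkord; congr (_ + _).
  apply: eq_big_nat => i /andP[ni _]; by rewrite /restrict_seq ni.
move: Sn; lra.
Qed.

Variables (X : normedModType K) (Y : closedSubspace ell).
Implicit Types T : bop X Y.

(** For bounded operators into a subspace of [l^r] this is equivalent to compactness, which thereby
    becomes a norm estimate. *)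
Definition uniform_tails T := forall e : R, 0 < e -> exists n, forall x : X,
  rnorm x <= 1 ->
  (ell_enorm r (restrict_seq (leq n) (subspace_val (T x))) <= e%:E)%E.

Lemma uniform_tails_scale T (e : R) : uniform_tails T -> 0 < e ->
  exists n, forall x : X,
  (ell_enorm r (restrict_seq (leq n) (subspace_val (T x))) <= (e * rnorm x)%:E)%E.
Proof.
move=> TU e0; have [n Tn] := TU e e0; exists n => x.
have [x0|x0] := eqVneq (rnorm x) 0.
  have -> : x = 0 by apply: normr0_eq0; rewrite normr_rnorm x0 of_real0.
  rewrite linear0 rnorm0 mulr0 (_ : restrict_seq _ _ = 0) ?ell_enorm0//.
  by apply/funext => i; rewrite /restrict_seq; case: ifP.
have {}x0 : 0 < rnorm x by rewrite lt0r x0 rnorm_ge0.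
pose x' := of_real s (rnorm x)^-1 *: x.
have x'1 : rnorm x' <= 1.
  by rewrite rnormZ modulus_of_real ?invr_ge0 ?(ltW x0)// mulVf ?gt_eqF.
have xE : x = of_real s (rnorm x) *: x'.
  by rewrite scalerA -of_realM mulfV ?gt_eqF// of_real1 scale1r.
have -> : subspace_val (T x) =
    (fun i => of_real s (rnorm x) * subspace_val (T x') i) :> (nat -> K).
  by apply/funext => i; rewrite {1}xE bop_coordZ.
rewrite restrict_seqZ ell_enorm_scale modulus_of_real ?(ltW x0)// mulrC EFinM.
by apply: lee_wpmul2l; [rewrite lee_fin ltW|exact: Tn].
Qed.

(** Around each point of the compact closure a single cut works on a whole neighbourhood, up to
    [e / 2]; compactness makes the cut uniform. *)
Lemma compact_uniform_tails T : compact_op T -> uniform_tails T.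
Proof.
rewrite /compact_op precompactE => /compact_near_coveringP cT e e0.
set C := closure _ in cT; have e20 : 0 < e / 2 by rewrite divr_gt0.
pose P (n : nat) (y : Y) :=
  (ell_enorm r (restrict_seq (leq n) (subspace_val y)) <= e%:E)%E.
have near_y (y : Y) : C y -> \forall y' \near y & n \near \oo, P n y'.
  move=> _; have [n yn] := ell_tail_cvg0 (subspace_val y) e20.
  exists (ball y (of_real s (e / 2)), [set m | (n <= m)%N]); first split => /=.
  - by apply: nbhsx_ballx; rewrite -(of_real0 R s) ltr_of_real.
  - by exists n.
  - move=> [y' m] [/= yy' nm]; rewrite /P [X in X%:E](splitr e).
    apply: (@ell_enorm_addle (restrict_seq (leq m) (subspace_val y))
      (restrict_seq (leq m) (subspace_val (y' - y)))).
    + move=> i; rewrite /restrict_seq; case: ifP => _; last by rewrite addr0.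
      by rewrite subspace_coordB addrC subrK.
    + apply: le_trans yn; apply: le_ell_enorm => // i.
      rewrite /restrict_seq; case: leqP => mi; last by rewrite modulus0 modulus_ge0.
      by rewrite (leq_trans nm mi).
    + apply: (le_trans (ell_enorm_restrict _ _)).
      rewrite -ell_rnorm lee_fin -subspace_rnorm rnormB_sym ltW// rnorm_lt.
      by move: yy'; rewrite -ball_normE.
have [n _ nP] := cT nat \oo P _ near_y.
exists n => x x1; apply: (nP n (leqnn n)).
apply: subset_closure; exists x => //=.
by rewrite normr_rnorm -(of_real1 R s) ler_of_real.
Qed.

Lemma ultra_coord_limit (F : set_system Y) (l : nat -> K) :
  UltraFilter F ->
  (forall i e, 0 < e -> F [set y : Y | modulus (subspace_val y i - l i) < e]) ->
  forall n e, 0 < e ->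
    F [set y : Y | forall i, (i < n)%N -> modulus (subspace_val y i - l i) <= e].
Proof.
move=> UF Fl n e e0; elim: n => [|n IHn].
  by apply: filterS (filterT) => y _ i; rewrite ltn0.
apply: filterS (filterI IHn (Fl n e e0)) => y [/= yn yne] i.
by rewrite ltnS leq_eqVlt => /orP[/eqP->|/yn//]; exact: ltW.
Qed.

Lemma ultra_limit_enorm (F : set_system Y) (l : nat -> K) (P : pred nat) (d : R) :
  UltraFilter F ->
  (forall i e, 0 < e -> F [set y : Y | modulus (subspace_val y i - l i) < e]) ->
  F [set y : Y | (ell_enorm r (restrict_seq P (subspace_val y)) <= d%:E)%E] ->
  (ell_enorm r (restrict_seq P l) <= d%:E)%E.
Proof.
move=> UF Fl Fd; have d0 : 0 <= d.
  have [y /= yd] := filter_ex Fd.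
  by rewrite -lee_fin (le_trans _ yd)// ell_enorm_ge0.
have r0 : 0 < r by exact: lt_le_trans r1.
have head n : (ell_enorm r (restrict_seq (fun i => (i < n)%N)
    (restrict_seq P l)) <= d%:E)%E.
  apply/lee_addgt0Pr => e e0.
  pose e' := e / n.+1%:R; have e'0 : 0 < e' by rewrite divr_gt0.
  have [y [/= yl yd]] := filter_ex (filterI (ultra_coord_limit UF Fl n e'0) Fd).
  apply: (@ell_enorm_addle
    (restrict_seq (fun i => (i < n)%N) (restrict_seq P (subspace_val y)))
    (restrict_seq (fun i => (i < n)%N)
      (fun i => restrict_seq P l i - restrict_seq P (subspace_val y) i))).
  - by move=> i; rewrite /restrict_seq; case: ifP => _; [ring|rewrite addr0].
  - exact: le_trans (ell_enorm_restrict _ _) yd.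
  - apply: (@le_trans _ _ (n%:R * e')%:E).
      apply: ell_enorm_finite_le => [|i lin]; first exact: ltW.
      rewrite /restrict_seq; case: ifP => _.
        by rewrite modulusB_sym yl.
      by rewrite subrr modulus0 ltW.
    rewrite lee_fin /e' mulrA ler_pdivrMr// mulrC ler_wpM2l ?(ltW e0)//.
    by rewrite ler_nat.
apply: ell_enorm_le => // n.
have := @powsum_le_ell_enorm R s r r1 (iota 0 n) _ d d0 (iota_uniq 0 n) (head n).
rewrite /powsum -{1}(subn0 n) -/(index_iota 0 n) big_mkord => H.
apply: le_trans H; apply: ler_sum => i _.
by rewrite {2}/restrict_seq ltn_ord.
Qed.

(** Coordinatewise limits along an ultrafilter inherit the tail bounds, so closeness on finitely
    many coordinates becomes closeness in norm. Closedness of [Y] keeps the limit in the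
    subspace. *)
Lemma uniform_tails_compact T : uniform_tails T -> compact_op T.
Proof.
move=> TU; rewrite /compact_op.
have h k : exists n, forall x : X, rnorm x <= 1 ->
    (ell_enorm r (restrict_seq (leq n) (subspace_val (T x))) <= (k.+1%:R^-1)%:E)%E.
  by apply: TU; rewrite invr_gt0.
have [n nP] := choice h.
pose C := [set y : Y | rnorm y <= rnorm T /\ forall k,
  (ell_enorm r (restrict_seq (leq (n k)) (subspace_val y)) <= (k.+1%:R^-1)%:E)%E].
apply: (@compact_precompact_sub R s Y _ C); last first.
  move=> _ [x /= x1 <-]; have {}x1 : rnorm x <= 1 by rewrite rnorm_le of_real1.
  split; last by move=> k; exact: nP.
  rewrite (le_trans (ler_rnorm_bop _ _))// -[leRHS]mulr1.
  by rewrite ler_wpM2l ?rnorm_ge0.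
rewrite compact_ultra => F UF FC.
have FM i : F [set y : Y | modulus (subspace_val y i) <= rnorm T].
  apply: filterS FC => y [yM _] /=; apply: le_trans yM.
  exact: modulus_le_rnorm.
have [l Fl] : exists l : nat -> K, forall i e, 0 < e ->
    F [set y : Y | modulus (subspace_val y i - l i) < e].
  by have [l Fl] := choice (fun i => ultra_limit UF (FM i)); exists l.
have lM : (ell_enorm r l <= (rnorm T)%:E)%E.
  have -> : l = restrict_seq predT l by apply/funext.
  apply: (ultra_limit_enorm UF Fl); apply: filterS FC => y [yM _] /=.
  by rewrite (le_trans (ell_enorm_restrict _ _))// -ell_rnorm lee_fin.
have ltail k : (ell_enorm r (restrict_seq (leq (n k)) l) <= (k.+1%:R^-1)%:E)%E.
  by apply: (ultra_limit_enorm UF Fl); apply: filterS FC => y [_ yk]; exact: yk.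
pose l0 : ell := Ell r1 (ell_enorm_mem lM).
have Fl0 (e : R) : 0 < e -> F [set y : Y | rnorm (l0 - subspace_val y) < e].
  move=> e0.
  have [k ke] : exists k, k.+1%:R^-1 < e / 4.
    have e40 : 0 < e / 4 by rewrite divr_gt0.
    exists (Num.truncn (e / 4)^-1); rewrite -[ltRHS]invrK ltf_pV2 ?posrE ?invr_gt0//.
    by rewrite truncnS_gt.
  (* Summed over the [n k] head coordinates, errors of size [e'] stay below [e / 4]; the two tails
     contribute at most [e / 4] each. *)
  pose e' := e / (4 * (n k).+1%:R); have e'0 : 0 < e' by rewrite divr_gt0// mulr_gt0.
  apply: filterS (filterI (ultra_coord_limit UF Fl (n k) e'0) FC).
  move=> y [/= yl [_ yk]]; rewrite -lte_fin ell_rnorm.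
  apply: (@le_lt_trans _ _ ((e / 4 + (e / 4 + e / 4))%:E)); last first.
    by rewrite lte_fin; lra.
  apply: (@ell_enorm_addle
    (restrict_seq (fun i => (i < n k)%N) (fun i => l i - subspace_val y i))
    (fun i => restrict_seq (leq (n k)) l i -
       restrict_seq (leq (n k)) (subspace_val y) i)).
  - move=> i; rewrite ell_coordB /restrict_seq/= ltnNge.
    by case: leqP => _ /=; rewrite ?subrr ?add0r ?addr0.
  - apply: (@le_trans _ _ ((n k)%:R * e')%:E).
      apply: ell_enorm_finite_le => [|i lin]; first exact: ltW.
      by rewrite modulusB_sym yl.
    have -> : (n k)%:R * e' = e / 4 * ((n k)%:R / (n k).+1%:R).
      by rewrite /e' invfM mulrCA -[RHS]mulrA; congr (_ * _); rewrite mulrCA.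
    rewrite lee_fin.
    rewrite ler_piMr ?divr_ge0 ?(ltW e0)// ler_pdivrMr// mul1r ler_nat.
    exact: leqnSn.
  - apply: (@ell_enorm_addle (restrict_seq (leq (n k)) l)
      (fun i => - restrict_seq (leq (n k)) (subspace_val y) i)) => //.
      by rewrite (le_trans (ltail k))// lee_fin ltW.
    apply: (@le_trans _ _ (k.+1%:R^-1)%:E); last by rewrite lee_fin ltW.
    by apply: le_trans (yk k); apply: le_ell_enorm => // i; rewrite modulusN.
have l0Y : l0 \in subspace_pred Y.
  have : closure [set x | x \in subspace_pred Y] l0.
    apply/closure_rnormP => e e0; have [y /= ye] := filter_ex (Fl0 e e0).
    by exists (subspace_val y) => //; exact: subspace_valP.
  by move/(@subspace_closed _ _ Y).
exists (SubspaceOf l0Y); split.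
  split; first by rewrite -lee_fin subspace_rnorm ell_rnorm.
  exact: ltail.
move=> A /nbhs_ballP[e /= e0 eA].
apply: filterS (Fl0 (modulus e) _); last first.
  by rewrite -(ltr_of_real s) of_real0 -ge0_of_real// ltW.
move=> y /= ye; apply: eA; rewrite -ball_normE/=.
by move: ye; rewrite rnorm_lt -ge0_of_real// ltW.
Qed.

End compactness.

(** * Geometric decay over the levels of a coding *)

Section geometric.
Variables (R : realType) (lam : R).
Hypotheses (lam_ge0 : 0 <= lam) (lam_lt1 : lam < 1).

Lemma geometric_small (M e : R) : 0 < e -> exists m, M * lam ^+ m <= e.
Proof.
move=> e0; have [M0|M0] := leP M 0.
  exists 0; rewrite expr0 mulr1; exact: le_trans M0 (ltW e0).
have lam1 : `|lam| < 1 by rewrite ger0_norm.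
have /cvgrPdist_le/(_ (e / M) (divr_gt0 e0 M0)) [m _ /(_ m (leqnn m))] :=
  cvg_expr lam1.
rewrite /= sub0r normrN normrX ger0_norm// => H.
by exists m; rewrite mulrC -ler_pdivlMr.
Qed.

Lemma geometric_tail_sum (M : R) m N : 0 <= M ->
  \sum_(k < N) (if (k < m)%N then 0 else M * lam ^+ k) <= M * lam ^+ m / (1 - lam).
Proof.
move=> M0; have l1 : 0 < 1 - lam by rewrite subr_gt0.
have -> : \sum_(k < N) (if (k < m)%N then 0 else M * lam ^+ k) =
    M * (lam ^+ m - lam ^+ (maxn N m)) / (1 - lam).
  elim: N => [|N IHN]; first by rewrite big_ord0 max0n subrr mulr0 mul0r.
  rewrite big_ord_recr/= IHN; case: ltnP => Nm.
    by rewrite addr0 !(maxn_idPr _)// ltnW.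
  rewrite !(maxn_idPl _) ?(leq_trans Nm)// exprS; field.
  by rewrite gt_eqF.
by rewrite ler_pM2r ?invr_gt0// ler_wpM2l// gerBl exprn_ge0.
Qed.

Lemma geometric_sum (M : R) N : 0 <= M ->
  \sum_(k < N) M * lam ^+ k <= M / (1 - lam).
Proof.
move=> M0; have := geometric_tail_sum 0 N M0.
by rewrite expr0 mulr1.
Qed.

End geometric.

Section coding_theory.
Variables (R : realType) (s : scalars) (r : R).
Hypothesis r1 : 1 <= r.
Local Notation K := (scalar R s).
Variables (T : eqType) (lev : T -> nat) (L : nat -> seq T).
Hypothesis memL : forall n j, (j \in L n) = (lev j == n).
Variables (nrm : nat -> (T -> K) -> R) (C : R).
Hypothesis nrm_local : forall n x y, {in L n, x =1 y} -> nrm n x = nrm n y.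
Hypothesis nrm0 : forall n, nrm n (fun=> 0) = 0.
Hypothesis C_ge0 : 0 <= C.
Variable cd : coding r lev L nrm C.
Implicit Types x w : T -> K.

Lemma enc_lin (a : K) x w i :
  enc cd (fun j => a * x j + w j) i = a * enc cd x i + enc cd w i.
Proof.
have [l [c cE]] := enc_finite cd i; rewrite !cE mulr_sumr -big_split/=.
by apply: eq_bigr => j _; rewrite mulrDr mulrCA.
Qed.

Lemma encD x w i : enc cd (fun j => x j + w j) i = enc cd x i + enc cd w i.
Proof.
have := enc_lin 1 x w i; rewrite mul1r => <-; congr (enc cd _ i).
by apply/funext => j; rewrite mul1r.
Qed.

Lemma dec_lin (a : K) (y z : nat -> K) j :
  dec cd (fun i => a * y i + z i) j = a * dec cd y j + dec cd z j.
Proof.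
have [l [c cE]] := dec_finite cd j; rewrite !cE mulr_sumr -big_split/=.
by apply: eq_bigr => i _; rewrite mulrDr mulrCA.
Qed.

(** Each decoded coordinate involves finitely many entries, so it is a bounded functional; linear
    conditions on decoded families therefore define closed subspaces. *)
Lemma dec_bounded j : exists A, forall y : ell s r1,
  modulus (dec cd y j) <= A * rnorm y.
Proof.
have [l [c cE]] := dec_finite cd j; exists (\sum_(i <- l) modulus (c i)) => y.
rewrite cE mulr_suml (le_trans (ler_modulus_sum _ _ _))//; apply: ler_sum => i _.
by rewrite modulusM ler_wpM2l ?modulus_ge0// modulus_le_rnorm.
Qed.

Lemma encdec_bounded i : exists A, forall y : ell s r1,
  modulus (enc cd (dec cd y) i) <= A * rnorm y.
Proof.
have [l [c cE]] := enc_finite cd i; have /choice[A AP] := dec_bounded.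
exists (\sum_(j <- l) modulus (c j) * A j) => y.
rewrite cE mulr_suml (le_trans (ler_modulus_sum _ _ _))//; apply: ler_sum => j _.
by rewrite modulusM -mulrA ler_wpM2l ?modulus_ge0.
Qed.

(** These functionals vanish together exactly when [y] is a code, that is, lies in the range of
    [enc]; so the codes form a closed subspace. *)
Definition code_gap i (y : ell s r1) : K := enc cd (dec cd y) i - y i.

Lemma code_gap_lin i a (x y : ell s r1) :
  code_gap i (a *: x + y) = a * code_gap i x + code_gap i y.
Proof.
rewrite /code_gap ell_coord_lin.
have -> : dec cd (a *: x + y) = (fun j => a * dec cd x j + dec cd y j).
  by apply/funext => j; rewrite -dec_lin.
by rewrite enc_lin; ring.
Qed.

Lemma code_gap_bounded i : exists A, forall y, modulus (code_gap i y) <= A * rnorm y.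
Proof.
have [A AP] := encdec_bounded i; exists (A + 1) => y.
rewrite (le_trans (ler_modulusD _ _))// modulusN mulrDl mul1r lerD//.
exact: modulus_le_rnorm.
Qed.

Lemma nrm_dec_le n (y : ell s r1) : (forall i, code_gap i y = 0) ->
  nrm n (dec cd y) <= rnorm y.
Proof.
move=> y0; rewrite -lee_fin (le_trans (enc_lower cd n _))// ell_rnorm.
rewrite (_ : enc cd (dec cd y) = y)//; apply/funext => i.
by apply/eqP; rewrite -subr_eq0; apply/eqP/y0.
Qed.

Lemma enc_upper_geometric (M lam : R) w : 0 <= lam -> lam < 1 -> 0 <= M ->
  (forall n, nrm n w <= M * lam ^+ n) ->
  (ell_enorm r (enc cd w) <= (C * (M / (1 - lam)))%:E)%E.
Proof.
move=> l0 l1 M0 wM; apply: (enc_upper cd wM) => N.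
exact: geometric_sum.
Qed.

(** Levels below [m] occupy finitely many positions by [enc_tail]; past these only the geometric
    remainder of the other levels is visible. *)
Lemma enc_uniform_tails (M lam e : R) : 0 <= lam -> lam < 1 -> 0 <= M -> 0 < e ->
  exists n0, forall w, (forall n, nrm n w <= M * lam ^+ n) ->
  (ell_enorm r (restrict_seq (leq n0) (enc cd w)) <= e%:E)%E.
Proof.
move=> l0 l1 M0 e0.
have [m me] := geometric_small l0 l1 (C * (M / (1 - lam))) e0.
have [n0 n0P] := enc_tail cd m; exists n0 => w wM.
pose w2 j := if (lev j < m)%N then 0 else w j.
pose w1 j := if (lev j < m)%N then w j else 0.
have wE : w = (fun j => w1 j + w2 j).
  by apply/funext => j; rewrite /w1 /w2; case: ifP; rewrite ?addr0 ?add0r.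
apply: (@le_trans _ _ (ell_enorm r (enc cd w2))).
  apply: le_ell_enorm => // i; rewrite /restrict_seq; case: leqP => ni.
    rewrite {1}wE encD n0P ?add0r// => j mj.
    by rewrite /w1 ltnNge mj.
  by rewrite modulus0 modulus_ge0.
have := @enc_upper _ _ _ _ _ _ _ _ cd w2
  (fun k => if (k < m)%N then 0 else M * lam ^+ k) (M * lam ^+ m / (1 - lam)).
move=> /(_ _ (fun N => geometric_tail_sum l0 l1 m N M0)) H.
apply: le_trans (H _) _.
  move=> n; case: ltnP => nm.
    rewrite (nrm_local (y := fun=> 0)) ?nrm0// => j.
    by rewrite memL /w2 => /eqP->; rewrite nm.
  rewrite (nrm_local (y := w)) // => j.
  by rewrite memL /w2 => /eqP->; rewrite ltnNge nm.
rewrite lee_fin (le_trans _ me)// le_eqVlt; apply/orP; left; apply/eqP; ring.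
Qed.

End coding_theory.

(** * Compact factorization through a subspace of [l^q] *)

Lemma interval_levels (n : nat -> nat) : n 0 = 0 -> (forall k, (n k < n k.+1)%N) ->
  exists lev : nat -> nat,
    forall k j, (j \in index_iota (n k) (n k.+1)) = (lev j == k).
Proof.
move=> n0 n_lt.
have n_mono : {homo n : i j / (i <= j)%N}.
  move=> i j ij; rewrite -(subnK ij); elim: (j - i)%N => // m IHm.
  by rewrite addSn (leq_trans IHm)// ltnW.
have n_ge k : (k <= n k)%N.
  by elim: k => // k IHk; rewrite (leq_ltn_trans IHk).
have ex j : exists k, (j < n k.+1)%N.
  by exists j; rewrite (leq_trans _ (n_ge j.+1)).
exists (fun j => ex_minn (ex j)) => k j; rewrite mem_index_iota.
case: ex_minnP => m jm mmin; apply/andP/eqP => [[kj jk]|<-].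
  apply/eqP; rewrite eqn_leq mmin//=; rewrite leqNgt; apply/negP => mk.
  by have := leq_trans (leq_trans jm (n_mono _ _ mk)) kj; rewrite ltnn.
split=> //; case: m jm mmin => [|m] _ mmin; first by rewrite n0.
by rewrite leqNgt; apply/negP => /mmin; rewrite ltnn.
Qed.

Section compact_factorization.
Variables (R : realType) (s : scalars) (p q : R) (p1 : 1 <= p) (q1 : 1 <= q).
Hypotheses (leqp : q <= p) (p_lt2 : p < 2).
Local Notation K := (scalar R s).
Variables (X : normedModType K) (Y : closedSubspace (ell s p1)) (S : bop X Y).
Hypothesis cS : compact_op S.

Let p_gt0 : 0 < p. Proof. exact: lt_le_trans p1. Qed.

Let half_ge0 : 0 <= 2^-1 :> R. Proof. by rewrite invr_ge0. Qed.
Let half_lt1 : 2^-1 < 1 :> R. Proof. by rewrite invf_lt1 ?ltr1n. Qed.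

(** The rate [4^-k] is to be shared between the two factors: each needs a decay [2^-k] over the
    blocks in order to be compact. *)
Lemma rapid_tails : exists (n : nat -> nat), [/\ n 0 = 0,
  (forall k, (n k < n k.+1)%N) & forall k (x : X),
  (ell_enorm p (restrict_seq (leq (n k)) (subspace_val (S x))) <=
   ((1 + rnorm S) * 4 ^- k * rnorm x)%:E)%E].
Proof.
have h k : exists m, forall x : X,
    (ell_enorm p (restrict_seq (leq m) (subspace_val (S x))) <=
     (4 ^- k * rnorm x)%:E)%E.
  apply: uniform_tails_scale; first exact: compact_uniform_tails.
  by rewrite invr_gt0 exprn_gt0.
have [m mP] := choice h.
pose fix n k := if k is k'.+1 then maxn (n k').+1 (m k) else 0.
have nm k : (m k.+1 <= n k.+1)%N by exact: leq_maxr.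
exists n; split=> // [k|[|k] x]; first exact: leq_maxl.
  rewrite expr0 invr1 mulr1 (le_trans (ell_enorm_restrict p1 _ _))//.
  rewrite -ell_rnorm lee_fin -subspace_rnorm (le_trans (ler_rnorm_bop _ _))//.
  by rewrite ler_wpM2r ?rnorm_ge0// lerDr.
apply: (@le_trans _ _ (ell_enorm p (restrict_seq (leq (m k.+1)) (subspace_val (S x))))).
  apply: le_ell_enorm => // i; rewrite /restrict_seq; case: leqP => ni.
    by rewrite (leq_trans (nm k) ni).
  by rewrite modulus0 modulus_ge0.
apply: (le_trans (mP _ _)); rewrite lee_fin ler_wpM2r ?rnorm_ge0//.
by rewrite ler_peMl ?invr_ge0 ?exprn_ge0// lerDl rnorm_ge0.
Qed.

(** [A] codes [2^k] times the [k]-th block of [S x], and [B] decodes and multiplies back by [2^-k].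
    Both keep a decay [2^-k], hence have uniform tails. Nothing is assumed about [X] or about
    complements of [Y]: the subspace between them consists of codes and is adapted to [Y]. *)
Lemma compact_op_KS : KS_ops q1 X Y S.
Proof.
have [n [n0 n_lt nS]] := rapid_tails.
have [lev memL] := interval_levels n0 n_lt.
pose L k := index_iota (n k) (n k.+1).
pose nrm k (x : nat -> K) := powsum p (L k) x `^ p^-1.
have nrm_ge0 k x : 0 <= nrm k x by exact: powR_ge0.
have [C C1 embC] := stable_embedding_seq s q1 leqp p_lt2.
have C0 : 0 <= C by exact: le_trans C1.
have uL k : uniq (L k) by exact: iota_uniq.
have nrm_local k x y : {in L k, x =1 y} -> nrm k x = nrm k y.
  by move=> xy; rewrite /nrm (eq_powsum p xy).
have nrm0 k : nrm k (fun=> 0) = 0.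
  rewrite /nrm /powsum big1 ?powR0 ?invr_eq0 ?gt_eqF// => i _.
  by rewrite modulus0 powR0// gt_eqF.
have [cd] : inhabited (coding q lev L nrm C).
  apply: coding_exists => //.
    move=> k x j /eqP; rewrite powR_eq0 => /andP[/eqP xp _].
    by apply: (powsum_eq0 (p := p)) => //; rewrite gt_eqF.
  move=> k; have [M [a aP]] := embC _ (L k) (uL k); exists M, a => x.
  have -> : nrm k x `^ q = powsum p (L k) x `^ (q / p).
    by rewrite /nrm -powRrM mulrC.
  have /andP[lo hi] := aP x; rewrite lo (le_trans hi)//= powRM//.
  have -> : nrm k x `^ q = powsum p (L k) x `^ (q / p).
    by rewrite /nrm -powRrM mulrC.
  by rewrite ler_wpM2r ?powR_ge0// le1r_powR.
pose w (x : X) j := of_real s (2 ^+ lev j) * subspace_val (S x) j.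
pose M (x : X) := (1 + rnorm S) * rnorm x.
have M_ge0 x : 0 <= M x by rewrite mulr_ge0 ?rnorm_ge0// addr_ge0 ?rnorm_ge0.
have powsum_scale (c : R) k (y y' : nat -> K) : 0 <= c ->
    (forall j, lev j = k -> y j = of_real s c * y' j) ->
    nrm k y = c * nrm k y'.
  move=> c0 yE; have -> : nrm k y = (c `^ p * powsum p (L k) y') `^ p^-1.
    rewrite /nrm; congr (_ `^ _); rewrite /powsum mulr_sumr.
    apply: eq_big_seq => j; rewrite memL => /eqP/yE->.
    by rewrite modulusM modulus_of_real// powRM ?modulus_ge0.
  by rewrite powRM ?powR_ge0 ?powsum_ge0// -powRrM mulfV ?gt_eqF// powRr1.
have wM x k : nrm k (w x) <= M x * 2^-1 ^+ k.
  rewrite (powsum_scale (2 ^+ k) k _ (subspace_val (S x))) ?exprn_ge0//; last first.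
    by move=> j <-.
  have := le_trans (ell_enorm_ge p1 _ (uL k)) (nS k x); rewrite lee_fin.
  have -> : powsum p (L k) (restrict_seq (leq (n k)) (subspace_val (S x))) =
      powsum p (L k) (subspace_val (S x)).
    apply: eq_powsum => j; rewrite mem_index_iota => /andP[nj _].
    by rewrite /restrict_seq nj.
  rewrite -/(nrm k _) => H.
  apply: (@le_trans _ _ (2 ^+ k * ((1 + rnorm S) * 4 ^- k * rnorm x))).
    by rewrite ler_wpM2l// exprn_ge0.
  rewrite le_eqVlt; apply/orP; left; apply/eqP.
  have -> : 4 = 2 * 2 :> R by rewrite -natrM.
  rewrite /M exprVn exprMn; field.
  by rewrite expf_neq0.
pose f (y : nat -> K) j := of_real s (2^-1 ^+ lev j) * dec cd y j.
have f_lin a (y z : nat -> K) j : f (fun i => a * y i + z i) j = a * f y j + f z j.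
  by rewrite /f dec_lin; ring.
have f_sub (y z : ell s q1) j : f (y - z : ell s q1) j = f y j - f z j.
  have -> : f (y - z : ell s q1) = f (fun i => -1 * z i + y i).
    by congr f; apply/funext => i; rewrite mulN1r addrC.
  by rewrite f_lin mulN1r addrC.
have f_nrm (y : ell s q1) k : (forall i, code_gap cd i y = 0) ->
    nrm k (f y) <= rnorm y * 2^-1 ^+ k.
  move=> y0; rewrite (powsum_scale (2^-1 ^+ k) k _ (dec cd y)) ?exprn_ge0//; last first.
    by move=> j <-.
  by rewrite mulrC ler_wpM2r ?exprn_ge0// nrm_dec_le.
have f_block (y : ell s q1) m : (forall i, code_gap cd i y = 0) ->
    (ell_enorm p (restrict_seq (leq (n m)) (f y)) <=
     (rnorm y * 2^-1 ^+ m / (1 - 2^-1))%:E)%E.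
  move=> y0; apply: (@ell_enorm_blocks_le R s p p1 L
    (fun k => if (k < m)%N then 0 else rnorm y * 2^-1 ^+ k)).
  - by move=> i _; exists (lev i); rewrite memL.
  - move=> k; case: ltnP => km.
      rewrite -/(nrm k _) (nrm_local k _ (fun=> 0)) ?nrm0// => j.
      rewrite mem_index_iota /restrict_seq => /andP[_ jk].
      suff -> : (n m <= j)%N = false by [].
      apply/negbTE; rewrite -ltnNge (leq_trans jk)//.
      have n_mono : {homo n : i j / (i <= j)%N}.
        move=> i i' ii'; rewrite -(subnK ii'); elim: (i' - i)%N => // m' IHm.
        by rewrite addSn (leq_trans IHm)// ltnW.
      exact: n_mono.
    apply: le_trans (f_nrm y k y0); apply: ge0_ler_powR.
    + by rewrite invr_ge0 ltW.
    + by rewrite nnegrE powsum_ge0.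
    + by rewrite nnegrE powsum_ge0.
    apply: ler_sum => j _; apply: ge0_ler_powR; rewrite ?nnegrE ?modulus_ge0 ?(ltW p_gt0)//.
    by rewrite /restrict_seq; case: ifP => // _; rewrite modulus0 modulus_ge0.
  - by move=> N; apply: geometric_tail_sum => //; exact: rnorm_ge0.
have f_bound (y : ell s q1) : (forall i, code_gap cd i y = 0) ->
    (ell_enorm p (f y) <= (2 * rnorm y)%:E)%E.
  move=> y0; have := f_block y 0 y0; rewrite n0 expr0 mulr1.
  have -> : rnorm y / (1 - 2^-1) = 2 * rnorm y by field.
  by rewrite (_ : restrict_seq _ _ = f y)//; apply/funext.
(* The intermediate space: sequences coding families whose rescaled
   concatenation lies in [Y]. *)
pose Zset := [set y : ell s q1 | (forall i, code_gap cd i y = 0) /\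
  exists2 e, e \in subspace_pred Y & forall j, e j = f y j].
have gapK (y : ell s q1) : (y \in subspace_pred (common_kernel
    (code_gap_lin cd (r1 := q1)) (code_gap_bounded q1 cd))) <->
    forall i, code_gap cd i y = 0.
  by split=> [/common_kernelP//|y0]; apply/common_kernelP.
have Zsub : GRing.submod_closed (mem Zset).
  have [Y0 YD] := subspace_submod Y.
  have [G0 GD] := subspace_submod (common_kernel
    (code_gap_lin cd (r1 := q1)) (code_gap_bounded q1 cd)).
  split.
    rewrite inE; split; first exact/gapK.
    exists 0 => // j; have := f_lin (-1) 0 0 j.
    have -> : (fun i => -1 * (0 : nat -> K) i + (0 : nat -> K) i) = 0.
      by apply/funext => i; rewrite mulN1r addNr.
    by rewrite mulN1r addNr => ->.
  move=> a y z; rewrite !inE => -[y0 [e eY eE]] [z0 [e' e'Y e'E]]; split.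
    by apply/gapK; apply: GD; exact/gapK.
  exists (a *: e + e'); first exact: YD.
  by move=> j; rewrite ell_coord_lin eE e'E -f_lin.
(* On codes the rescaled decoding [f] is bounded into [l^p] by [f_bound]; so if [z] tends to [y],
   then [f z] tends to [f y] and membership in the closed subspace [Y] survives. *)
have Zclosed : closed [set y | y \in mem Zset].
  move=> y yZ.
  have y0 : forall i, code_gap cd i y = 0.
    apply/gapK; apply: subspace_closed; move: yZ; apply: closureS => z /=.
    by rewrite inE => -[z0 _]; apply/gapK.
  rewrite /= inE; split=> //.
  exists (Ell p1 (ell_enorm_mem (f_bound y y0))) => //.
  apply: (@subspace_closed _ _ Y); apply/closure_rnormP => e e0.
  move/closure_rnormP: yZ => /(_ (e / 2) (divr_gt0 e0 (ltr0Sn _ 1)))[z].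
  rewrite /= inE => -[z0 [e' e'Y e'E]] yz; exists e' => //.
  rewrite -lte_fin ell_rnorm.
  have -> : Ell p1 (ell_enorm_mem (f_bound y y0)) - e' = f (y - z : ell s q1) :> (nat -> K).
    apply/funext => j; rewrite ell_coordB e'E/=.
    exact/esym/f_sub.
  have yz0 : forall i, code_gap cd i (y - z : ell s q1) = 0.
    move=> i; rewrite addrC -scaleN1r code_gap_lin z0 y0.
    by rewrite mulr0 addr0.
  apply: (le_lt_trans (f_bound _ yz0)).
  by rewrite lte_fin mulrC -ltr_pdivlMr.
pose Z := ClosedSubspace Zsub Zclosed.
have Zgap (y : Z) i : code_gap cd i (subspace_val y) = 0.
  by have := subspace_valP y; rewrite inE => -[].
have w_lin a x y : w (a *: x + y) = (fun j => a * w x j + w y j).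
  by apply/funext => j; rewrite /w bop_coordP; ring.
have [A AE] : exists A : bop X Z,
    forall x i, subspace_val (A x) i = enc cd (w x) i.
  apply: (@bop_into_subspace _ _ _ _ _ _ _ (C * 2 * (1 + rnorm S))).
  - by move=> a x y i; rewrite w_lin enc_lin.
  - move=> x; have := enc_upper_geometric cd half_ge0 half_lt1 (M_ge0 x) (wM x).
    by congr (_ <= _%:E)%E; rewrite /M; field.
  - move=> x e eE; have {}eE : enc cd (w x) = e by apply/funext => i; rewrite eE.
    have dE : dec cd e = w x by apply/funext => j; rewrite -eE encK.
    rewrite inE; split=> [i|]; first by rewrite /code_gap dE eE subrr.
    exists (subspace_val (S x)); first exact: subspace_valP.
    move=> j; rewrite /f dE /w mulrA -of_realM -exprMn mulVf ?expr1n ?of_real1//.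
    by rewrite mul1r.
have [B BE] : exists B : bop Z Y,
    forall y i, subspace_val (B y) i = f (subspace_val y) i.
  apply: (@bop_into_subspace _ _ _ _ _ _ _ 2).
  - move=> a x y i.
    have -> : subspace_val (a *: x + y) =
        (fun k => a * subspace_val x k + subspace_val y k) :> (nat -> K).
      by apply/funext => k; rewrite subspace_coordD subspace_coordZ.
    exact: f_lin.
  - by move=> y; apply: f_bound; exact: Zgap.
  - move=> y e eE; have := subspace_valP y; rewrite inE => -[_ [e' e'Y e'E]].
    by rewrite (_ : e = e')//; apply: ell_eqP => i; rewrite eE e'E.
exists Z, A, B; split.
- apply: uniform_tails_compact => e e0.
  have M0 : 0 <= 1 + rnorm S by rewrite addr_ge0 ?rnorm_ge0.
  have [m mP] := enc_uniform_tails q1 memL nrm_local nrm0 cd half_ge0 half_lt1 M0 e0.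
  exists m => x x1; have -> : subspace_val (A x) = enc cd (w x) :> (nat -> K).
    by apply/funext => i; rewrite AE.
  apply: mP => k; apply: (le_trans (wM x k)).
  by rewrite ler_wpM2r ?exprn_ge0// /M ler_piMr.
- apply: uniform_tails_compact => e e0.
  have [m me] := geometric_small half_ge0 half_lt1 (1 / (1 - 2^-1)) e0.
  exists (n m) => y y1; have -> : subspace_val (B y) = f (subspace_val y) :> (nat -> K).
    by apply/funext => i; rewrite BE.
  apply: (le_trans (f_block _ m (Zgap y))); rewrite lee_fin (le_trans _ me)//.
  rewrite [leRHS]mulrAC ler_pM2r ?invr_gt0 ?subr_gt0// mul1r.
  by rewrite ler_piMl// exprn_ge0.
- apply: bopP => x; apply: val_inj; apply: ell_eqP => j.
  rewrite [RHS]BE /f; have -> : subspace_val (A x) = enc cd (w x) :> (nat -> K).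
    by apply/funext => i; rewrite AE.
  rewrite encK /w mulrA -of_realM -exprMn mulVf ?expr1n ?of_real1//.
  by rewrite mul1r.
Qed.

End compact_factorization.

Section compact_ideal.
Variables (R : realType) (s : scalars) (r : R) (r1 : 1 <= r).
Local Notation K := (scalar R s).

Lemma compact_ops_closed (X : normedModType K) (Y : closedSubspace (ell s r1)) :
  closure (compact_ops X Y) `<=` compact_ops X Y.
Proof.
move=> T /closure_rnormP TC; apply: uniform_tails_compact => e e0.
have e20 : 0 < e / 2 by rewrite divr_gt0.
have [S cS TS] := TC _ e20.
have [n nS] := compact_uniform_tails cS e20; exists n => x x1.
rewrite [X in X%:E](splitr e).
apply: (@ell_enorm_addle R s r r1 (restrict_seq (leq n) (subspace_val (S x)))
  (restrict_seq (leq n) (subspace_val ((T - S) x)))).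
- move=> i; rewrite /restrict_seq bopBE; case: (n <= i)%N; last by rewrite addr0.
  by rewrite subspace_coordB addrC subrK.
- exact: nS.
- rewrite (le_trans (ell_enorm_restrict r1 _ _))// -ell_rnorm lee_fin.
  rewrite -subspace_rnorm (le_trans (ler_rnorm_bop _ _))//.
  rewrite (le_trans _ (ltW TS))// -[leRHS]mulr1 ler_wpM2l ?rnorm_ge0//.
Qed.

End compact_ideal.

Lemma KS_ops_compact (R : realType) (s : scalars) (r : R) (r1 : 1 <= r)
    (X Y : normedModType (scalar R s)) : KS_ops r1 X Y `<=` compact_ops X Y.
Proof. by move=> _ [Z [A [B [_ cB ->]]]]; exact: compact_op_compr. Qed.

Lemma KS_ops_subspace (R : realType) (s : scalars) (p q : R)
    (p1 : 1 <= p) (q1 : 1 <= q) : q <= p -> p < 2 ->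
  forall X : closedSubspace (ell s p1),
    KS_ops q1 X X = closure (KS_ops q1 X X) /\
    closure (KS_ops q1 X X) = compact_ops X X.
Proof.
move=> qp p2 X.
have KC : compact_ops X X `<=` KS_ops q1 X X.
  by move=> T; exact: compact_op_KS.
have clC : closure (KS_ops q1 X X) `<=` compact_ops X X.
  by move=> T TK; apply: compact_ops_closed; move: TK;
    apply: closureS; exact: KS_ops_compact.
have sub : KS_ops q1 X X `<=` closure (KS_ops q1 X X) by exact: subset_closure.
split; apply/seteqP; split=> //.
- exact: subset_trans clC KC.
- exact: subset_trans KC sub.
Qed.

(** * Words and blocks *)

Section strings.

Fixpoint strings n : seq (seq bool) :=
  if n is n'.+1 then
    [seq false :: i | i <- strings n'] ++ [seq true :: i | i <- strings n']
  else [:: [::]].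

Lemma mem_strings n i : (i \in strings n) = (size i == n).
Proof.
elim: n i => [|n IHn] [|b i] //=; rewrite mem_cat.
  by apply/negbTE; rewrite negb_or; apply/andP; split; apply/negP => /mapP[].
rewrite eqSS -IHn; apply/orP/idP => [[] /mapP[j jn [_ ->]]//|iN].
by case: b; [right|left]; apply: map_f.
Qed.

Lemma uniq_strings n : uniq (strings n).
Proof.
elim: n => //= n IHn; rewrite cat_uniq !map_inj_uniq ?IHn//= => [|i j []//|i j []//].
by rewrite andbT; apply/hasPn => _ /mapP[i _ ->]; apply/negP => /mapP[].
Qed.

Lemma size_strings n : size (strings n) = (2 ^ n)%N.
Proof.
by elim: n => //= n IHn; rewrite size_cat !size_map IHn expnS mul2n addnn.
Qed.

Lemma big_strings (V : nmodType) n (F : seq bool -> V) :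
  \sum_(j <- strings n.+1) F j =
  \sum_(i <- strings n) (F (false :: i) + F (true :: i)).
Proof. by rewrite /= big_cat !big_map big_split. Qed.

(* Positions in a word are counted from its tail, so that they are not moved by
   adding letters in front. *)
Fixpoint flip (phi : nat -> bool) (i : seq bool) : seq bool :=
  if i is b :: i' then (b (+) phi (size i')) :: flip phi i' else [::].

Lemma size_flip phi i : size (flip phi i) = size i.
Proof. by elim: i => //= b i ->. Qed.

Lemma sum_flip (V : nmodType) n phi (F : seq bool -> V) :
  \sum_(i <- strings n) F (flip phi i) = \sum_(i <- strings n) F i.
Proof.
elim: n F => [|n IHn] F; first by rewrite !big_seq1.
rewrite !big_strings -[RHS]IHn !big_seq; apply: eq_bigr => i.
rewrite mem_strings => /eqP /= ->.
by case: (phi n) => //=; rewrite addrC.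
Qed.

(** Letters of other classes are overwritten by [false] rather than deleted, so that positions and
    lengths are preserved. *)
Fixpoint keep_class (c : nat) (i : seq bool) : seq bool :=
  if i is b :: i' then (b && (size i' %% 8 == c)%N) :: keep_class c i' else [::].

Lemma keep_class_flip c phi i : (forall k, (k %% 8)%N = c -> phi k = false) ->
  keep_class c (flip phi i) = keep_class c i.
Proof.
move=> phic; elim: i => //= b i ->; rewrite size_flip; congr (_ :: _).
by case: eqP => [/phic->|_]; rewrite ?andbF// addbF.
Qed.

Lemma keep_class_flip_inj c phi phi' i :
  keep_class c (flip phi i) = keep_class c (flip phi' i) ->
  forall k, (k < size i)%N -> (k %% 8)%N = c -> phi k = phi' k.
Proof.
elim: i => [|b i IHi] //=; rewrite !size_flip => -[bE /IHi iE] k.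
rewrite ltnS leq_eqVlt => /orP[/eqP-> kc|]; last exact: iE.
by move: bE; rewrite kc eqxx !andbT; case: b (phi _) (phi' _) => -[] [].
Qed.

(** Writes the pattern [f] on the successive positions congruent to [c] modulo 8; past the end of
    [f] the default [false] means no flip. *)
Definition mask (c : nat) (f : seq bool) (k : nat) : bool :=
  (k %% 8 == c)%N && nth false f (k %/ 8)%N.

(* [block] remembers only the letters in the class of its word, so that flipping
   this class moves [a :: b :: i] through distinct blocks and leaves the other
   words of the relation in theirs. *)
Definition class_of (m : nat) (a b : bool) : nat := (4 * odd m + (2 * a + b))%N.

Lemma class_of_lt8 m a b : (class_of m a b < 8)%N.
Proof. by rewrite /class_of; case: (odd m) a b => -[] []. Qed.

(** Words [w ++ i] from one vector have prefixes of length 1, 2 and 3. Parity separates lengths 1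
    and 3 from [[:: a; b]], and the two letters separate it from the other prefixes of length 2. *)
Lemma class_of_inj m m' a b a' b' : class_of m a b = class_of m' a' b' ->
  [/\ odd m = odd m', a = a' & b = b'].
Proof. by rewrite /class_of; case: (odd m) (odd m') a b a' b' => -[] [] [] [] []. Qed.

Definition block (j : seq bool) : seq bool :=
  if j is [:: a, b, h & i] then [:: a, b & keep_class (class_of (size i) a b) i]
  else j.

Section flips.
Variables (a b : bool) (f i : seq bool).
Hypotheses (size_i : (1 < size i)%N) (size_f : size f = ((size i).-1 %/ 8)%N).

Let phi := mask (class_of (size i).-1 a b) f.

(** The head occupies position [(size i).-1], whose quotient by 8 is [size f]: the first index
    beyond the pattern, hence never flipped. *)
Lemma flip_head h i' : i = h :: i' -> flip phi i = h :: flip phi i'.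
Proof.
move=> iE; rewrite iE /= /phi /mask iE /= nth_default ?andbF ?addbF//.
by rewrite size_f iE.
Qed.

Lemma mask_class c k : c != class_of (size i).-1 a b -> (k %% 8)%N = c -> phi k = false.
Proof. by move=> cN kc; rewrite /phi /mask kc (negbTE cN). Qed.

(** The class kept by the block of [w ++ i] differs from the flipped class: by parity if [w] has one
    or three letters, by its letters if it has two. The head of [i] matters when [w] is a single
    letter, since it is then the second letter of the block; [flip_head] keeps it. *)
Lemma block_prefix_flip w : w != [::] -> (size w <= 3)%N -> w != [:: a; b] ->
  block (w ++ flip phi i) = block (w ++ i).
Proof.
case: i size_i flip_head (@mask_class) => [|h [|h2 i1]] //= _ fh mc.
rewrite (fh h (h2 :: i1))//=.
have odd1 c d c' d' m : class_of m.+1 c d != class_of m c' d'.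
  by apply/eqP => /class_of_inj[/=]; case: odd.
have K c i' : c != class_of (size i1).+1 a b ->
    keep_class c (flip phi i') = keep_class c i'.
  by move=> cN; apply: keep_class_flip => k; exact: mc.
case: w => [|c [|d [|e [|//]]]] //= _ _.
- by move=> _; rewrite size_flip K// eq_sym.
- move=> cd; have /= := K (class_of (size i1).+1 c d) (h2 :: i1).
  rewrite !size_flip => -> //.
  by apply: contraNneq cd => /class_of_inj[_ -> ->].
- move=> _; have [hE] := fh h (h2 :: i1) erefl.
  have /= := K (class_of (size i1).+2 c d) [:: h, h2 & i1] (odd1 _ _ _ _ _).
  by rewrite hE !size_flip => ->.
Qed.

End flips.

Lemma mask_inj (c m : nat) (f f' i : seq bool) : (c < 8)%N -> size i = m ->
  size f = (m %/ 8)%N -> size f' = (m %/ 8)%N ->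
  keep_class c (flip (mask c f) i) = keep_class c (flip (mask c f') i) -> f = f'.
Proof.
move=> c8 im sf sf' /keep_class_flip_inj H.
apply: (@eq_from_nth _ false); rewrite ?sf ?sf'// => k km.
have := H (k * 8 + c)%N; rewrite /mask modnMDl (modn_small c8) eqxx/=.
rewrite divnMDl// divn_small// addn0; apply => //.
have : ((m %/ 8) * 8 <= m)%N by exact: leq_divM.
have : (k * 8 + 8 <= (m %/ 8) * 8)%N by rewrite -mulSnr leq_pmul2r.
by rewrite im; move: c8; lia.
Qed.

Lemma flip_block_inj a b f f' i : (1 < size i)%N ->
  size f = ((size i).-1 %/ 8)%N -> size f' = ((size i).-1 %/ 8)%N ->
  block [:: a, b & flip (mask (class_of (size i).-1 a b) f) i] =
  block [:: a, b & flip (mask (class_of (size i).-1 a b) f') i] -> f = f'.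
Proof.
case: i => [|h i'] //= _ sf sf'; rewrite !size_flip => -[].
by apply: (mask_inj (class_of_lt8 _ _ _) (m := size i')).
Qed.

Lemma flip_mask_inj a b f f' i : (1 < size i)%N ->
  size f = ((size i).-1 %/ 8)%N -> size f' = ((size i).-1 %/ 8)%N ->
  flip (mask (class_of (size i).-1 a b) f) i =
  flip (mask (class_of (size i).-1 a b) f') i -> f = f'.
Proof. by move=> s1 sf sf' E; apply: (@flip_block_inj a b f f' i) => //; rewrite E. Qed.

End strings.

(** * Averaging inequalities and lower bounds for mixed sums *)

Section averages.
Variables (R : realType) (s : scalars).
Local Notation K := (scalar R s).

(** Hoelder's inequality up to the factor 2, obtained termwise: a term is at most the threshold
    [lam], or else at most [lam ^ (1 - t)] times its [t]-th power. The choice of [lam] balances the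
    two sums. *)
Lemma sum_le_power_mean (A : Type) (r : seq A) (c : A -> R) (t N : R) : 1 <= t ->
  (forall f, 0 <= c f) -> 0 <= N -> \sum_(f <- r) c f `^ t <= N `^ t ->
  \sum_(f <- r) c f <= 2 * (size r)%:R `^ (1 - t^-1) * N.
Proof.
move=> t1 c0 N0 cN; have t0 : 0 < t by exact: lt_le_trans t1.
case: (posnP (size r)) => [/size0nil r0|m0].
  by rewrite r0 big_nil !mulr_ge0// powR_ge0.
set m : R := (size r)%:R; have {}m0 : 0 < m by rewrite ltr0n.
have [lam0|lam0] := eqVneq (m `^ (- t^-1) * N) 0.
  have {lam0}N0' : N = 0.
    by move/eqP: lam0; rewrite mulf_eq0 gt_eqF ?powR_gt0//= => /eqP.
  rewrite N0' mulr0 in cN *; rewrite powR0 ?gt_eqF// in cN.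
  elim: r cN {m m0} => [|f r IHr]; rewrite ?big_nil// !big_cons => cN.
  have r0 : 0 <= \sum_(f <- r) c f `^ t by apply: sumr_ge0 => *; exact: powR_ge0.
  have f0 : c f `^ t = 0 by apply/le_anti; rewrite powR_ge0 andbT; lra.
  rewrite (powR_eq0_eq0 f0) add0r; apply: IHr; move: cN; rewrite f0; lra.
set lam := m `^ (- t^-1) * N in lam0.
have lamE : lam = m `^ (- t^-1) * N by [].
clearbody lam.
have {}lam0 : 0 < lam by rewrite lt0r lam0 lamE mulr_ge0// powR_ge0.
have term f : c f <= lam + lam `^ (1 - t) * c f `^ t.
  have [cl|cl] := leP (c f) lam.
    by rewrite (le_trans cl)// lerDl mulr_ge0// powR_ge0.
  have cf0 : 0 < c f by exact: lt_trans cl.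
  apply: (@le_trans _ _ (lam `^ (1 - t) * c f `^ t)); last by rewrite lerDr ltW.
  rewrite -(mulr_powRB1 (ltW cf0) t0) mulrCA ler_peMr ?(ltW cf0)//.
  rewrite -[1 - t]opprB powRN mulrC ler_pdivlMr ?powR_gt0// mul1r.
  by apply: ge0_ler_powR; rewrite ?nnegrE ?subr_ge0 ?(ltW lam0) ?(ltW cf0)// ltW.
apply: (le_trans (ler_sum _ (fun f _ => term f))).
rewrite big_split/= -mulr_sumr big_const_seq count_predT iter_addr addr0 -[_ *+ _]mulr_natl -/m.
have E : m * m `^ (- t^-1) = m `^ (1 - t^-1).
  by rewrite -{1}[m]powRr1 ?(ltW m0)// -powRD ?(gt_eqF m0) ?implybT.
have -> : 2 * m `^ (1 - t^-1) * N = m * lam + m * lam by rewrite lamE -E; ring.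
rewrite lerD2l; apply: (@le_trans _ _ (lam `^ (1 - t) * N `^ t)).
  by rewrite ler_wpM2l// powR_ge0.
have NE : N `^ t = m * lam `^ t.
  rewrite lamE powRM ?powR_ge0// -powRrM mulNr mulVf ?gt_eqF//.
  by rewrite powR_inv1 ?(ltW m0)// mulrA mulfV ?mul1r// gt_eqF.
by rewrite NE mulrCA -powRD ?(gt_eqF lam0) ?implybT// subrK powRr1// ltW.
Qed.

Lemma powR_superadditive (A : Type) (r : seq A) (v : A -> R) (e : R) :
  1 <= e -> (forall a, 0 <= v a) ->
  \sum_(a <- r) v a `^ e <= (\sum_(a <- r) v a) `^ e.
Proof.
move=> e1 v0; have e0 : 0 < e by exact: lt_le_trans e1.
have S0 (r' : seq A) : 0 <= \sum_(a <- r') v a by exact: sumr_ge0.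
elim: r => [|a r IHr]; first by rewrite !big_nil powR_ge0.
rewrite !big_cons; apply: (le_trans (lerD (lexx _) IHr)).
set S := \sum_(j <- r) v j.
rewrite -(mulr_powRB1 (v0 a) e0) -(mulr_powRB1 (S0 r) e0).
rewrite -(mulr_powRB1 (addr_ge0 (v0 a) (S0 r)) e0) mulrDl.
by apply: lerD; apply: ler_wpM2l => //; apply: ge0_ler_powR;
  rewrite ?nnegrE ?subr_ge0 ?addr_ge0 ?lerDl ?lerDr.
Qed.

(* Averaging over all choices of signs kills the off-diagonal terms. *)
Lemma sign_average (A : eqType) (r : seq A) (B : A -> A -> K) (c : K) (M : R) :
  uniq r ->
  (forall e : A -> K, (forall f, e f = 1 \/ e f = -1) ->
    modulus (c + \sum_(f <- r) \sum_(g <- r) e f * e g * B f g) <= M) ->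
  modulus (c + \sum_(f <- r) B f f) <= M.
Proof.
elim: r c => [|f0 r IHr] c; first by move=> _ /(_ (fun=> 1)); rewrite !big_nil; apply; left.
move=> /= /andP[f0r ur] H; rewrite big_cons addrA; apply: IHr => // e e1.
pose e' (x : K) f := if f == f0 then x else e f.
have e'1 x f : x = 1 \/ x = -1 -> e' x f = 1 \/ e' x f = -1.
  by rewrite /e'; case: eqP.
have e'r x f : f \in r -> e' x f = e f.
  by move=> fr; rewrite /e'; case: eqP => // ff0; rewrite -ff0 fr in f0r.
pose Q := \sum_(f <- r) \sum_(g <- r) e f * e g * B f g.
pose l := \sum_(g <- r) e g * B f0 g + \sum_(f <- r) e f * B f f0.
have QE x : x * x = 1 ->
    \sum_(f <- f0 :: r) \sum_(g <- f0 :: r) e' x f * e' x g * B f g =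
    B f0 f0 + Q + x * l.
  move=> xx; have e0 : e' x f0 = x by rewrite /e' eqxx.
  rewrite !big_cons e0 xx mul1r.
  have -> : \sum_(g <- r) x * e' x g * B f0 g = x * \sum_(g <- r) e g * B f0 g.
    by rewrite mulr_sumr; apply: eq_big_seq => g gr; rewrite e'r// mulrA.
  have -> : \sum_(f <- r) \sum_(g <- f0 :: r) e' x f * e' x g * B f g =
      x * (\sum_(f <- r) e f * B f f0) + Q.
    rewrite mulr_sumr -big_split/=; apply: eq_big_seq => f fr.
    rewrite big_cons e0 e'r//; congr (_ + _); first by ring.
    by apply: eq_big_seq => g gr; rewrite e'r.
  by rewrite /l; ring.
have H1 := H (e' 1) (fun f => e'1 1 f (or_introl erefl)).
have H2 := H (e' (-1)) (fun f => e'1 (-1) f (or_intror erefl)).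
rewrite QE ?mulr1// mul1r in H1; rewrite QE ?mulrNN ?mulr1// mulN1r in H2.
set z := c + B f0 f0 + _; have zE : of_real s 2 * z =
    (c + (B f0 f0 + Q + l)) + (c + (B f0 f0 + Q - l)).
  rewrite of_real2M.
  by rewrite /z -/Q; ring.
have := ler_modulusD (c + (B f0 f0 + Q + l)) (c + (B f0 f0 + Q - l)).
by rewrite -zE modulusM modulus_of_real//; lra.
Qed.

Section mixed_lower.
Variables (t u : R) (T T' : eqType) (blk : T -> T').
Hypotheses (t1 : 1 <= t) (tu : t <= u).
Implicit Types (L : seq T) (x : T -> K).

Let t_gt0 : 0 < t. Proof. exact: lt_le_trans t1. Qed.
Let u_gt0 : 0 < u. Proof. exact: lt_le_trans tu. Qed.

(** With one word per block each inner [l^u]-norm dominates a single coordinate, so these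
    coordinates are summed with exponent [t]. The contrast with the exponent [u] in
    [enc_block_bound] is the source of the gain. *)
Lemma mixed_sum_ge_transversal (A : eqType) (r : seq A) (g : A -> T) L x :
  uniq r -> {in r, forall f, g f \in L} ->
  {in r &, injective (fun f => blk (g f))} ->
  \sum_(f <- r) modulus (x (g f)) `^ t <= mixed_sum t u blk L x.
Proof.
move=> ur gL inj.
pose H l := powsum u [seq j <- L | blk j == l] x `^ (t / u).
apply: (@le_trans _ _ (\sum_(f <- r) H (blk (g f)))).
  rewrite !big_seq; apply: ler_sum => f fr.
  have -> : modulus (x (g f)) `^ t = (modulus (x (g f)) `^ u) `^ (t / u).
    by rewrite -powRrM mulrCA mulfV ?mulr1// gt_eqF.
  apply: ge0_ler_powR; rewrite ?nnegrE ?powR_ge0 ?powsum_ge0 ?divr_ge0 ?(ltW t_gt0) ?(ltW u_gt0)//.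
  have gfr : g f \in [seq j <- L | blk j == blk (g f)].
    by rewrite mem_filter eqxx gL.
  rewrite /powsum (big_rem _ gfr)/= lerDl.
  by apply: sumr_ge0 => *; exact: powR_ge0.
rewrite -(big_map (fun f => blk (g f)) predT H); apply: ler_sum_uniq.
- by rewrite map_inj_in_uniq.
- by move=> _ /mapP[f fr ->]; rewrite mem_undup map_f// gL.
- by move=> l; exact: powR_ge0.
Qed.

(** Since [t <= u], replacing the [l^t]-sum over the blocks by an [l^u]-sum can only decrease the
    norm. *)
Lemma powsum_le_mixed_sum L x : powsum u L x <= mixed_sum t u blk L x `^ (u / t).
Proof.
have -> : powsum u L x = \sum_(l <- undup (map blk L))
    (powsum u [seq j <- L | blk j == l] x `^ (t / u)) `^ (u / t).
  have -> : powsum u L x = \sum_(j <- L) \sum_(l <- undup (map blk L) | l == blk j)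
      modulus (x j) `^ u.
    apply: eq_big_seq => j jL.
    rewrite big_mkcond (bigD1_seq (blk j)) ?undup_uniq ?mem_undup ?map_f//=.
    by rewrite eqxx big1 ?addr0// => l /negbTE->.
  rewrite (exchange_big_dep predT)//=; apply: eq_bigr => l _.
  rewrite -powRrM mulf_div [t * u]mulrC mulfV ?powRr1 ?powsum_ge0//; last first.
    by rewrite mulf_neq0// gt_eqF.
  by rewrite /powsum big_filter; apply: eq_bigl => j; rewrite eq_sym.
apply: powR_superadditive => [|l]; last exact: powR_ge0.
by rewrite ler_pdivlMr// mul1r.
Qed.

End mixed_lower.
End averages.

(** * Weighted spaces of families indexed by words *)

Section word_codings.
Variables (R : realType) (s : scalars) (t u : R).
Hypotheses (t1 : 1 <= t) (tu : t < u) (u2 : u < 2).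
Local Notation K := (scalar R s).
Implicit Types (x : seq bool -> K) (n : nat).

Let t_gt0 : 0 < t. Proof. exact: lt_le_trans t1. Qed.
Let u_gt0 : 0 < u. Proof. exact: lt_trans tu. Qed.

Definition word_norm (mu : R) n x : R :=
  mu ^+ n * mixed_sum t u block (strings n) x `^ t^-1.

Lemma word_norm_local mu n x y : {in strings n, x =1 y} ->
  word_norm mu n x = word_norm mu n y.
Proof. by move=> xy; rewrite /word_norm (eq_mixed_sum _ _ _ xy). Qed.

Lemma word_norm0 mu n : word_norm mu n (fun=> 0) = 0.
Proof.
rewrite /word_norm [mixed_sum _ _ _ _ _]big1 ?powR0 ?mulr0 ?invr_eq0 ?gt_eqF// => l _.
rewrite /powsum big1 ?powR0// => [|j _].
  by rewrite mulf_neq0 ?invr_eq0 ?gt_eqF.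
by rewrite modulus0 powR0// gt_eqF.
Qed.

(** Levels are embedded separately and the weight [mu ^+ n] scales both sides of the estimate alike.
    So [C] is independent of [mu], and one constant serves a whole sequence of weights. *)
Lemma word_coding_exists (r : R) : 1 <= r -> r <= t -> exists2 C : R, 1 <= C &
  forall mu, 0 < mu -> inhabited (coding r size strings (word_norm mu) C).
Proof.
move=> r1 rt; have r0 : 0 < r by exact: lt_le_trans r1.
have [C C1 emb] := mixed_embedding s r1 rt (ltW tu) u2.
exists C => // mu mu0; have C0 : 0 <= C by exact: le_trans C1.
have mun n : 0 < mu ^+ n by rewrite exprn_gt0.
apply: coding_exists => //.
- exact: uniq_strings.
- exact: mem_strings.
- by move=> n x; rewrite mulr_ge0 ?powR_ge0// ltW.
- move=> n x j /eqP; rewrite mulf_eq0 gt_eqF//= powR_eq0 => /andP[/eqP xn _].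
  exact: mixed_sum_eq0 xn.
move=> n; have [M [a aP]] := emb _ _ block _ (uniq_strings n).
exists M, (fun k j => of_real s (mu ^+ n) * a k j) => x.
have -> : \sum_(k < M) modulus (\sum_(j <- strings n)
      of_real s (mu ^+ n) * a k j * x j) `^ r =
    (mu ^+ n) `^ r * \sum_(k < M) modulus (\sum_(j <- strings n) a k j * x j) `^ r.
  rewrite mulr_sumr; apply: eq_bigr => k _.
  under eq_bigr do rewrite -mulrA.
  by rewrite -mulr_sumr modulusM modulus_of_real ?powRM ?modulus_ge0// ltW.
have E : word_norm mu n x `^ r =
    (mu ^+ n) `^ r * mixed_sum t u block (strings n) x `^ (r / t).
  by rewrite powRM ?powR_ge0 ?(ltW (mun n))// -powRrM [t^-1 * r]mulrC.
have /andP[lo hi] := aP x.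
rewrite E ler_wpM2l ?powR_ge0//= powRM// ?mulr_ge0 ?powR_ge0 ?(ltW (mun n))// E.
rewrite mulrCA ler_wpM2l ?powR_ge0// (le_trans hi)//.
by rewrite ler_wpM2r ?powR_ge0// le1r_powR.
Qed.

Section words.
Variables (r mu C : R) (cd : coding r size strings (word_norm mu) C).
Hypotheses (r1 : 1 <= r) (mu1 : 1 <= mu) (C1 : 1 <= C).

Let mu_gt0 : 0 < mu. Proof. exact: lt_le_trans mu1. Qed.

(** All words [g a] lie in one block of one level, so only an [l^u]-norm of distinct unit vectors
    with coefficients of modulus at most 1 is left. *)
Lemma enc_block_bound (A : eqType) (f : seq A) (g : A -> seq bool) (e : A -> K) n :
  uniq f -> {in f &, injective g} -> {in f, forall a, size (g a) = n} ->
  {in f &, forall a b, block (g a) = block (g b)} ->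
  (forall a, modulus (e a) <= 1) ->
  (ell_enorm r (enc cd (fun v => (\sum_(a <- f) e a * (v == g a)%:R)%R)) <=
   (C * (mu ^+ n * (size f)%:R `^ u^-1))%:E)%E.
Proof.
move=> uf inj gn gblk e1.
set x := fun v => _; set c := mu ^+ n * _.
have c0 : 0 <= c by rewrite mulr_ge0 ?powR_ge0// exprn_ge0// ltW.
have x0 v : (forall a, a \in f -> v != g a) -> x v = 0.
  move=> va; rewrite /x big_seq big1// => a /va /negbTE->.
  by rewrite mulr0.
apply: (enc_upper cd (c := fun m => if m == n then c else 0)); last first.
  move=> N; rewrite -big_mkcond/=.
  have [nN|Nn] := ltnP n N; first by rewrite (big_pred1 (Ordinal nN)).
  by rewrite big1// => i /eqP im; move: (ltn_ord i); rewrite im ltnNge Nn.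
move=> m; case: eqP => [->|mn]; last first.
  rewrite (word_norm_local _ (y := fun=> 0)) ?word_norm0// => v.
  rewrite mem_strings => /eqP vm; apply: x0 => a af; apply/eqP => va.
  by apply: mn; rewrite -vm va gn.
rewrite /word_norm ler_wpM2l ?exprn_ge0 ?(ltW mu_gt0)//.
case: f uf inj gn gblk @x @c c0 x0 => [|a0 f'] uf inj gn gblk x c c0 x0.
  have -> : mixed_sum t u block (strings n) x = 0.
    rewrite /mixed_sum big1// => l _; rewrite /powsum big1 ?powR0// => [|j _].
      by rewrite mulf_neq0 ?invr_eq0 ?gt_eqF.
    by rewrite x0// modulus0 powR0// gt_eqF.
  by rewrite powR0 ?powR_ge0// invr_eq0 gt_eqF.
set f := a0 :: f' in uf inj gn gblk x c c0 x0 *.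
apply: (@le_trans _ _ ((powsum u (strings n) x `^ (t / u)) `^ t^-1)).
  apply: ge0_ler_powR; rewrite ?nnegrE ?mixed_sum_ge0 ?powR_ge0 ?invr_ge0 ?(ltW t_gt0) ?(ltW u_gt0)//.
  apply: (@mixed_sum_block R s t u _ _ block t_gt0 u_gt0 _ x (block (g a0))) => j _ jb.
  apply: x0 => a af; apply: contraNneq jb => ->.
  by rewrite (gblk a a0)// mem_head.
rewrite -powRrM mulrAC mulfV ?gt_eqF// mul1r.
apply: ge0_ler_powR; rewrite ?nnegrE ?powsum_ge0 ?invr_ge0 ?(ltW t_gt0) ?(ltW u_gt0)//.
have count1 j : \sum_(a <- f) (j == g a)%:R <= 1 :> R.
  have -> : \sum_(a <- f) (j == g a)%:R = (count_mem j (map g f))%:R :> R.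
    rewrite -sum1_count big_map natr_sum [RHS]big_mkcond/=.
    by apply: eq_bigr => a _; rewrite [g a == j]eq_sym; case: eqP.
  by rewrite count_uniq_mem ?map_inj_in_uniq//; case: (_ \in _); rewrite ?ler01.
apply: (@le_trans _ _ (\sum_(j <- strings n) \sum_(a <- f) (j == g a)%:R)).
  apply: ler_sum => j _; apply: (@le_trans _ _ (modulus (x j))).
    have xj : modulus (x j) <= 1.
      apply: le_trans (count1 j); apply: (le_trans (ler_modulus_sum _ _ _)).
      apply: ler_sum => a _; rewrite modulusM.
      by case: (j == g a); rewrite ?modulus0 ?mulr0// modulus1 mulr1.
    have [xj0|xj0] := eqVneq (modulus (x j)) 0.
      by rewrite xj0 powR0// gt_eqF.
    rewrite ge1r_powR//; first by rewrite lt0r xj0 modulus_ge0.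
    exact: le_trans t1 (ltW tu).
  apply: (le_trans (ler_modulus_sum _ _ _)); apply: ler_sum => a _.
  rewrite modulusM; case: (j == g a); rewrite ?modulus0 ?mulr0//.
  by rewrite modulus1 mulr1.
have -> : (size f)%:R = \sum_(a <- f) 1 :> R.
  by rewrite big_const_seq count_predT iter_addr addr0.
rewrite exchange_big/= !big_seq; apply: ler_sum => a af.
have -> : \sum_(j <- strings n) (j == g a)%:R = (count_mem (g a) (strings n))%:R :> R.
  by rewrite -sum1_count natr_sum [RHS]big_mkcond/=; apply: eq_bigr => j _; case: eqP.
by rewrite count_uniq_mem ?uniq_strings//; case: (_ \in _); rewrite ?ler01.
Qed.

Lemma enc_zero i : enc cd (fun=> 0) i = 0.
Proof.
have [l [c cE]] := enc_finite cd i.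
by rewrite cE big1// => j _; rewrite mulr0.
Qed.

Lemma enc_sum_bound (W : eqType) (l : seq (K * W)) (P : W -> seq bool -> K) (B : R) :
  (forall w, w \in map snd l -> (ell_enorm r (enc cd (P w)) <= B%:E)%E) ->
  (ell_enorm r (enc cd (fun v => (\sum_(cw <- l) cw.1 * P cw.2 v)%R)) <=
   (\sum_(cw <- l) modulus cw.1 * B)%:E)%E.
Proof.
elim: l => [|cw l IHl] PB.
  rewrite big_nil (_ : enc cd _ = (0 : nat -> K^o)) ?ell_enorm0//.
  by apply/funext => i; under eq_fun do rewrite big_nil; exact: enc_zero.
rewrite big_cons; apply: (@ell_enorm_addle R s r r1 (fun i => cw.1 * enc cd (P cw.2) i)
  (enc cd (fun v => (\sum_(cw <- l) cw.1 * P cw.2 v)%R))).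
- by move=> i; under eq_fun do rewrite big_cons; rewrite enc_lin.
- rewrite ell_enorm_scale// EFinM; apply: lee_wpmul2l.
    by rewrite lee_fin modulus_ge0.
  by apply: PB; rewrite /= mem_head.
- by apply: IHl => w wl; apply: PB; rewrite /= inE wl orbT.
Qed.

End words.
End word_codings.

(** * Szankowski spaces *)

Section relations.
Variables (R : realType) (s : scalars).
Local Notation K := (scalar R s).
Implicit Types (x : seq bool -> K) (i v w : seq bool).

(* The vectors [z i] are Szankowski's [e_{2i} - e_{2i+1} + e_{4i} + ... + e_{4i+3}],
   indexed by binary words; [relation i x = 0] says that the two functionals
   [(x_{2i} - x_{2i+1}) / 2] and [(x_{4i} + ... + x_{4i+3}) / 4] agree on [x]. *)
Definition relation i x : K :=
  2 * (x (false :: i) - x (true :: i)) -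
  (x [:: false, false & i] + x [:: false, true & i] +
   x [:: true, false & i] + x [:: true, true & i]).

(** Vectors are lists of coefficients and prefixes, so that their [l^1]-mass and all conditions on
    prefixes are settled by computation, uniformly in [i]. *)
Definition word_sum (l : seq (K * seq bool)) i v : K :=
  \sum_(cw <- l) cw.1 * (v == cw.2 ++ i)%:R.

Definition z_words : seq (K * seq bool) :=
  [:: (1, [:: false]); (-1, [:: true]);
      (1, [:: false; false]); (1, [:: false; true]);
      (1, [:: true; false]); (1, [:: true; true])].

Definition z_vec i : seq bool -> K := word_sum z_words i.

Lemma relation_lin i (a : K) x y :
  relation i (fun v => a * x v + y v) = a * relation i x + relation i y.
Proof. by rewrite /relation; ring. Qed.

(** For [i = j] both functionals equal 1. For [j = c :: i] the second sees opposite signs, for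
    [i = c :: j] the first sees equal values, and otherwise both vanish. *)
Lemma relation_z i j : relation i (z_vec j) = 0.
Proof.
rewrite /relation /z_vec /word_sum !big_cons !big_nil /= !eqseq_cons /=.
ring.
Qed.

Definition letter_sign (a : bool) : K := if a then -1 else 1.

(** The sign makes the word [[:: a, b & i]] cancel, so the coordinate tested in [level_sum] is
    absent from the vector. At [[:: ~~ a; b]] the contributions add to -2, entered as two unit
    terms. *)
Definition y_words (a b : bool) : seq (K * seq bool) :=
  [:: (-1, [:: ~~ a; b]); (-1, [:: ~~ a; b]);
      (letter_sign a, [:: false; false; b]); (letter_sign a, [:: false; true; b]);
      (letter_sign a, [:: true; false; b]); (letter_sign a, [:: true; true; b]);
      (-1, [:: false]); (1, [:: true]);
      (-1, [:: false; ~~ b]); (-1, [:: true; ~~ b])].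

Lemma y_wordsE a b i v :
  letter_sign a * z_vec (b :: i) v - z_vec i v = word_sum (y_words a b) i v.
Proof.
rewrite /z_vec /word_sum !big_cons !big_nil /=.
by case: a; case: b => /=; ring.
Qed.

Lemma y_words_short a b w : w \in map snd (y_words a b) ->
  [&& w != [::], (size w <= 3)%N & w != [:: a; b]].
Proof.
suff /allP/(_ w) : all (fun w => [&& w != [::], (size w <= 3)%N & w != [:: a; b]])
  (map snd (y_words a b)) by [].
by case: a; case: b.
Qed.

Lemma z_words_short w : w \in map snd z_words -> (size w <= 3)%N.
Proof.
by suff /allP/(_ w) : all (fun w => (size w <= 3)%N) (map snd z_words) by [].
Qed.

Lemma modulus_letter_sign a : modulus (letter_sign a) = 1.
Proof. by case: a; rewrite /= ?modulusN modulus1. Qed.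

Lemma y_words_modulus a b : \sum_(cw <- y_words a b) modulus cw.1 = 10 :> R.
Proof. by rewrite !big_cons big_nil /= !modulus_letter_sign !modulusN !modulus1; ring. Qed.

Lemma z_words_modulus : \sum_(cw <- z_words) modulus cw.1 = 6 :> R.
Proof. by rewrite !big_cons big_nil /= !modulusN !modulus1; ring. Qed.

Lemma z_vec_coord b i : z_vec i (b :: i) = letter_sign b.
Proof.
have ne (c : bool) : (i == c :: i) = false.
  by apply/negbTE/eqP => /(congr1 size) /= /n_Sn.
rewrite /z_vec /word_sum !big_cons big_nil /= !eqseq_cons !ne !eqxx !andbF.
by case: b => /=; ring.
Qed.

End relations.

Section szankowski_space.
Variables (R : realType) (s : scalars) (t u : R).
Hypotheses (t1 : 1 <= t) (tu : t < u) (u2 : u < 2).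
Local Notation K := (scalar R s).
Variables (r mu C : R) (cd : coding r size strings (word_norm t u mu : nat -> (seq bool -> K) -> R) C).
Hypotheses (r1 : 1 <= r) (mu1 : 1 <= mu) (C1 : 1 <= C).
Local Notation ell := (ell s r1).

Let C_ge0 : 0 <= C. Proof. exact: le_trans C1. Qed.

(** The left summand requires [y] to be a code, the right one imposes the relations on the decoded
    family; one index type gives one common kernel. *)
Definition sz_functional (k : nat + seq bool) (y : ell) : K :=
  match k with inl i => code_gap cd i y | inr i => relation i (dec cd y) end.

Lemma sz_functional_lin k a x y :
  sz_functional k (a *: x + y) = a * sz_functional k x + sz_functional k y.
Proof.
case: k => i; first exact: code_gap_lin.
rewrite /sz_functional -relation_lin; congr (relation i _).
by apply/funext => j; rewrite -dec_lin.
Qed.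

Lemma sz_functional_bounded k :
  exists A, forall x, modulus (sz_functional k x) <= A * rnorm x.
Proof.
case: k => i; first exact: code_gap_bounded.
have /choice[A AP] := @dec_bounded _ _ _ r1 _ _ _ _ _ cd.
exists (modulus (2 : K) * (A (false :: i) + A (true :: i)) +
  (A [:: false, false & i] + A [:: false, true & i] +
   A [:: true, false & i] + A [:: true, true & i])) => x.
rewrite /sz_functional /relation (le_trans (ler_modulusD _ _))// modulusN modulusM.
rewrite [leRHS]mulrDl -[_ * _ * rnorm x]mulrA !mulrDl; apply: lerD.
  apply: ler_wpM2l; first exact: modulus_ge0.
  by rewrite (le_trans (ler_modulusD _ _))// modulusN lerD.
by do !(rewrite (le_trans (ler_modulusD _ _))//; apply: lerD => //).
Qed.

Definition sz_space := common_kernel sz_functional_lin sz_functional_bounded.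

Lemma sz_gap (y : sz_space) i : code_gap cd i (subspace_val y) = 0.
Proof. exact: (common_kernelP sz_functional_lin sz_functional_bounded _ (subspace_valP y) (inl i)). Qed.

Lemma sz_relation (y : sz_space) i : relation i (dec cd (subspace_val y)) = 0.
Proof. exact: (common_kernelP sz_functional_lin sz_functional_bounded _ (subspace_valP y) (inr i)). Qed.

Lemma sz_enc_dec (y : sz_space) :
  enc cd (dec cd (subspace_val y)) = subspace_val y :> (nat -> K).
Proof.
by apply/funext => i; apply/eqP; rewrite -subr_eq0; apply/eqP/sz_gap.
Qed.

Lemma sz_rnorm (y : sz_space) :
  (rnorm y)%:E = ell_enorm r (enc cd (dec cd (subspace_val y))).
Proof. by rewrite sz_enc_dec subspace_rnorm ell_rnorm. Qed.

Lemma enc_in_sz (x : seq bool -> K) (e : ell) : (forall i, relation i x = 0) ->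
  (forall i, e i = enc cd x i) -> e \in subspace_pred sz_space.
Proof.
move=> x0 ex; have eE : enc cd x = e by apply/funext => i; rewrite ex.
have dE : dec cd e = x by apply/funext => j; rewrite -eE encK.
apply/common_kernelP => -[i|i] /=; last by rewrite dE.
by rewrite /code_gap dE eE subrr.
Qed.

Lemma sz_element (x : seq bool -> K) (M : R) : (forall i, relation i x = 0) ->
  (ell_enorm r (enc cd x) <= M%:E)%E ->
  exists y : sz_space, forall j, dec cd (subspace_val y) j = x j.
Proof.
move=> x0 xM; pose e : ell := Ell r1 (ell_enorm_mem xM).
have eP : e \in subspace_pred sz_space by exact: (enc_in_sz x0).
by exists (SubspaceOf eP) => j; exact: encK.
Qed.

Lemma sz_dec_lin (a : K) (x y : sz_space) j :
  dec cd (subspace_val (a *: x + y)) j =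
  a * dec cd (subspace_val x) j + dec cd (subspace_val y) j.
Proof.
have -> : subspace_val (a *: x + y) =
    (fun k => a * subspace_val x k + subspace_val y k) :> (nat -> K).
  by apply/funext => k; rewrite subspace_coordD subspace_coordZ.
exact: dec_lin.
Qed.

(** For each fixed prefix the words [w ++ g a] stay in a single block, so [enc_block_bound] applies
    prefix by prefix. Prefixes have at most three letters, whence [mu ^+ (n + 3)]. *)
Lemma words_enorm (A : eqType) (f : seq A) (g : A -> seq bool) (e : A -> K) n
    (l : seq (K * seq bool)) : uniq f -> {in f &, injective g} ->
  {in f, forall a, size (g a) = n} ->
  (forall w, w \in map snd l -> (size w <= 3)%N) ->
  (forall w, w \in map snd l ->
     {in f &, forall a b, block (w ++ g a) = block (w ++ g b)}) ->
  (forall a, modulus (e a) <= 1) ->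
  (ell_enorm r (enc cd (fun v => (\sum_(a <- f) e a * word_sum l (g a) v)%R)) <=
   ((\sum_(cw <- l) modulus cw.1) *
    (C * (mu ^+ (n + 3) * (size f)%:R `^ u^-1)))%:E)%E.
Proof.
move=> uf inj gn l3 gblk e1; pose B := C * (mu ^+ (n + 3) * (size f)%:R `^ u^-1).
pose P w v : K := \sum_(a <- f) e a * (v == w ++ g a)%:R.
have -> : (fun v => \sum_(a <- f) e a * word_sum l (g a) v) =
    (fun v => \sum_(cw <- l) cw.1 * P cw.2 v).
  apply/funext => v; under eq_bigr do rewrite /word_sum mulr_sumr.
  rewrite exchange_big/=; apply: eq_bigr => cw _; rewrite mulr_sumr.
  by apply: eq_bigr => a _; rewrite mulrCA.
rewrite mulr_suml; apply: enc_sum_bound => // w wl.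
have inj' : {in f &, injective (fun a => w ++ g a)}.
  by move=> a b af bf /eqP; rewrite eqseq_cat// eqxx => /eqP; exact: inj.
have size' : {in f, forall a, size (w ++ g a) = (size w + n)%N}.
  by move=> a af; rewrite size_cat gn.
have := enc_block_bound t1 tu cd mu1 uf inj' size' (gblk w wl) e1.
move=> H; apply: le_trans H _.
rewrite lee_fin ler_wpM2l// ler_wpM2r ?powR_ge0// addnC.
by rewrite ler_weXn2l// leq_add2l l3.
Qed.

Lemma z_vec_enorm i :
  (ell_enorm r (enc cd (z_vec R s i : seq bool -> K)) <= (6 * (C * mu ^+ (size i + 3)))%:E)%E.
Proof.
have := @words_enorm unit [:: tt] (fun=> i) (fun=> 1) (size i) (z_words R s) isT.
rewrite z_words_modulus /= powR1 mulr1.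
have -> : (fun v => \sum_(a <- [:: tt]) 1 * word_sum (z_words R s) i v) = z_vec R s i.
  by apply/funext => v; rewrite big_seq1 mul1r.
apply => //; first by move=> [] [].
- exact: z_words_short.
- by rewrite modulus1.
Qed.

Lemma z_element i : exists y : sz_space, forall j, dec cd (subspace_val y) j = z_vec R s i j.
Proof. by apply: sz_element (z_vec_enorm i) => k; exact: relation_z. Qed.

Definition zv i : sz_space := sval (cid (z_element i)).

Lemma dec_zv i j : dec cd (subspace_val (zv i)) j = z_vec R s i j.
Proof. exact: (svalP (cid (z_element i))). Qed.

Lemma rnorm_zv i : rnorm (zv i) <= 6 * (C * mu ^+ (size i + 3)).
Proof.
rewrite -lee_fin sz_rnorm; have -> : dec cd (subspace_val (zv i)) = z_vec R s i.
  by apply/funext => j; exact: dec_zv.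
exact: z_vec_enorm.
Qed.

Definition yv a b i : sz_space := letter_sign R s a *: zv (b :: i) + (-1) *: zv i.

Lemma dec_yv a b i j :
  dec cd (subspace_val (yv a b i)) j = word_sum (y_words R s a b) i j.
Proof.
rewrite sz_dec_lin -y_wordsE dec_zv.
have := sz_dec_lin (-1) (zv i) 0 j; rewrite addr0 => ->.
have -> : dec cd (subspace_val (0 : sz_space)) j = 0.
  have := sz_dec_lin (-1) 0 0 j; rewrite scaler0 addr0.
  by rewrite mulN1r addNr.
by rewrite addr0 dec_zv mulN1r.
Qed.

End szankowski_space.

Lemma of_real_expr2 (R : realType) (s : scalars) l :
  of_real s (2 ^+ l : R) = (2 ^ l)%:R.
Proof.
elim: l => [|k IHk]; first by rewrite expr0 of_real1.
by rewrite exprS of_realM IHk of_real2M expnS mul2n -addnn natrD.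
Qed.

(** * Trace functionals [beta] and their increments *)

Section trace_functional.
Variables (R : realType) (s : scalars) (t u : R).
Hypotheses (t1 : 1 <= t) (tu : t < u) (u2 : u < 2).
Local Notation K := (scalar R s).
Local Notation wnorm := (fun m => (word_norm t u m : nat -> (seq bool -> K) -> R)).
Variables (r mu C : R) (cd : coding r size strings (wnorm mu) C).
Hypotheses (r1 : 1 <= r) (mu1 : 1 <= mu) (C1 : 1 <= C).
Variables (r' mu' C' : R) (cd' : coding r' size strings (wnorm mu') C').
Hypotheses (r1' : 1 <= r') (mu1' : 1 <= mu').
Local Notation X := (sz_space cd r1).
Local Notation X' := (sz_space cd' r1').
Local Notation zv := (zv t1 tu cd r1 mu1 C1).
Local Notation yv := (yv t1 tu cd r1 mu1 C1).
Implicit Types (S : bop X X') (n : nat).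

Let t_gt0 : 0 < t. Proof. exact: lt_le_trans ltr01 t1. Qed.

Definition image_coord S (x : X) j : K := dec cd' (subspace_val (S x)) j.

Lemma image_coord_lin S a x y j : image_coord S (a *: x + y) j =
  a * image_coord S x j + image_coord S y j.
Proof. by rewrite /image_coord linearP sz_dec_lin. Qed.

Lemma image_coord0 S j : image_coord S 0 j = 0.
Proof.
by have := image_coord_lin S (-1) 0 0 j; rewrite scaler0 addr0 mulN1r addNr.
Qed.

Lemma image_coordZ S a x j : image_coord S (a *: x) j = a * image_coord S x j.
Proof. by have := image_coord_lin S a x 0 j; rewrite addr0 image_coord0 addr0. Qed.

Lemma image_coord_sum S (A : Type) (f : seq A) (e : A -> K) (w : A -> X) j :
  image_coord S (\sum_(a <- f) e a *: w a) j =
  \sum_(a <- f) e a * image_coord S (w a) j.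
Proof.
elim: f => [|a f IHf]; first by rewrite !big_nil image_coord0.
by rewrite !big_cons image_coord_lin IHf.
Qed.

Lemma dec_sum (A : Type) (f : seq A) (e : A -> K) (w : A -> X) j :
  dec cd (subspace_val (\sum_(a <- f) e a *: w a)) j =
  \sum_(a <- f) e a * dec cd (subspace_val (w a)) j.
Proof.
elim: f => [|a f IHf]; last by rewrite !big_cons sz_dec_lin IHf.
rewrite !big_nil; have := sz_dec_lin (-1) 0 (0 : X) j.
by rewrite scaler0 addr0 mulN1r addNr.
Qed.

Lemma image_coord_yv S a b i j : image_coord S (yv a b i) j =
  letter_sign R s a * image_coord S (zv (b :: i)) j - image_coord S (zv i) j.
Proof. by rewrite image_coord_lin image_coordZ mulN1r. Qed.

(** Half of [x (false :: i) - x (true :: i)] is 1 at [z i]; thus [beta S n / 2 ^+ n.+1] is a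
    normalized trace of [S] over the [z i] of level [n]. *)
Definition beta S n : K := \sum_(i <- strings n)
  (image_coord S (zv i) (false :: i) - image_coord S (zv i) (true :: i)).

Definition level_sum S a b n : K :=
  \sum_(i <- strings n) image_coord S (yv a b i) [:: a, b & i].

(** The relations hold for [S (z i)] since it lies in the target space; they rewrite [2 * beta S n]
    in the coordinates [[:: a, b & i]] that also occur in [beta S n.+1]. *)
Lemma beta_step S n : beta S n.+1 - 2 * beta S n =
  level_sum S false false n + level_sum S false true n +
  (level_sum S true false n + level_sum S true true n).
Proof.
rewrite /beta /level_sum big_strings mulr_sumr -sumrB -!big_split/=.
apply: eq_bigr => i _; rewrite !image_coord_yv /=.
have := sz_relation (S (zv i)) i; rewrite /relation -/(image_coord S (zv i) _).
move/eqP; rewrite subr_eq0 => /eqP; rewrite -!/(image_coord S (zv i) _) => ->.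
ring.
Qed.

(** By [sign_average] the diagonal may be replaced by the image of one signed sum [x] of the vectors
    [yv]. Common blocks give [x] the factor [2 ^ (l / u)], distinct blocks of the tested coordinates
    give [2 ^ (l * (1 - 1 / t))] by [sum_le_power_mean]; 20 is the mass 10 of [y_words] times the 2
    of that lemma. *)
Lemma family_bound S a b i l : (1 < size i)%N -> l = ((size i).-1 %/ 8)%N ->
  modulus (\sum_(f <- strings l)
    image_coord S (yv a b (flip (mask (class_of (size i).-1 a b) f) i))
      [:: a, b & flip (mask (class_of (size i).-1 a b) f) i]) <=
  20 * C * mu ^+ (size i + 3) * rnorm S *
    ((2 ^+ l) `^ (1 - t^-1) * (2 ^+ l) `^ u^-1).
Proof.
move=> size_i lE; pose fl f := flip (mask (class_of (size i).-1 a b) f) i.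
rewrite -[X in modulus X]/(\sum_(f <- strings l)
  image_coord S (yv a b (fl f)) [:: a, b & fl f]).
have lP f : f \in strings l -> size f = ((size i).-1 %/ 8)%N.
  by rewrite mem_strings lE => /eqP.
have ul := uniq_strings l.
have inj : {in strings l &, injective fl}.
  by move=> f f' /lP sf /lP sf'; exact: (@flip_mask_inj a b f f' i size_i sf sf').
rewrite -[X in modulus X]add0r; apply: (@sign_average R s _ _
  (fun f g => image_coord S (yv a b (fl g)) [:: a, b & fl f])) => // e e1.
rewrite add0r.
have {}e1 f : modulus (e f) <= 1 by case: (e1 f) => ->; rewrite ?modulusN modulus1.
pose x := \sum_(f <- strings l) e f *: yv a b (fl f).
have -> : \sum_(f <- strings l) \sum_(g <- strings l)
      e f * e g * image_coord S (yv a b (fl g)) [:: a, b & fl f] =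
    \sum_(f <- strings l) e f * image_coord S x [:: a, b & fl f].
  apply: eq_bigr => f _; rewrite image_coord_sum mulr_sumr.
  by apply: eq_bigr => g _; rewrite mulrA.
have size2 : (size (strings l))%:R = 2 ^+ l :> R by rewrite size_strings natrX.
have xM : rnorm x <= 10 * (C * (mu ^+ (size i + 3) * (2 ^+ l) `^ u^-1)).
  rewrite -lee_fin sz_rnorm.
  have -> : dec cd (subspace_val x) =
      (fun v => \sum_(f <- strings l) e f * word_sum (y_words R s a b) (fl f) v).
    apply/funext => v; rewrite dec_sum; apply: eq_bigr => f _.
    by rewrite dec_yv.
  have := @words_enorm R s t u t1 tu r mu C cd r1 mu1 C1 _ (strings l) fl e
    (size i) (y_words R s a b) ul inj.
  rewrite y_words_modulus size2; apply => //.
  - by move=> f _; rewrite size_flip.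
  - by move=> w /y_words_short/and3P[].
  - move=> w /y_words_short/and3P[w0 w3 wab] f f' /lP sf /lP sf'.
    by rewrite !block_prefix_flip.
pose v := image_coord S x; pose N := rnorm (S x).
have vN : \sum_(f <- strings l) modulus (v [:: a, b & fl f]) `^ t <= N `^ t.
  have sub : {in strings l, forall f, [:: a, b & fl f] \in strings (size i).+2}.
    by move=> f _; rewrite mem_strings /= size_flip.
  have binj : {in strings l &, injective (fun f => block [:: a, b & fl f])}.
    by move=> f f' /lP sf /lP sf'; exact: (@flip_block_inj a b f f' i size_i sf sf').
  apply: (le_trans (mixed_sum_ge_transversal t1 (ltW tu) v ul sub binj)).
  have := nrm_dec_le (size i).+2 (sz_gap (S x)).
  rewrite /word_norm -/(image_coord S x) -/v -subspace_rnorm -/N => H.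
  set m := mixed_sum _ _ _ _ _ in H *.
  have m0 : 0 <= m by exact: mixed_sum_ge0.
  have -> : m = (m `^ t^-1) `^ t by rewrite -powRrM mulVf ?gt_eqF// powRr1.
  apply: ge0_ler_powR; rewrite ?nnegrE ?powR_ge0 ?rnorm_ge0 ?(ltW t_gt0)//.
  apply: le_trans H; rewrite ler_peMl ?powR_ge0//.
  exact: exprn_ege1.
apply: (le_trans (ler_modulus_sum _ _ _)).
apply: (@le_trans _ _ (\sum_(f <- strings l) modulus (v [:: a, b & fl f]))).
  by apply: ler_sum => f _; rewrite modulusM ler_piMl ?modulus_ge0.
apply: (le_trans (sum_le_power_mean t1 _ (rnorm_ge0 _) vN)).
  by move=> f; exact: modulus_ge0.
rewrite size2.
have NM : N <= rnorm S * (10 * (C * (mu ^+ (size i + 3) * (2 ^+ l) `^ u^-1))).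
  by rewrite (le_trans (ler_rnorm_bop _ _))// ler_wpM2l ?rnorm_ge0.
apply: (@le_trans _ _ (2 * (2 ^+ l) `^ (1 - t^-1) *
    (rnorm S * (10 * (C * (mu ^+ (size i + 3) * (2 ^+ l) `^ u^-1)))))).
  by rewrite ler_wpM2l// mulr_ge0// powR_ge0.
by rewrite le_eqVlt; apply/orP; left; apply/eqP; ring.
Qed.

(** Flips permute the words of length [n], so the level sum is its own average over the [2 ^ l]
    flips, and each word contributes one [family_bound]. Dividing by [2 ^ l] leaves the negative
    exponent. *)
Lemma level_sum_bound S a b n l : (1 < n)%N -> l = (n.-1 %/ 8)%N ->
  modulus (level_sum S a b n) <=
  2 ^+ n * (20 * C * mu ^+ (n + 3) * rnorm S * (2 ^+ l) `^ (u^-1 - t^-1)).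
Proof.
move=> n1 lE; set B := 20 * C * mu ^+ (n + 3) * rnorm S.
pose F i := image_coord S (yv a b i) [:: a, b & i].
have l2 : 0 < 2 ^+ l :> R by rewrite exprn_gt0.
have E : (2 ^+ l) * modulus (level_sum S a b n) <=
    2 ^+ n * (B * ((2 ^+ l) `^ (1 - t^-1) * (2 ^+ l) `^ u^-1)).
  rewrite -[2 ^+ l in leLHS](@modulus_of_real R s) ?(ltW l2)// -modulusM.
  have -> : of_real s (2 ^+ l) * level_sum S a b n =
      \sum_(i <- strings n) \sum_(f <- strings l)
        F (flip (mask (class_of n.-1 a b) f) i).
    rewrite exchange_big/=; under eq_bigr do rewrite sum_flip.
    rewrite big_const_seq count_predT iter_addr addr0 size_strings.
    rewrite of_real_expr2.
    by rewrite mulr_natl.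
  apply: (le_trans (ler_modulus_sum _ _ _)).
  apply: (@le_trans _ _ (\sum_(i <- strings n)
      (B * ((2 ^+ l) `^ (1 - t^-1) * (2 ^+ l) `^ u^-1)))).
    rewrite !big_seq; apply: ler_sum => i; rewrite mem_strings => /eqP ni.
    by have := @family_bound S a b i l; rewrite ni; apply.
  rewrite big_const_seq count_predT iter_addr addr0 size_strings.
  by rewrite -[leLHS]mulr_natl natrX.
have -> : (2 ^+ l) `^ (u^-1 - t^-1) =
    (2 ^+ l)^-1 * ((2 ^+ l) `^ (1 - t^-1) * (2 ^+ l) `^ u^-1).
  have -> : (2 ^+ l)^-1 = (2 ^+ l) `^ (-1) :> R by rewrite powR_inv1// ltW.
  rewrite -!powRD ?(gt_eqF l2) ?implybT//.
  by congr (_ `^ _); ring.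
rewrite mulrA [2 ^+ n * B]mulrC -/(2 ^+ l) -(ler_pM2l l2) (le_trans E)//.
rewrite le_eqVlt; apply/orP; left; apply/eqP; field.
by rewrite gt_eqF.
Qed.

End trace_functional.

(** * The trace functional and finite rank *)

Section finite_rank_representation.
Variables (R : realType) (s : scalars) (r : R) (r1 : 1 <= r).
Local Notation K := (scalar R s).
Variable Y : closedSubspace (ell s r1).

Definition bounded_functional (g : Y -> K) :=
  (forall a x y, g (a *: x + y) = a * g x + g y) /\
  exists A, forall x, modulus (g x) <= A * rnorm x.

Lemma bounded_functional_sum (k : nat) (g : nat -> Y -> K) (c : nat -> K) :
  (forall i, bounded_functional (g i)) ->
  bounded_functional (fun y => \sum_(i < k) g i y * c i).
Proof.
move=> gb; split=> [a x y|].
  rewrite mulr_sumr -big_split/=; apply: eq_bigr => i _.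
  by rewrite (gb i).1; ring.
have /choice[A AP] : forall i, exists A, forall x, modulus (g i x) <= A * rnorm x.
  by move=> i; exact: (gb i).2.
exists (\sum_(i < k) A i * modulus (c i)) => x.
rewrite mulr_suml (le_trans (ler_modulus_sum _ _ _))//; apply: ler_sum => i _.
by rewrite modulusM mulrAC ler_wpM2r ?modulus_ge0.
Qed.

Lemma subspace_coord_sum (k : nat) (c : nat -> K) (z : nat -> Y) j :
  subspace_val (\sum_(i < k) c i *: z i) j =
  \sum_(i < k) c i * subspace_val (z i) j.
Proof.
elim: k => [|k IHk]; first by rewrite !big_ord0.
by rewrite !big_ord_recr subspace_coordD subspace_coordZ; congr (_ + _).
Qed.

(* Gaussian elimination on coordinates gives a spanning family with bounded
   coefficient functionals. *)
Lemma span_representation (m : nat) (y : nat -> Y) :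
  exists (k : nat) (z : nat -> Y) (g : nat -> Y -> K),
    (forall i, bounded_functional (g i)) /\
    forall (c : nat -> K) v, v = \sum_(i < m) c i *: y i ->
      v = \sum_(i < k) g i v *: z i.
Proof.
elim: m => [|m [k [z [g [gb gv]]]]].
  exists 0, (fun=> 0), (fun _ _ => 0); split=> [i|c v ->] /=; last by rewrite !big_ord0.
  by split=> [a x x'|]; [rewrite mulr0 addr0|exists 0 => x; rewrite modulus0 mul0r].
pose res (v : Y) : Y := v - \sum_(i < k) g i v *: z i.
have res_lin a x x' : res (a *: x + x') = a *: res x + res x'.
  rewrite /res; have -> : \sum_(i < k) g i (a *: x + x') *: z i =
      a *: (\sum_(i < k) g i x *: z i) + \sum_(i < k) g i x' *: z i.
    rewrite scaler_sumr -big_split/=; apply: eq_bigr => i _.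
    by rewrite (gb i).1 scalerDl scalerA.
  by rewrite scalerBr opprD addrACA.
have res_y (c : nat -> K) (v : Y) :
    v = \sum_(i < m.+1) c i *: y i -> res v = c m *: res (y m).
  move=> ->; rewrite big_ord_recr/= addrC res_lin [X in _ + X](_ : _ = 0) ?addr0//.
  by apply/eqP; rewrite subr_eq0; apply/eqP/gv.
have [u0|u0] := eqVneq (res (y m)) 0.
  exists k, z, g; split=> // c v /res_y vE; apply/eqP; rewrite -subr_eq0.
  by apply/eqP; rewrite [LHS]vE u0 scaler0.
have [j uj] : exists j, subspace_val (res (y m)) j != 0.
  apply: contrapT => /forallNP H; case/eqP: u0; apply: val_inj; apply: ell_eqP => j.
  by have /negP/negPn/eqP := H j.
set u := res (y m) in u0 uj res_y.
pose h v := subspace_val (res v) j / subspace_val u j.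
have hb : bounded_functional h.
  split=> [a x x'|].
    by rewrite /h res_lin subspace_coordD subspace_coordZ mulrDl mulrA.
  have [_ [A AP]] := bounded_functional_sum k (fun i => subspace_val (z i) j) gb.
  exists ((1 + A) * modulus (subspace_val u j)^-1) => x.
  rewrite /h modulusM mulrAC ler_wpM2r ?modulus_ge0// mulrDl mul1r.
  rewrite /res subspace_coordB (subspace_coord_sum k (fun i => g i x) z j) (le_trans (ler_modulusD _ _))//.
  by rewrite modulusN lerD// subspace_rnorm; exact: modulus_le_rnorm.
exists k.+1, (fun i => if (i < k)%N then z i else u),
  (fun i => if (i < k)%N then g i else h); split=> [i|c v /res_y vE].
  by case: ifP.
rewrite big_ord_recr/= ltnn.
have -> : \sum_(i < k) (if (i < k)%N then g i else h) v *:
    (if (i < k)%N then z i else u) = \sum_(i < k) g i v *: z i.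
  by apply: eq_bigr => i _; rewrite ltn_ord.
have -> : h v = c m.
  by rewrite /h vE subspace_coordZ mulfK.
by rewrite -vE /res addrC subrK.
Qed.

(** [finite_rank] only provides coefficients pointwise; here they become bounded linear functionals
    of [S x], as the estimates for [beta] and for tails demand. *)
Lemma finite_rank_representation (X : normedModType K) (S : bop X Y) :
  finite_rank S -> exists (k : nat) (z : nat -> Y) (g : nat -> Y -> K),
    (forall i, bounded_functional (g i)) /\
    forall x, S x = \sum_(i < k) g i (S x) *: z i.
Proof.
move=> [m [y Sy]]; pose y' i := if insub i is Some i' then y i' else 0.
have [k [z [g [gb gv]]]] := span_representation m y'.
exists k, z, g; split=> // x; have [c ->] := Sy x.
apply: (gv (fun i => if insub i is Some i' then c i' else 0)).
by apply: eq_bigr => i _; rewrite /y' valK.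
Qed.

End finite_rank_representation.

(** Trades [eta ^+ (16 * l)] for [eta ^+ (n + n)] at the cost of the constant [eta ^- 16]. *)
Lemma double_le_div8 n : (n + n <= 16 * (n.-1 %/ 8) + 16)%N.
Proof. have := divn_eq n.-1 8; have := ltn_pmod n.-1 (isT : (0 < 8)%N); lia. Qed.

(** * Identities that are not approximable *)

Section not_approximable.
Variables (R : realType) (s : scalars) (t u : R).
Hypotheses (t1 : 1 <= t) (tu : t < u) (u2 : u < 2).
Local Notation K := (scalar R s).
Local Notation wnorm := (fun m => (word_norm t u m : nat -> (seq bool -> K) -> R)).
Variables (r mu C : R) (cd : coding r size strings (wnorm mu) C).
Hypotheses (r1 : 1 <= r) (mu1 : 1 <= mu) (C1 : 1 <= C).
Variables (r' mu' C' : R) (cd' : coding r' size strings (wnorm mu') C').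
Hypotheses (r1' : 1 <= r') (mu1' : 1 <= mu').
Variable eta : R.
Hypotheses (eta_gt0 : 0 < eta) (eta_lt1 : eta < 1) (mu_eta : mu * eta <= 1).
Hypothesis eta16 : eta ^+ 16 = 2 `^ (u^-1 - t^-1).
Hypothesis mu_lt : mu * 2 `^ (- u^-1) < 1.
Local Notation X := (sz_space cd r1).
Local Notation X' := (sz_space cd' r1').
Local Notation zv := (zv t1 tu cd r1 mu1 C1).
Local Notation beta := (@beta R s t u t1 tu r mu C cd r1 mu1 C1 r' mu' C' cd' r1').
Implicit Types (S : bop X X') (n : nat).

Let t_gt0 : 0 < t. Proof. exact: lt_le_trans ltr01 t1. Qed.
Let u_gt0 : 0 < u. Proof. exact: lt_trans t_gt0 tu. Qed.
Let C_ge0 : 0 <= C. Proof. exact: le_trans C1. Qed.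
Let mu_gt0 : 0 < mu. Proof. exact: lt_le_trans mu1. Qed.

Lemma beta_increment S n : (1 < n)%N ->
  modulus (beta S n.+1) / 2 ^+ n.+2 <= modulus (beta S n) / 2 ^+ n.+1 +
    20 * C * (mu ^+ 3 / eta ^+ 16) * rnorm S * eta ^+ n.
Proof.
move=> n1; have [l lE] : exists l, l = (n.-1 %/ 8)%N by eexists.
have lb a b := @level_sum_bound R s t u t1 tu r mu C cd r1 mu1 C1 r' mu' C' cd'
  r1' mu1' S a b n l n1 lE.
set B := 20 * C * mu ^+ (n + 3) * rnorm S * (2 ^+ l) `^ (u^-1 - t^-1) in lb.
have BE : B <= 20 * C * (mu ^+ 3 / eta ^+ 16) * rnorm S * eta ^+ n.
  rewrite /B; have -> : (2 ^+ l) `^ (u^-1 - t^-1) = eta ^+ (16 * l).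
    rewrite exprM eta16 -[RHS]powR_mulrn ?powR_ge0//.
    have -> : 2 ^+ l = 2 `^ l%:R :> R by rewrite powR_mulrn.
    by rewrite -!powRrM mulrC.
  have h : mu ^+ (n + 3) * eta ^+ (16 * l) <= mu ^+ 3 / eta ^+ 16 * eta ^+ n.
    rewrite mulrAC ler_pdivlMr ?exprn_gt0// -mulrA -exprD.
    apply: (@le_trans _ _ (mu ^+ (n + 3) * eta ^+ (n + n))).
      rewrite ler_wpM2l ?exprn_ge0 ?(ltW mu_gt0)//.
      apply: ler_wiXn2l; rewrite ?(ltW eta_gt0) ?(ltW eta_lt1)//.
      by rewrite lE double_le_div8.
    have -> : mu ^+ (n + 3) * eta ^+ (n + n) = (mu * eta) ^+ n * (mu ^+ 3 * eta ^+ n).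
      by rewrite !exprD exprMn; ring.
    apply: ler_piMl.
      by apply: mulr_ge0; rewrite exprn_ge0// ltW.
    by apply: exprn_ile1 => //; rewrite mulr_ge0// ltW.
  have D0 : 0 <= 20 * C * rnorm S by rewrite !mulr_ge0 ?rnorm_ge0.
  apply: (@le_trans _ _ (20 * C * rnorm S * (mu ^+ (n + 3) * eta ^+ (16 * l)))).
    by rewrite le_eqVlt; apply/orP; left; apply/eqP; ring.
  apply: (le_trans (ler_wpM2l D0 h)).
  by rewrite le_eqVlt; apply/orP; left; apply/eqP; ring.
set E := 20 * C * _ * _ * _ in BE *.
have step : modulus (beta S n.+1) <= 2 * modulus (beta S n) + 4 * (2 ^+ n * E).
  have lS a b : modulus (level_sum t1 tu mu1 C1 S a b n) <= 2 ^+ n * E.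
    by rewrite (le_trans (lb a b))// ler_wpM2l// exprn_ge0.
  have -> : beta S n.+1 = beta S n + beta S n + (beta S n.+1 - 2 * beta S n).
    by ring.
  rewrite beta_step (le_trans (ler_modulusD _ _))//; apply: lerD.
    by rewrite (le_trans (ler_modulusD _ _))//; lra.
  have := ler_modulusD (level_sum t1 tu mu1 C1 S false false n)
    (level_sum t1 tu mu1 C1 S false true n).
  have := ler_modulusD (level_sum t1 tu mu1 C1 S true false n)
    (level_sum t1 tu mu1 C1 S true true n).
  have := lS false false; have := lS false true; have := lS true false.
  have := lS true true => ? ? ? ? ? ?.
  by rewrite (le_trans (ler_modulusD _ _))//; lra.
have p2 : 0 < 2 ^+ n :> R by rewrite exprn_gt0.
rewrite ler_pdivrMr ?exprn_gt0// (le_trans step)// !exprS.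
rewrite le_eqVlt; apply/orP; left; apply/eqP; field.
by rewrite gt_eqF.
Qed.

(** The increments form a geometric series. It starts at level 2, where flips become available;
    there a crude bound by finitely many coordinate functionals suffices. That [D] does not depend
    on [S] is essential for passing to limits of operators. *)
Lemma beta_bounded : exists2 D, 0 <= D & forall S n, (1 < n)%N ->
  modulus (beta S n) <= D * rnorm S * 2 ^+ n.+1.
Proof.
have [A0 A0P] : exists A0, forall S, modulus (beta S 2) <= A0 * rnorm S.
  have /choice[A AP] := @dec_bounded _ _ _ r1' _ _ _ _ _ cd'.
  exists (\sum_(i <- strings 2) (`|A (false :: i)| + `|A (true :: i)|) * rnorm (zv i)).
  move=> S; rewrite mulr_suml (le_trans (ler_modulus_sum _ _ _))//.
  apply: ler_sum => i _; rewrite (le_trans (ler_modulusD _ _))// modulusN.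
  have h j : modulus (image_coord S (zv i) j) <= `|A j| * (rnorm S * rnorm (zv i)).
    rewrite (le_trans (AP _ _))// (le_trans (ler_wpM2r (rnorm_ge0 _) (ler_norm _)))//.
    by rewrite ler_wpM2l// -subspace_rnorm ler_rnorm_bop.
  apply: le_trans (lerD (h _) (h _)) _.
  by rewrite le_eqVlt; apply/orP; left; apply/eqP; ring.
pose E := 20 * C * (mu ^+ 3 / eta ^+ 16).
have E0 : 0 <= E.
  by rewrite !mulr_ge0 ?invr_ge0 ?exprn_ge0 ?(ltW mu_gt0) ?(ltW eta_gt0).
exists (`|A0| + E / (1 - eta)).
  by rewrite addr_ge0// divr_ge0// subr_ge0 ltW.
move=> S n n1; rewrite -ler_pdivrMr ?exprn_gt0//.
have geo k : modulus (beta S k.+2) / 2 ^+ k.+3 <=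
    `|A0| * rnorm S + \sum_(j < k) (E * rnorm S * eta ^+ 2) * eta ^+ j.
  elim: k => [|k IHk].
    rewrite big_ord0 addr0 (le_trans (y := modulus (beta S 2)))//.
      by rewrite ler_piMr ?modulus_ge0// invf_le1 ?exprn_gt0// exprn_ege1// ler1n.
    by rewrite (le_trans (A0P S))// ler_wpM2r ?rnorm_ge0// ler_norm.
  apply: (le_trans (beta_increment S _)) => //.
  rewrite big_ord_recr/= addrA; apply: lerD => //.
  by rewrite -[(E * _ * _ * _)]mulrA -exprD.
case: n n1 => [|[|k]] // _; apply: (le_trans (geo k)).
rewrite mulrDl lerD2l.
have F0 : 0 <= E * rnorm S * eta ^+ 2.
  by rewrite mulr_ge0 ?exprn_ge0 ?(ltW eta_gt0)// mulr_ge0 ?rnorm_ge0.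
apply: (le_trans (geometric_sum (ltW eta_gt0) eta_lt1 k F0)).
rewrite [leRHS]mulrAC ler_pM2r ?invr_gt0 ?subr_gt0//.
apply: ler_piMr; first by rewrite mulr_ge0 ?rnorm_ge0.
by apply: exprn_ile1; exact: ltW.
Qed.

Lemma sum_dec_bound (y : X') n :
  \sum_(j <- strings n) modulus (dec cd' (subspace_val y) j) <=
  2 * (2 ^+ n) `^ (1 - u^-1) * rnorm y.
Proof.
rewrite -natrX -size_strings; apply: sum_le_power_mean.
- exact: le_trans t1 (ltW tu).
- by move=> j; exact: modulus_ge0.
- exact: rnorm_ge0.
have := @powsum_le_mixed_sum R s t u _ _ block t1 (ltW tu) (strings n)
  (dec cd' (subspace_val y)).
move=> H; apply: le_trans H _.
have := nrm_dec_le n (sz_gap y); rewrite /word_norm -subspace_rnorm.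
set m := mixed_sum _ _ _ _ _ => H.
have m0 : 0 <= m by exact: mixed_sum_ge0.
have -> : m `^ (u / t) = (m `^ t^-1) `^ u by rewrite -powRrM mulrC.
apply: ge0_ler_powR; rewrite ?nnegrE ?powR_ge0 ?rnorm_ge0 ?(ltW u_gt0)//.
apply: le_trans H; rewrite ler_peMl ?powR_ge0//.
exact: exprn_ege1.
Qed.

(** Testing a fixed vector against a whole level costs only [2 ^ (n * (1 - 1 / u))] by
    [sum_dec_bound], and the [zv i] grow like [mu ^ n]; the product is small against [2 ^ n] because
    [mu * 2 ^ (- 1 / u) < 1]. *)
Lemma beta_finite_rank S (e : R) : finite_rank S -> 0 < e ->
  exists2 n, (1 < n)%N & modulus (beta S n) <= e * 2 ^+ n.+1.
Proof.
move=> /finite_rank_representation[k [z [g [gb Sg]]]] e0.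
have /choice[A AP] : forall i, exists A, forall x, modulus (g i x) <= A * rnorm x.
  by move=> i; exact: (gb i).2.
pose Q := \sum_(l < k) `|A l| * (rnorm S * 6 * C) * (2 * rnorm (z l)).
have Q0 : 0 <= Q.
  by apply: sumr_ge0 => l _; rewrite !mulr_ge0 ?rnorm_ge0.
have Sbound n : modulus (beta S n) <=
    Q * mu ^+ (n + 3) * (2 ^+ n.+1) `^ (1 - u^-1).
  have coordE i j : image_coord S (zv i) j =
      \sum_(l < k) g l (S (zv i)) * dec cd' (subspace_val (z l)) j.
    rewrite /image_coord {1}Sg.
    exact: (dec_sum _ (fun l : 'I_k => g l (S (zv i))) (fun l => z l)).
  apply: (@le_trans _ _ (\sum_(i <- strings n) \sum_(l < k)
      (`|A l| * (rnorm S * (6 * (C * mu ^+ (n + 3))))) *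
      (modulus (dec cd' (subspace_val (z l)) (false :: i)) +
       modulus (dec cd' (subspace_val (z l)) (true :: i))))).
    rewrite (le_trans (ler_modulus_sum _ _ _))// !big_seq; apply: ler_sum => i.
    rewrite mem_strings => /eqP ni; rewrite !coordE -sumrB.
    rewrite (le_trans (ler_modulus_sum _ _ _))//; apply: ler_sum => l _.
    rewrite -mulrBr modulusM; apply: ler_pM; rewrite ?modulus_ge0//; last first.
      by rewrite (le_trans (ler_modulusD _ _))// modulusN.
    rewrite (le_trans (AP _ _))// (le_trans (ler_wpM2r (rnorm_ge0 _) (ler_norm _)))//.
    rewrite ler_wpM2l// (le_trans (ler_rnorm_bop _ _))// ler_wpM2l ?rnorm_ge0//.
    by have := rnorm_zv t1 tu cd r1 mu1 C1 i; rewrite ni.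
  rewrite exchange_big/= /Q !mulr_suml; apply: ler_sum => l _.
  rewrite -mulr_sumr -(big_strings n (fun j => modulus (dec cd' (subspace_val (z l)) j))).
  have c0 : 0 <= `|A l| * (rnorm S * (6 * (C * mu ^+ (n + 3)))).
    by rewrite !mulr_ge0 ?rnorm_ge0// exprn_ge0// ltW.
  apply: (le_trans (ler_wpM2l c0 (sum_dec_bound (z l) n.+1))).
  by rewrite le_eqVlt; apply/orP; left; apply/eqP; ring.
have lam0 : 0 <= mu * 2 `^ (- u^-1) by rewrite mulr_ge0 ?powR_ge0// ltW.
have [m me] := geometric_small lam0 mu_lt (Q * mu ^+ 2) e0.
exists m.+2 => //; apply: (le_trans (Sbound _)).
have p0 : 0 < 2 ^+ m.+3 :> R by rewrite exprn_gt0.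
have -> : (2 ^+ m.+3) `^ (1 - u^-1) = 2 ^+ m.+3 * (2 `^ (- u^-1)) ^+ m.+3 :> R.
  rewrite powRD ?(gt_eqF p0) ?implybT// powRr1 ?(ltW p0)//; congr (_ * _).
  rewrite -[RHS]powR_mulrn ?powR_ge0//.
  have -> : 2 ^+ m.+3 = 2 `^ m.+3%:R :> R by rewrite powR_mulrn.
  by rewrite -!powRrM mulrC.
rewrite mulrCA mulrC ler_pM2r//; apply: le_trans me.
have -> : (m.+2 + 3 = 2 + m.+3)%N by rewrite addnC.
apply: (@le_trans _ _ (Q * mu ^+ 2 * (mu * 2 `^ (- u^-1)) ^+ m.+3)).
  by rewrite le_eqVlt; apply/orP; left; apply/eqP; rewrite exprD exprMn; ring.
apply: ler_wpM2l; first by rewrite mulr_ge0// exprn_ge0// ltW.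
by apply: ler_wiXn2l => //; [exact: ltW|do 3!apply: leqW].
Qed.

(** The exponents [r], [r'] enter only through the codings, so this serves operators from [l^p] to
    [l^q] as well as operators within [l^p]. *)
Theorem identity_not_approximable (J : bop X X') :
  (forall x j, image_coord J x j = dec cd (subspace_val x) j) ->
  ~ approximable_ops X X' J.
Proof.
move=> JE /closure_rnormP; have [D D0 DP] := beta_bounded.
(* A finite rank [S] this close to [J] would give [1 <= 1 / 4 + 1 / 4] for the normalized traces:
   the first quarter bounds [J - S], the second [S] itself. *)
have e0 : 0 < (4 * (D + 1))^-1 by rewrite invr_gt0 mulr_gt0// ltr_wpDl.
move=> /(_ _ e0)[S fS JS].
have [n n1 Sn] := beta_finite_rank fS (e := 4^-1) ltac:(by rewrite invr_gt0).
have bJ : beta J n = of_real s (2 ^+ n.+1).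
  rewrite of_real_expr2 /beta.
  under eq_bigr do rewrite !JE !dec_zv !z_vec_coord /=.
  rewrite big_const_seq count_predT iter_addr addr0 size_strings.
  by rewrite opprK expnSr natrM mulr_natl.
have bB : beta J n = beta (J - S) n + beta S n.
  rewrite /beta -big_split/=; apply: eq_bigr => i _.
  have h j : image_coord (J - S) (zv i) j =
      image_coord J (zv i) j - image_coord S (zv i) j.
    rewrite /image_coord bopBE addrC -scaleN1r sz_dec_lin.
    by rewrite mulN1r addrC.
  by rewrite !h; ring.
have := ler_modulusD (beta (J - S) n) (beta S n).
rewrite -bB bJ modulus_of_real ?exprn_ge0//.
have p0 : 0 < 2 ^+ n.+1 :> R by rewrite exprn_gt0.
have H1 : modulus (beta (J - S) n) <= 4^-1 * 2 ^+ n.+1.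
  rewrite (le_trans (DP _ _ n1))// ler_wpM2r ?(ltW p0)//.
  apply: (@le_trans _ _ (D * (4 * (D + 1))^-1)); first by rewrite ler_wpM2l// ltW.
  rewrite invfM mulrCA ler_piMr ?invr_ge0// ler_pdivrMr ?ltr_wpDl//.
  by rewrite mul1r lerDl.
move: Sn H1; lra.
Qed.

End not_approximable.

(** Passing from weight [mu] to [mu'] multiplies the norm of level [n] by [(mu' / mu) ^ n]. This
    decay supplies boundedness despite the loss between lower and upper estimates, as well as
    uniform tails. *)
Lemma identity_compact (R : realType) (s : scalars) (t u : R)
    (r mu C : R) (cd : coding r size strings (word_norm t u mu : nat -> (seq bool -> scalar R s) -> R) C)
    (r1 : 1 <= r)
    (r' mu' C' : R) (cd' : coding r' size strings (word_norm t u mu' : nat -> (seq bool -> scalar R s) -> R) C')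
    (r1' : 1 <= r') :
  1 <= t -> t < u -> 0 < mu' -> mu' < mu ->
  exists2 J : bop (sz_space cd r1) (sz_space cd' r1'), compact_op J &
    forall x j, image_coord J x j = dec cd (subspace_val x) j.
Proof.
move=> t1 tu mu'0 mu'mu; have mu0 : 0 < mu by exact: lt_trans mu'mu.
pose lam := mu' / mu.
have lam0 : 0 <= lam by rewrite divr_ge0// ltW.
have lam1 : lam < 1 by rewrite ltr_pdivrMr// mul1r.
pose f (x : sz_space cd r1) := enc cd' (dec cd (subspace_val x)).
have f_nrm (x : sz_space cd r1) n :
    word_norm t u mu' n (dec cd (subspace_val x)) <= rnorm x * lam ^+ n.
  have := nrm_dec_le n (sz_gap x); rewrite -subspace_rnorm => H.
  have -> : word_norm t u mu' n (dec cd (subspace_val x)) =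
      word_norm t u mu n (dec cd (subspace_val x)) * lam ^+ n.
    rewrite /word_norm /lam exprMn exprVn; field.
    by rewrite expf_neq0// gt_eqF.
  by rewrite ler_wpM2r// exprn_ge0.
have [J JE] : exists J : bop (sz_space cd r1) (sz_space cd' r1'),
    forall x i, subspace_val (J x) i = f x i.
  apply: (@bop_into_subspace _ _ _ _ _ _ _ (C' / (1 - lam))).
  - move=> a x y i; rewrite -enc_lin; congr (enc cd' _ i).
    by apply/funext => j; rewrite sz_dec_lin.
  - move=> x; have := enc_upper_geometric cd' lam0 lam1 (rnorm_ge0 x) (f_nrm x).
    by rewrite mulrCA mulrC -mulrA [_ * rnorm x]mulrC mulrA.
  - by move=> x e ex; apply: (enc_in_sz _ ex) => i; exact: sz_relation.
exists J.
  apply: uniform_tails_compact => e e0.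
  have [m mP] := enc_uniform_tails r1' mem_strings (word_norm_local (s := s) t u mu')
    (word_norm0 s t1 tu mu') cd' lam0 lam1 ler01 e0.
  exists m => x x1; have -> : subspace_val (J x) = f x :> (nat -> scalar R s).
    by apply/funext => i; rewrite JE.
  apply: mP => n; apply: (le_trans (f_nrm x n)).
  by rewrite ler_wpM2r// exprn_ge0.
move=> x j; rewrite /image_coord.
have -> : subspace_val (J x) = f x :> (nat -> scalar R s).
  by apply/funext => i; rewrite JE.
exact: encK.
Qed.

(** [mu0] is [eta^-1], the largest weight that [eta] absorbs. The last inequality amounts to
    [(1 / t - 1 / u) / 16 < 1 / u], clear from [1 / t <= 1] and [1 / u > 1 / 2]. *)
Lemma weight_parameters (R : realType) (t u : R) : 1 <= t -> t < u -> u < 2 ->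
  exists eta mu0 : R, [/\ 0 < eta < 1, 1 < mu0,
    eta ^+ 16 = 2 `^ (u^-1 - t^-1) &
    forall mu, 0 <= mu -> mu <= mu0 -> mu * eta <= 1 /\ mu * 2 `^ (- u^-1) < 1].
Proof.
move=> t1 tu u2; have t0 : 0 < t by exact: lt_le_trans t1.
have u0 : 0 < u by exact: lt_trans tu.
have tu' : u^-1 < t^-1 by rewrite ltf_pV2 ?posrE.
have t1' : t^-1 <= 1 by rewrite invf_le1.
have u2' : 2^-1 < u^-1 by rewrite ltf_pV2 ?posrE.
pose e := (u^-1 - t^-1) / 16; pose eta : R := 2 `^ e.
have e0 : e < 0 by rewrite /e; lra.
have eta0 : 0 < eta by exact: powR_gt0.
have eta1 : eta < 1 by rewrite -(powRr0 2); exact: ltr2_powR.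
exists eta, eta^-1; split.
- by rewrite eta0.
- by rewrite invf_gt1.
- by rewrite -powR_mulrn ?ltW// -powRrM /e divfK.
move=> mu mu0 mue; split; first by rewrite -ler_pdivlMr// div1r.
apply: (@le_lt_trans _ _ (eta^-1 * 2 `^ (- u^-1))).
  by rewrite ler_wpM2r ?powR_ge0.
rewrite /eta -powRN -powRD ?pnatr_eq0 ?implybT// -[ltRHS](powRr0 2).
by apply: ltr2_powR; rewrite /e; lra.
Qed.

(** * Compactness of approximable operators and strictness of the inclusion *)

Lemma ell_enorm_sum_le (R : realType) (s : scalars) (r : R) (k : nat)
    (c : nat -> scalar R s) (z : nat -> nat -> scalar R s) (B : R) : 1 <= r ->
  (forall l, (l < k)%N -> (ell_enorm r (z l) <= B%:E)%E) ->
  (ell_enorm r (fun i => (\sum_(l < k) c l * z l i)%R) <=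
    (\sum_(l < k) modulus (c l) * B)%:E)%E.
Proof.
move=> r1; elim: k => [|k IHk] zB.
  rewrite big_ord0; have -> : (fun i => \sum_(l < 0) c l * z l i) =
      (0 : nat -> (scalar R s)^o) by apply/funext => i; rewrite big_ord0.
  by rewrite ell_enorm0.
rewrite big_ord_recr/=; apply: (@ell_enorm_addle R s r r1
  (fun i => \sum_(l < k) c l * z l i) (fun i => c k * z k i)).
- by move=> i; rewrite big_ord_recr.
- by apply: IHk => l lk; apply: zB; exact: ltnW.
- rewrite ell_enorm_scale// EFinM; apply: lee_wpmul2l.
    by rewrite lee_fin modulus_ge0.
  exact: zB.
Qed.

Lemma finite_rank_compact (R : realType) (s : scalars) (r : R) (r1 : 1 <= r)
    (X : normedModType (scalar R s)) (Y : closedSubspace (ell s r1)) (S : bop X Y) :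
  finite_rank S -> compact_op S.
Proof.
move=> /finite_rank_representation[k [z [g [gb Sg]]]].
have /choice[A AP] : forall i, exists A, forall x, modulus (g i x) <= A * rnorm x.
  by move=> i; exact: (gb i).2.
apply: uniform_tails_compact => e e0.
pose M := \sum_(l < k) `|A l| * rnorm S.
have M0 : 0 <= M by apply: sumr_ge0 => l _; rewrite mulr_ge0 ?rnorm_ge0.
have d0 : 0 < e / (M + 1) by rewrite divr_gt0// ltr_wpDl.
have [n nP] : exists n, forall l, (l < k)%N ->
    (ell_enorm r (restrict_seq (leq n) (subspace_val (z l))) <= (e / (M + 1))%:E)%E.
  have /choice[n nP] : forall l, exists n, (ell_enorm r
      (restrict_seq (leq n) (subspace_val (z l))) <= (e / (M + 1))%:E)%E.
    by move=> l; exact: ell_tail_cvg0.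
  exists (\max_(l < k) n l) => l lk; apply: le_trans (nP l).
  apply: le_ell_enorm => // i; rewrite /restrict_seq; case: leqP => ni.
    by rewrite (leq_trans (leq_bigmax (Ordinal lk)) ni).
  by rewrite modulus0 modulus_ge0.
exists n => x x1.
have -> : restrict_seq (leq n) (subspace_val (S x)) =
    (fun i => \sum_(l < k) g l (S x) * restrict_seq (leq n) (subspace_val (z l)) i).
  apply/funext => i; rewrite /restrict_seq; case: (n <= i)%N; last first.
    by rewrite big1// => l _; rewrite mulr0.
  by rewrite {1}Sg (subspace_coord_sum k (fun l => g l (S x)) z).
have H := @ell_enorm_sum_le R s r k (fun l => g l (S x))
  (fun l => restrict_seq (leq n) (subspace_val (z l))) _ r1 nP.
apply: (le_trans H); clear H.
rewrite lee_fin -mulr_suml.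
have gM : \sum_(l < k) modulus (g l (S x)) <= M.
  apply: ler_sum => l _; apply: (le_trans (AP _ _)).
  apply: (le_trans (ler_wpM2r (rnorm_ge0 _) (ler_norm _))).
  rewrite ler_wpM2l// (le_trans (ler_rnorm_bop _ _))//.
  by rewrite ler_piMr// rnorm_ge0.
apply: (le_trans (ler_wpM2r (ltW d0) gM)).
by rewrite mulrCA ler_piMr ?(ltW e0)// ler_pdivrMr ?ltr_wpDl// mul1r lerDl.
Qed.

Lemma approximable_sub_compact (R : realType) (s : scalars) (r : R) (r1 : 1 <= r)
    (X : normedModType (scalar R s)) (Y : closedSubspace (ell s r1)) :
  approximable_ops X Y `<=` compact_ops X Y.
Proof.
move=> T TA; apply: compact_ops_closed; move: TA; apply: closureS => S.
exact: finite_rank_compact.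
Qed.

Lemma exists_not_approximable (R : realType) (s : scalars) (p q : R)
    (p1 : 1 <= p) (q1 : 1 <= q) : p < 2 -> q < 2 ->
  exists (X : closedSubspace (ell s p1)) (Y : closedSubspace (ell s q1)),
    approximable_ops X Y `<` compact_ops X Y.
Proof.
(* Codings exist in [l^r] for [r <= t], so [t] must dominate both exponents; [u] is any number
   strictly between [t] and 2. Below, the domain has weight [mu0 > 1] and the target weight 1. *)
move=> p2 q2; pose t := Num.max p q; pose u := (t + 2) / 2.
have t1 : 1 <= t by rewrite le_max p1.
have t2 : t < 2 by rewrite gt_max p2.
have tu : t < u by rewrite /u; lra.
have u2 : u < 2 by rewrite /u; lra.
have [eta [mu0 [/andP[eta0 eta1] mu01 eta16 muP]]] := weight_parameters t1 tu u2.
have pt : p <= t by rewrite le_max lexx.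
have qt : q <= t by rewrite le_max lexx orbT.
have mu00 : 0 < mu0 by exact: lt_trans mu01.
have [C C1 /(_ mu0 mu00)[cd]] := word_coding_exists s t1 tu u2 p1 pt.
have [C' C1' /(_ 1 ltr01)[cd']] := word_coding_exists s t1 tu u2 q1 qt.
have [J cJ JE] := identity_compact cd p1 cd' q1 t1 tu ltr01 mu01.
have [mue mul] := muP mu0 (ltW mu00) (lexx _).
exists (sz_space cd p1), (sz_space cd' q1); split.
  exact: approximable_sub_compact.
move=> /(_ J cJ).
exact: (identity_not_approximable t1 tu (ltW mu01) C1 (lexx _) eta0 eta1 mue eta16 mul JE).
Qed.

(** * Countable direct sums and the quotient algebra *)

Section countable_sum.
Variables (R : realType) (s : scalars) (r : R) (r1 : 1 <= r).
Local Notation K := (scalar R s).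
Local Notation ell := (ell s r1).

(** [ocancel] makes [g] injective where it is defined, so every coordinate of [y] is used at most
    once. *)
Lemma ell_enorm_reindex (g : nat -> option nat) (h : nat -> nat) (y : nat -> K) :
  ocancel g h -> (ell_enorm r (fun i => oapp y 0%R (g i)) <= ell_enorm r y)%E.
Proof.
move=> gh; have [y_fin|y_inf] := ltP (ell_enorm r y) +oo%E; last first.
  by apply: le_trans y_inf; rewrite leey.
have yE : ell_enorm r y = (fine (ell_enorm r y))%:E.
  by rewrite fineK// ge0_fin_numE// ell_enorm_ge0.
have y0 : 0 <= fine (ell_enorm r y) by rewrite fine_ge0// ell_enorm_ge0.
rewrite yE; apply: (ell_enorm_le r1 y0) => n.
apply: le_trans (powsum_le_ell_enorm r1 (l := pmap g (iota 0 n)) y0 _ _); last first.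
- by rewrite -yE.
- by apply: (pmap_uniq gh); exact: iota_uniq.
rewrite -(big_mkord xpredT (fun i => modulus (oapp y 0 (g i)) `^ r)).
rewrite /powsum /index_iota subn0.
elim: (iota 0 n) => [|i l IHl]; first by rewrite !big_nil.
rewrite big_cons/=; case: (g i) => [j|]/=; first by rewrite big_cons lerD2l.
by rewrite modulus0 powR0 ?add0r// gt_eqF// (lt_le_trans ltr01).
Qed.

(** Reading the [k]-th block and inserting into it are both partial reindexings; the former is total
    but has an option type so that [reindex] covers both. *)
Definition nth_block (k i : nat) : option nat := Some (pickle (k, i)).
Definition block_nth (k n : nat) : option nat :=
  if @pickle_inv (nat * nat)%type n is Some (l, i) then
    if l == k then Some i else None
  else None.

Lemma nth_blockK k : ocancel (nth_block k)
  (fun n => oapp snd 0%N (@pickle_inv (nat * nat)%type n)).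
Proof. by move=> i; rewrite /= pickleK_inv. Qed.

Lemma block_nthK k : ocancel (block_nth k) (fun i => pickle (k, i)).
Proof.
move=> n; rewrite /block_nth.
have := @pickle_invK (nat * nat)%type n; case: pickle_inv => [[l i]|]//=.
by case: eqVneq => // ->.
Qed.

Lemma block_nth_pickle k l i :
  block_nth k (pickle (l, i)) = if l == k then Some i else None.
Proof. by rewrite /block_nth pickleK_inv. Qed.

Definition reindex (g : nat -> option nat) (y : nat -> K^o) : nat -> K^o :=
  fun i => oapp y 0 (g i).

Lemma reindex_linear g : linear (reindex g).
Proof.
move=> a x y; apply/funext => i.
rewrite -[RHS]/(a *: reindex g x i + reindex g y i) /reindex.
by case: (g i) => [j|]//=; rewrite scaler0 addr0.
Qed.

Definition coord_block k : bop ell ell := ell_map r1 (reindex_linear (nth_block k))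
  (fun y => ell_enorm_reindex y (@nth_blockK k)).
Definition embed_block k : bop ell ell := ell_map r1 (reindex_linear (block_nth k))
  (fun y => ell_enorm_reindex y (@block_nthK k)).

Lemma block_embed k l y :
  coord_block l (embed_block k y) = if l == k then y else 0.
Proof.
apply/val_inj/funext => i; rewrite /= /reindex/= block_nth_pickle.
by case: eqP.
Qed.

Variable X_ : nat -> closedSubspace ell.

Definition csum_pred : {pred ell} :=
  mem [set y | forall k, coord_block k y \in subspace_pred (X_ k)].

Lemma csum_submod : GRing.submod_closed csum_pred.
Proof.
split=> [|a x y]; rewrite !inE.
  by move=> k; rewrite linear0 (subspace_submod (X_ k)).1.
move=> xX yX k; rewrite linearP.
by apply: (subspace_submod (X_ k)).2; [exact: xX|exact: yX].
Qed.

Lemma csum_closed : closed [set y | y \in csum_pred].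
Proof.
have -> : [set y | y \in csum_pred] =
    \bigcap_k (coord_block k @^-1` [set y | y \in subspace_pred (X_ k)]).
  apply/seteqP; split=> y /=; rewrite inE; first by move=> yX k _; exact: yX.
  by move=> yX k; exact: yX.
apply: closed_bigI => k _; apply: preimage_closed => [z _|].
- exact: bop_continuous.
- exact: subspace_closed.
Qed.

(** Serves as the [l^r]-sum of the [X_ k]. Positions that are not of the form [pickle (k, i)], if
    any, are left unconstrained; this does not affect the maps between the sum and its blocks. *)
Definition csum := ClosedSubspace csum_submod csum_closed.

Fact csum_coord_subproof k y :
  y \in subspace_pred csum -> coord_block k y \in subspace_pred (X_ k).
Proof. by rewrite inE; exact. Qed.

Fact csum_inj_subproof k y :
  y \in subspace_pred (X_ k) -> embed_block k y \in subspace_pred csum.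
Proof.
move=> yX; rewrite inE => l; rewrite block_embed.
by case: eqP => [->//|_]; rewrite (subspace_submod (X_ l)).1.
Qed.

Definition csum_coord k : bop csum (X_ k) := bop_restrict (@csum_coord_subproof k).
Definition csum_inj k : bop (X_ k) csum := bop_restrict (@csum_inj_subproof k).

Lemma csum_injK k x : csum_coord k (csum_inj k x) = x.
Proof. by apply: val_inj; rewrite [LHS](block_embed k k (subspace_val x)) eqxx. Qed.

Lemma csum_inj0 k l x : l != k -> csum_coord l (csum_inj k x) = 0.
Proof. by move=> lk; apply: val_inj; rewrite [LHS](block_embed k l (subspace_val x)) (negPf lk). Qed.

End countable_sum.

(** * Shifts on the direct sum and their classes modulo approximable operators *)

Section shifts.
Variables (R : realType) (s : scalars) (p q : R) (p1 : 1 <= p) (q1 : 1 <= q).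
Local Notation K := (scalar R s).
Variables (X_ : nat -> closedSubspace (ell s p1)) (T : Type).
(** Stands for decoding to families on words: a map commuting with [D] is an identity in disguise,
    and no such map is approximable. *)
Variable D : forall k, X_ k -> T -> K.
Arguments D : clear implicits.
Variable J : forall k, bop (X_ k) (X_ k.+1).
Hypothesis J_KS : forall k, KS_ops q1 _ _ (J k).
Hypothesis D_J : forall k x j, D k.+1 (J k x) j = D k x j.
Hypothesis D_approx : forall k l (V : bop (X_ k) (X_ l)),
  (forall x j, D l (V x) j = D k x j) -> ~ approximable_ops _ _ V.

Local Notation X := (csum X_).
Local Notation A := (subalgebra_of (KS_closure q1 X)).
Local Notation pi := (\pi_(KS_quotient q1 X)%qT : A -> KS_quotient q1 X).

Definition shift_op k : bop X X :=
  bop_comp (csum_inj X_ k.+1) (bop_comp (J k) (csum_coord X_ k)).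

Fact shift_subproof k : shift_op k \in subalgebra_pred (KS_closure q1 X).
Proof. by rewrite inE; apply: subset_closure; exact/KS_compl/KS_compr. Qed.

Definition shift k : A := SubalgebraOf (shift_subproof k).

Lemma shift_inj k x : subalgebra_val (shift k) (csum_inj X_ k x) = csum_inj X_ k.+1 (J k x).
Proof. by rewrite -[in RHS](csum_injK x). Qed.

Lemma shift_inj0 k l x : l != k -> subalgebra_val (shift l) (csum_inj X_ k x) = 0.
Proof.
move=> lk; rewrite -[LHS]/(csum_inj X_ l.+1 (J l (csum_coord X_ l (csum_inj X_ k x)))).
by rewrite csum_inj0// !linear0.
Qed.

Let pi_0 : pi 0 = 0. Proof. exact: (raddf0 \pi_(KS_quotient q1 X)%qT). Qed.

Lemma pi_eq0 (W : A) : pi W = 0 -> approximable_ops X X (subalgebra_val W).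
Proof.
move=> W0; have : W - 0 \in ideal_pred (approximable_ideal q1 X).
  by apply/pi_eqP; rewrite [LHS]W0; exact/esym/pi_0.
by rewrite subr0 !inE.
Qed.

Lemma approximable_corner k l a (W : bop X X) : approximable_ops X X W ->
  approximable_ops (X_ k) (X_ l)
    (bop_comp (csum_coord X_ l) (bop_comp W (a *: csum_inj X_ k))).
Proof.
move=> WA; apply: closure_compl (closure_compr (B := [set V | finite_rank V]) _ WA).
- by move=> U; exact: finite_rank_compl.
- by move=> U; exact: finite_rank_compr.
Qed.

(** [foldl] multiplies on the right and products are compositions, so the list is reversed to let
    [shift 0] act first. Only the action on the block [X_ 0] is followed, where every product
    remains an identity in decoded coordinates. *)
Lemma foldl_shifts l m (W : A) :
  (forall x j, D l (csum_coord X_ l (subalgebra_val W (csum_inj X_ m x))) j = D m x j) ->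
  exists2 V : A,
    foldl amul (pi W) (rev (mkseq (fun k => pi (shift k)) m)) = pi V &
    forall x j, D l (csum_coord X_ l (subalgebra_val V (csum_inj X_ 0 x))) j = D 0 x j.
Proof.
elim: m W => [|m IHm] W WD; first by exists W.
rewrite mkseqS rev_rcons/= -[amul _ _]pi_mul; apply: IHm => x j.
rewrite -[LHS]/(D l (csum_coord X_ l
  (subalgebra_val W (subalgebra_val (shift m) (csum_inj X_ m x)))) j).
by rewrite shift_inj WD D_J.
Qed.

Lemma shifts_not_nilpotent : ~ nilpotent_algebra (KS_quotient q1 X).
Proof.
move=> [m nil].
have sz : size (rev (mkseq (fun k => pi (shift k)) m)) == m.
  by rewrite size_rev size_mkseq.
have [x j|V VE VD] := @foldl_shifts m.+1 m (shift m).
  by rewrite shift_inj csum_injK D_J.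
have := nil (pi (shift m)) (Tuple sz); rewrite /= VE => /pi_eq0.
move=> /(@approximable_corner 0 m.+1 1); apply: D_approx => x j.
by rewrite /= scale1r VD.
Qed.

Lemma left_kernel_row (m n : nat) (M : 'M[K]_(m, n)) : (n < m)%N ->
  exists2 a : 'rV[K]_m, a != 0 & a *m M = 0.
Proof.
move=> nm; have : kermx M != 0.
  rewrite -mxrank_eq0 mxrank_ker subn_eq0 -ltnNge.
  exact: leq_ltn_trans (rank_leq_col M) nm.
by move=> /rowV0Pn[a /sub_kermxP aM a0]; exists a.
Qed.

(** If [n] elements spanned, [n.+1] shifts would satisfy a nontrivial relation modulo approximable
    operators. The corner from block [k0] to [k0.+1] sees only [shift k0], so it would make [J k0]
    approximable. *)
Lemma shifts_not_finite_dimensional : ~ finite_dimensional (KS_quotient q1 X).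
Proof.
move=> [n [e eP]].
have /choice[c cP] := fun k : 'I_n.+1 => eP (pi (shift k)).
have [a a0 aM] := left_kernel_row (\matrix_(k, i) c k i) (ltnSn n).
have [k0 ak0] : exists k, a 0 k != 0.
  apply/existsP; apply: contraR a0 => /existsPn a0.
  apply/eqP/rowP => k; rewrite mxE; exact/eqP/negPn/a0.
pose W : A := \sum_k a 0 k *: shift k.
have W0 : pi W = 0.
  rewrite /W (big_morph pi (@pi_add _ _ _) pi_0).
  rewrite (eq_bigr (fun k => \sum_i (a 0 k * c k i) *: e i)) => [|k _]; last first.
    rewrite [LHS]pi_scale -[LHS]/(a 0 k *: pi (shift k)) cP scaler_sumr.
    by apply: eq_bigr => i _; rewrite scalerA.
  rewrite exchange_big big1// => i _.
  rewrite -scaler_suml; have /rowP/(_ i) := aM; rewrite !mxE.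
  by under eq_bigr do rewrite mxE; move=> ->; rewrite scale0r.
have := @approximable_corner k0 k0.+1 (a 0 k0)^-1 _ (pi_eq0 W0).
apply: D_approx => x j.
have -> : bop_comp (csum_coord X_ k0.+1) (bop_comp (subalgebra_val W)
    ((a 0 k0)^-1 *: csum_inj X_ k0)) x = J k0 x; last exact: D_J.
rewrite -[LHS]/(csum_coord X_ k0.+1 (subalgebra_val W ((a 0 k0)^-1 *: csum_inj X_ k0 x))).
have WE : subalgebra_val W (csum_inj X_ k0 x) = a 0 k0 *: csum_inj X_ k0.+1 (J k0 x).
  rewrite /W (big_morph (fun V : A => subalgebra_val V (csum_inj X_ k0 x)) (id1 := 0) (op1 := +%R))//.
  rewrite (bigD1 k0)//= big1 ?addr0 => [|k kk0].
    by rewrite -[LHS]/(a 0 k0 *: subalgebra_val (shift k0) (csum_inj X_ k0 x)) shift_inj.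
  rewrite -[LHS]/(a 0 k *: subalgebra_val (shift k) (csum_inj X_ k0 x)).
  by rewrite shift_inj0 ?scaler0.
have -> : subalgebra_val W ((a 0 k0)^-1 *: csum_inj X_ k0 x) = csum_inj X_ k0.+1 (J k0 x).
  rewrite [LHS]linearZ -[LHS]/((a 0 k0)^-1 *: subalgebra_val W (csum_inj X_ k0 x)).
  by rewrite WE scalerA mulVf// scale1r.
exact: csum_injK.
Qed.

End shifts.

Lemma exists_non_nilpotent_quotient (R : realType) (s : scalars) (p q : R)
    (p1 : 1 <= p) (q1 : 1 <= q) : p < q -> q < 2 ->
  exists X : closedSubspace (ell s p1),
    ~ nilpotent_algebra (KS_quotient q1 X) /\
    ~ finite_dimensional (KS_quotient q1 X).
Proof.
move=> pq q2; pose u := (q + 2) / 2.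
have qu : q < u by rewrite /u; lra.
have u2 : u < 2 by rewrite /u; lra.
have [eta [mu0 [/andP[eta0 eta1] mu01 eta16 muP]]] := weight_parameters q1 qu u2.
(* Strictly decreasing, yet always between 1 and [mu0]: infinitely many successive identities are
   compact while every weight stays admissible. Even indices serve the [X_ k] in [l^p], odd ones the
   spaces of [l^q] inserted between them. *)
pose w (j : nat) : R := 1 + (mu0 - 1) / j.+1%:R.
have mu00 : 0 < mu0 - 1 by rewrite subr_gt0.
have w1 j : 1 <= w j by rewrite lerDl divr_ge0// ltW.
have w0 j : 0 < w j by exact: lt_le_trans (w1 j).
have wS j : w j.+1 < w j.
  by rewrite ltrD2l ltr_pM2l// ltf_pV2 ?posrE// ltr_nat.
have w_le j : w j <= mu0.
  rewrite -lerBrDl ler_pdivrMr// ler_peMr ?(ltW mu00)//.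
  by rewrite ler1n.
have [C C1 cdP] := word_coding_exists s q1 qu u2 p1 (ltW pq).
have [C' C1' cdQ] := word_coding_exists s q1 qu u2 q1 (lexx q).
have cd k := inhabited_witness (cdP _ (w0 k.*2)).
have cd' k := inhabited_witness (cdQ _ (w0 k.*2.+1)).
pose X_ k := sz_space (cd k) p1.
pose D k (x : X_ k) := dec (cd k) (subspace_val x).
have JE : forall k, exists J : bop (X_ k) (X_ k.+1),
    KS_ops q1 _ _ J /\ forall x j, D k.+1 (J x) j = D k x j.
  move=> k.
  have [A cA AE] := identity_compact (cd k) p1 (cd' k) q1 q1 qu (w0 _) (wS _).
  have [B cB BE] := identity_compact (cd' k) q1 (cd k.+1) p1 q1 qu (w0 _) (wS _).
  exists (bop_comp B A); split=> [|x j]; last exact: etrans (BE _ j) (AE x j).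
  by exists (sz_space (cd' k) q1), A, B.
pose J k := projT1 (cid (JE k)).
have JP k : KS_ops q1 _ _ (J k) /\ forall x j, D k.+1 (J k x) j = D k x j.
  exact: (projT2 (cid (JE k))).
have NA k l (V : bop (X_ k) (X_ l)) :
    (forall x j, D l (V x) j = D k x j) -> ~ approximable_ops _ _ V.
  have [mue mul] := muP (w k.*2) (ltW (w0 _)) (w_le _).
  exact: (identity_not_approximable q1 qu (w1 _) C1 (w1 _) eta0 eta1 mue eta16 mul).
exists (csum X_); split.
- exact: (shifts_not_nilpotent (fun k => (JP k).1) (fun k => (JP k).2) NA).
- exact: (shifts_not_finite_dimensional (fun k => (JP k).1) (fun k => (JP k).2) NA).
Qed.

Theorem theorem3p5 (R : realType) (s : scalars) :
  [/\ (forall (p q : R) (p1 : 1 <= p) (q1 : 1 <= q), q <= p -> p < 2 ->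
        forall X : closedSubspace (ell s p1),
          KS_ops q1 X X = closure (KS_ops q1 X X) /\
          closure (KS_ops q1 X X) = compact_ops X X),
      (forall (p q : R) (p1 : 1 <= p) (q1 : 1 <= q), p < 2 -> q < 2 -> p != q ->
        exists (X : closedSubspace (ell s p1)) (Y : closedSubspace (ell s q1)),
          approximable_ops X Y `<` compact_ops X Y)
    & (forall (p q : R) (p1 : 1 <= p) (q1 : 1 <= q), p < q -> q < 2 ->
        exists X : closedSubspace (ell s p1),
          ~ nilpotent_algebra (KS_quotient q1 X) /\
          ~ finite_dimensional (KS_quotient q1 X))].
Proof.
split=> [p q p1 q1 qp p2 X|p q p1 q1 p2 q2 _|p q p1 q1 pq q2].
- exact: KS_ops_subspace.
- exact: exists_not_approximable.
- exact: exists_non_nilpotent_quotient.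
Qed.
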